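(* Let $\Phi$ be a stationary point process in $\mathbb{R}^d$ of unit intensity such that for every $j\ge1$ the joint intensity $\rho^{(j)}$ is almost everywhere continuous, scaling functions $f^j,g^j_\rho$ for $\rho^{(j)}$ (as defined in the context) exist with $g^j_\rho$ almost everywhere continuous, and $f^{j+1}=O(f^j)$ as $r\to0$. Let $r_n\to0$. Assume further that $\tilde\mu_0(\Phi,\tilde\Gamma_{k+2})>0$ for all $k\in\{1,\ldots,d-1\}$ and $\mu_0(\Phi,O_k)>0$ for all $k\ge1$. Then $$\lim_{n\to\infty}\frac{\mathbb{E}\{\beta_k(C(\Phi_n,r_n))\}}{n r_n^{d(k+1)}f^{k+2}(r_n)}=\tilde\mu_0(\Phi,\tilde\Gamma_{k+2}),\qquad k\in\{1,\ldots,d-1\},$$ $$\lim_{n\to\infty}\frac{\mathbb{E}\{\beta_k(R(\Phi_n,r_n))\}}{n r_n^{d(2k+1)}f^{2k+2}(r_n)}=\mu_0(\Phi,O_k),\qquad k\ge1,$$ and for $k=0$, $$\lim_{n\to\infty}\frac{\mathbb{E}\{\beta_0(C(\Phi_n,r_n))\}}{n}=\lim_{n\to\infty}\frac{\mathbb{E}\{\beta_0(R(\Phi_n,r_n))\}}{n}=1.$$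
   Context: A point process $\Phi$ in $\mathbb{R}^d$ is a random locally finite counting measure, identified with its random set of points. $\Phi^{(k)}$ is the set of ordered $k$-tuples of pairwise distinct points of $\Phi$; the $k$th joint intensity $\rho^{(k)}$ is the Lebesgue density of the intensity measure of $\Phi^{(k)}$. Standing assumptions: point processes are simple and all joint intensities exist. Stationary means translation invariant in law; unit intensity means $\rho^{(1)}\equiv1$. $W_n=[-n^{1/d}/2,n^{1/d}/2]^d$, $\Phi_n=\Phi\cap W_n$; $B_x(r)$ is the ball of radius $r$ centred at $x$. Scaling functions for $\rho^{(j)}$: if $\rho^{(j)}(0,\ldots,0)=0$, functions $f^j:\mathbb{R}_+\to\mathbb{R}_+$ and $g^j_\rho:(B_0(j))^j\to\mathbb{R}_+$ with $\rho^{(j)}(r\mathbf{y})=\Theta(f^j(r))$ and $\lim_{r\to0}\rho^{(j)}(r\mathbf{y})/f^j(r)=g^j_\rho(\mathbf{y})$ for all $\mathbf{y}=(0,y_2,\ldots,y_j)$; if $\rho^{(j)}(0,\ldots,0)>0$, $f^j\equiv1$ and $g^j_\rho\equiv\rho^{(j)}(0,\ldots,0)$. Complexes: for a finite point set $P$ and $\varepsilon>0$, the Čech complex $C(P,\varepsilon)$ has as $m$-simplices the subsets $\{x_{i_0},\ldots,x_{i_m}\}\subset P$ with $\bigcap_l B_{x_{i_l}}(\varepsilon/2)\ne\varnothing$; the Vietoris–Rips complex $R(P,\varepsilon)$ has as $m$-simplices those with $B_{x_{i_l}}(\varepsilon/2)\cap B_{x_{i_{l'}}}(\varepsilon/2)\neq\varnothing$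 for all pairs. $\beta_k$ is the $k$th Betti number (rank of $k$th simplicial homology over $\mathbb{Z}_2$). The geometric graph $G(P,r)$ has vertex set $P$ and edges between distinct points at distance $\le r$. $O_k$ is the graph on $2k+2$ vertices $\pm e_1,\ldots,\pm e_{k+1}$ ($1$-skeleton of the boundary of the $(k+1)$-dimensional cross-polytope), all pairs being adjacent except antipodal ones. $\tilde\Gamma_j$ is the abstract simplicial complex on $j$ vertices in which every $j-1$ vertices form a face but the set of all $j$ vertices is not a face. For a connected graph $\Gamma$ on $j\ge2$ vertices and a complex $\Delta$ on $j\ge2$ vertices with connected $1$-skeleton, with $\mathbf{y}=(0,y_2,\ldots,y_j)$ and $d\mathbf{y}=dy_2\cdots dy_j$, $$\mu_0(\Phi,\Gamma)=\frac1{j!}\int_{\mathbb{R}^{d(j-1)}}\mathbf{1}[G(\{0,y_2,\ldots,y_j\},1)\simeq\Gamma]\,g^j_\rho(\mathbf{y})\,d\mathbf{y},$$ $$\tilde\mu_0(\Phi,\Delta)=\frac1{j!}\int_{\mathbb{R}^{d(j-1)}}\mathbf{1}[C(\{0,y_2,\ldots,y_j\},1)\simeq\Delta]\,g^j_\rho(\mathbf{y})\,d\mathbf{y},$$ where $\simeq$ is graph, respectively simplicial, isomorphism.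
   Formalization: Joint intensities are translation-invariant versions; the upper bound in Θ is uniform in y and its lower bound is for the supremum over y; when ρ^(j)(0,…,0)>0, ρ^(j)(ry)→ρ^(j)(0,…,0) boundedly is also assumed (otherwise the claim fails, e.g. a Poisson process with ρ changed on the diagonal). *)

(* Defs.v *)
From HB Require Import structures.
From mathcomp Require Export all_boot all_order all_algebra finmap.
From mathcomp Require Export all_classical all_reals all_analysis.
Export Order.TTheory GRing.Theory Num.Theory.
Export numFieldNormedType.Exports.

Set Implicit Arguments.
Unset Strict Implicit.
Unset Printing Implicit Defensive.

Local Open Scope classical_set_scope.
Local Open Scope ring_scope.

(* A point of R^d is a row vector ['rV[R]_d]; an ordered [j]-tuple of points of
   R^d is a matrix ['M[R]_(j, d)], whose rows are the points.  The library
   provides their topology and linear structure, but neither a sigma-algebra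
   nor a Lebesgue measure, which are built here. *)

Section MatrixMeasurable.
Context {R : realType} (m n : nat).

Definition mx_cylinder : set (set 'M[R]_(m, n)) :=
  [set A | exists i j (B : set R),
     measurable B /\ A = [set M : 'M[R]_(m, n) | B (M i j)]].

Definition measure_mx_display : measure_display.
Proof. by constructor. Qed.

(* The product sigma-algebra of the Borel sigma-algebra of R, that is, the
   Borel sigma-algebra of R^(m x n). *)
HB.instance Definition _ := @isMeasurable.Build measure_mx_display
  'M[R]_(m, n) <<s mx_cylinder >> (@sigma_algebra0 _ setT mx_cylinder)
  (@sigma_algebraC _ mx_cylinder) (@sigma_algebra_bigcup _ setT mx_cylinder).

Lemma measurable_mx_entry i j :
  measurable_fun setT (fun M : 'M[R]_(m, n) => M i j).
Proof.
move=> _ B mB; rewrite setTI; apply: sub_sigma_algebra.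
by exists i, j, B.
Qed.

Lemma measurable_fun_mx d (T : measurableType d) (f : T -> 'M[R]_(m, n)) :
  (forall i j, measurable_fun setT (fun x => f x i j)) ->
  measurable_fun setT f.
Proof.
move=> mf.
apply: (@measurability _ _ T 'M[R]_(m, n) setT f mx_cylinder) => //.
move=> _ [_ [i [j [B [mB ->]]]] <-].
exact: (mf i j measurableT B mB).
Qed.

End MatrixMeasurable.

Section LebesgueRow.
Variable R : realType.

Section Step.
Variables (n : nat) (mu : {sigma_finite_measure set 'rV[R]_n -> \bar R}).

Definition consr (p : measurableTypeR R * 'rV[R]_n) : 'rV[R]_(1 + n) :=
  row_mx (p.1 : R)%:M p.2.

Lemma consr0 p : consr p ord0 ord0 = p.1.
Proof.
rewrite /consr (_ : (ord0 : 'I_(1 + n)) = lshift n ord0); last exact/val_inj.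
by rewrite row_mxEl mxE eqxx.
Qed.

Lemma consrS p (i : 'I_n) : consr p ord0 (lift ord0 i) = p.2 ord0 i.
Proof.
rewrite /consr (_ : lift ord0 i = rshift 1 i); last exact/val_inj.
by rewrite row_mxEr.
Qed.

Lemma measurable_consr : measurable_fun setT consr.
Proof.
apply: measurable_fun_mx => i j; rewrite ord1.
have [k ->|k ->] := split_ordP j.
- rewrite (_ : (fun _ => _) = fst) //.
  by apply/funext => p; rewrite /consr row_mxEl mxE ord1 !eqxx.
- rewrite (_ : (fun _ => _) = (fun v : 'rV[R]_n => v ord0 k) \o snd); last first.
    by apply/funext => p; rewrite /consr row_mxEr.
  by apply: measurableT_comp => //; exact: measurable_mx_entry.
Qed.

Lemma measurable_rsubmx : measurable_fun setT (@rsubmx R 1 1 n).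
Proof.
apply: measurable_fun_mx => i j.
rewrite (_ : (fun _ => _) = (fun v : 'rV[R]_(1 + n) => v i (rshift 1 j))).
  exact: measurable_mx_entry.
by apply/funext => v; rewrite mxE.
Qed.

Definition leb_step : set 'rV[R]_(1 + n) -> \bar R :=
  pushforward (product_measure1 (@lebesgue_measure R) mu) consr.

Let leb_step_measure :=
  measure_function_pushforward__canonical__measure_function_Measure
    (product_measure1 (@lebesgue_measure R) mu) measurable_consr.

HB.instance Definition _ := isMeasure.Build _ _ _ leb_step
  (@measure0 _ _ _ leb_step_measure) (@measure_ge0 _ _ _ leb_step_measure)
  (@measure_semi_sigma_additive _ _ _ leb_step_measure).

Let leb_step_sigma_finite : sigma_finite setT leb_step.
Proof.
have /sigma_finiteP[F [TF ndF Foo]] := sigma_finiteT (@lebesgue_measure R).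
have /sigma_finiteP[G [TG ndG Goo]] := sigma_finiteT mu.
pose H k := [set v : 'rV[R]_(1 + n) | F k (v ord0 (lshift n ord0))] `&`
            [set v | G k (rsubmx v)].
exists H => [|k].
  apply/seteqP; split => // v _.
  have [p _ Fp] : (\bigcup_k F k) (v ord0 (lshift n ord0)) by rewrite -TF.
  have [q _ Gq] : (\bigcup_k G k) (rsubmx v) by rewrite -TG.
  exists (maxn p q) => //; split.
    by move: Fp; rewrite /=; apply/subsetPset/ndF/leq_maxl.
  by move: Gq; rewrite /=; apply/subsetPset/ndG/leq_maxr.
have [mF Fk] := Foo k; have [mG Gk] := Goo k.
split.
  apply: measurableI.
    have := @measurable_mx_entry R 1 (1 + n) ord0 (lshift n ord0).
    by move=> /(_ measurableT _ mF); rewrite setTI.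
  by have := measurable_rsubmx measurableT mG; rewrite setTI.
rewrite /leb_step /pushforward (_ : _ @^-1` _ = F k `*` G k).
  by rewrite product_measure1E// lte_mul_pinfty// ge0_fin_numE.
apply/seteqP; split => -[x v]; rewrite /H /consr /= row_mxKr row_mxEl mxE eqxx//=.
Qed.

HB.instance Definition _ :=
  @Measure_isSigmaFinite.Build _ _ _ leb_step leb_step_sigma_finite.

End Step.

Fixpoint lebesgue_row (n : nat) : {sigma_finite_measure set 'rV[R]_n -> \bar R} :=
  match n with
  | 0 => [the {sigma_finite_measure set 'rV[R]_0 -> \bar R} of dirac (0 : 'rV[R]_0)]
  | n'.+1 => [the {sigma_finite_measure set 'rV[R]_(1 + n') -> \bar R}
                of leb_step (lebesgue_row n')]
  end.

Lemma measurable_vec_mx m n :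
  measurable_fun setT (vec_mx : 'rV[R]_(m * n) -> 'M[R]_(m, n)).
Proof.
apply: measurable_fun_mx => i j.
rewrite (_ : (fun _ => _) = (fun v : 'rV[R]_(m * n) => v ord0 (mxvec_index i j))).
  exact: measurable_mx_entry.
by apply/funext => v; rewrite mxE.
Qed.

Definition lebesgue_mx (m n : nat) : set 'M[R]_(m, n) -> \bar R :=
  pushforward (lebesgue_row (m * n)) vec_mx.

Let lebesgue_mx_measure m n :=
  measure_function_pushforward__canonical__measure_function_Measure
    (lebesgue_row (m * n)) (@measurable_vec_mx m n).

HB.instance Definition _ m n := isMeasure.Build _ _ _ (@lebesgue_mx m n)
  (@measure0 _ _ _ (lebesgue_mx_measure m n))
  (@measure_ge0 _ _ _ (lebesgue_mx_measure m n))
  (@measure_semi_sigma_additive _ _ _ (lebesgue_mx_measure m n)).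

Let measurable_row_box n (A : 'I_n -> set R) : (forall i, measurable (A i)) ->
  measurable [set v : 'rV[R]_n | forall i, A i (v ord0 i)].
Proof.
move=> mA; rewrite (_ : [set v | _] =
    \bigcap_(i in [set: 'I_n]) [set v : 'rV[R]_n | A i (v ord0 i)]).
  apply: fin_bigcap_measurable => // i _.
  have := @measurable_mx_entry R 1 n ord0 i.
  by move=> /(_ measurableT _ (mA i)); rewrite setTI.
by apply/seteqP; split => v /= Av i => [_|]; exact: Av.
Qed.

Lemma lebesgue_row_box n (A : 'I_n -> set R) : (forall i, measurable (A i)) ->
  lebesgue_row n [set v | forall i, A i (v ord0 i)] =
  (\prod_(i < n) lebesgue_measure (A i))%E.
Proof.
elim: n A => [|n IHn] A mA.
  by rewrite big_ord0 /= /dirac indicE mem_set// => -[].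
rewrite big_ord_recl -(IHn (fun i => A (lift ord0 i)))//.
rewrite -product_measure1E; [|exact: mA|]; last first.
  by apply: (measurable_row_box (A := fun i => A (lift ord0 i))) => i; exact: mA.
congr (product_measure1 _ _ _); apply/seteqP; split => -[x v] /=.
  move=> Axv; split => [|i] /=; first by have := Axv ord0; rewrite consr0.
  by have := Axv (lift ord0 i); rewrite consrS.
move=> [/= Ax Av] i; case: (unliftP ord0 i) => [j|] ->; last by rewrite consr0.
by rewrite consrS.
Qed.

(* The normalization that characterizes Lebesgue measure. *)
Lemma lebesgue_mx_box m n (A : 'I_m -> 'I_n -> set R) :
  (forall i j, measurable (A i j)) ->
  lebesgue_mx [set M | forall i j, A i j (M i j)] =
  (\prod_(i < m) \prod_(j < n) lebesgue_measure (A i j))%E.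
Proof.
move=> mA; have [h hK Kh] := curry_mxvec_bij m n.
pose B k := A (h k).1 (h k).2.
have BE i j : B (mxvec_index i j) = A i j.
  by have := hK (i, j); rewrite /B /= => ->.
rewrite pair_bigA /= (reindex (h : 'I_(m * n) -> _)) /=; last first.
  exists (uncurry (@mxvec_index m n)) => [k _|p _]; [exact: Kh|exact: hK].
rewrite -(lebesgue_row_box (A := B)); last by move=> k; exact: mA.
congr (lebesgue_row _ _); apply/seteqP; split => v /= Bv.
  by move=> k; case/mxvec_indexP: k => i j; have := Bv i j; rewrite BE mxE.
by move=> i j; rewrite mxE -BE; exact: Bv.
Qed.

End LebesgueRow.

Section Geometry.
Context {R : realType} {d : nat}.
Implicit Types (r : R).

(* The norm of the library on ['rV[R]_d] is the sup norm. *)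
Definition enorm (x : 'rV[R]_d) : R := Num.sqrt (\sum_(i < d) x ord0 i ^+ 2).

Definition eball (x : 'rV[R]_d) r : set 'rV[R]_d := [set z | enorm (z - x) <= r].

Definition window (n : nat) : set 'rV[R]_d :=
  [set x | forall i, `|x ord0 i| <= n%:R `^ (d%:R^-1) / 2].

Definition geometric_graph (P : {fset 'rV[R]_d}) r : rel P :=
  fun x y => (x != y) && (enorm (val x - val y) <= r).

Definition cech (P : {fset 'rV[R]_d}) (eps : R) : {set {set P}} :=
  finset (fun s : {set P} => (0 < #|s|)%N &&
    `[< exists z, forall x, x \in s -> eball (val x) (eps / 2) z >]).

Definition rips (P : {fset 'rV[R]_d}) (eps : R) : {set {set P}} :=
  finset (fun s : {set P} => (0 < #|s|)%N &&
    `[< forall x y, x \in s -> y \in s ->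
          eball (val x) (eps / 2) `&` eball (val y) (eps / 2) !=set0 >]).

Definition points (j : nat) (y : 'M[R]_(j, d)) : {fset 'rV[R]_d} :=
  [fset row i y | i in 'I_j]%fset.

End Geometry.
Arguments window {R d} n.

Section Homology.
Variables (V : finType) (K : {set {set V}}).

Definition simplices (k : nat) : {set {set V}} :=
  finset (fun s : {set V} => (s \in K) && (#|s| == k.+1)).

(* The boundary operator from (k+1)-chains to k-chains over Z_2, acting on row
   vectors indexed by the simplices of each dimension. *)
Definition boundary (k : nat) : 'M['F_2]_(#|simplices k.+1|, #|simplices k|) :=
  \matrix_(i, j) ((enum_val j : {set V}) \subset (enum_val i : {set V}))%:R.

Definition dim_cycles (k : nat) : nat :=
  if k is k'.+1 then \rank (kermx (boundary k')) else #|simplices 0|.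

Definition betti (k : nat) : nat := (dim_cycles k - \rank (boundary k))%N.

End Homology.

Definition graph_iso (V W : finType) (e : rel V) (e' : rel W) : Prop :=
  exists2 h : V -> W, bijective h & forall x y, e' (h x) (h y) = e x y.

Definition complex_iso (V W : finType)
    (K : {set {set V}}) (L : {set {set W}}) : Prop :=
  exists2 h : V -> W, bijective h &
    forall s : {set V}, (imset h (mem s) \in L) = (s \in K).

(* The 1-skeleton of the boundary of the (k+1)-dimensional cross-polytope; the
   vertex [(b, i)] stands for [e_i] or [- e_i] according to [b]. *)
Definition cross_polytope_graph (k : nat) : rel (bool * 'I_k.+1) :=
  fun u v => u.2 != v.2.

(* The proper nonempty subsets of a [j]-element set. *)
Definition hollow_simplex (j : nat) : {set {set 'I_j}} :=
  finset (fun s : {set 'I_j} => (0 < #|s| < j)%N).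

Section PointProcess.
Context {R : realType} {d : nat}.

(* A simple point configuration is identified with its set of points, and the
   sigma-algebra is generated by the numbers of points in Borel sets. *)
Definition count_events : set (set (set 'rV[R]_d)) :=
  [set E | exists (B : set 'rV[R]_d) (k : nat), measurable B /\
     E = [set phi | counting (phi `&` B) = k%:R%:E :> \bar R]].

Definition configuration := g_sigma_algebraType count_events.

Definition locally_finite (phi : set 'rV[R]_d) : Prop :=
  forall r, finite_set (phi `&` eball 0 r).

(* Ordered [k]-tuples of pairwise distinct points. *)
Definition distinct_tuples (k : nat) (phi : set 'rV[R]_d) : set 'M[R]_(k, d) :=
  [set y | (forall i, phi (row i y)) /\ injective (fun i => row i y)].

Context {disp : measure_display} {Omega : measurableType disp}
  (P : probability Omega R) (Phi : Omega -> configuration).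

Definition stationary : Prop :=
  forall (x : 'rV[R]_d) (E : set configuration), measurable E ->
    P [set w | E [set z + x | z in (Phi w : set 'rV[R]_d)]] = P [set w | E (Phi w)].

(* [rho] is a density of the intensity measure of the distinct [k]-tuples. *)
Record joint_intensity (k : nat) (rho : 'M[R]_(k, d) -> R) : Prop := {
  joint_intensity_ge0 : forall y, 0 <= rho y ;
  joint_intensity_measurable : measurable_fun setT rho ;
  joint_intensity_density : forall A : set 'M[R]_(k, d), measurable A ->
    (\int[P]_w counting (@distinct_tuples k (Phi w) `&` A) =
     \int[@lebesgue_mx R k d]_(y in A) (rho y)%:E)%E }.

End PointProcess.
Arguments configuration : clear implicits.

Section Scaling.
Context {R : realType} {d : nat}.

Definition translation_invariant (j : nat) (rho : 'M[R]_(j, d) -> R) : Prop :=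
  forall (x : 'rV[R]_d) (y : 'M[R]_(j, d)),
    rho (\matrix_i (row i y + x)) = rho y.

(* The tuple (0, y_2, ..., y_j) with j = m + 1. *)
Definition with0 (m : nat) (y : 'M[R]_(m, d)) : 'M[R]_(m.+1, d) :=
  col_mx (0 : 'rV[R]_d) y.

Definition tuple_ball (m : nat) : set 'M[R]_(m, d) :=
  [set y | forall i, eball 0 m.+1%:R (row i y)].

(* [f] and [g] are scaling functions for [rho], the joint intensity of order
   [j = m + 1].  The relation rho (r y) = Theta (f r) is the equality of the
   orders of magnitude of [f r] and of the supremum of [rho (r y)] over [y]: a
   lower bound for each [y] cannot hold at tuples with repeated points, such as
   0, where rho vanishes.  The last clause fixes the choice of [f] and [g] when
   rho does not vanish at 0; the previous ones then say that rho (r y) tends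
   boundedly to rho (0). *)
Record scaling_functions (m : nat) (rho : 'M[R]_(m.+1, d) -> R)
    (f : R -> R) (g : 'M[R]_(m.+1, d) -> R) : Prop := {
  scaling_f_ge0 : forall r, 0 <= r -> 0 <= f r ;
  scaling_f_gt0 : \forall r \near 0^'+, 0 < f r ;
  scaling_g_ge0 : forall y, tuple_ball y -> 0 <= g (with0 y) ;
  scaling_upper : exists2 C, 0 < C & \forall r \near 0^'+,
    forall y, tuple_ball y -> rho (r *: with0 y) <= C * f r ;
  scaling_lower : exists2 c, 0 < c & \forall r \near 0^'+,
    exists2 y, tuple_ball y & c * f r <= rho (r *: with0 y) ;
  scaling_limit : forall y, tuple_ball y ->
    rho (r *: with0 y) / f r @[r --> 0^'+] --> g (with0 y) ;
  scaling_nonvanishing : 0 < rho 0 ->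
    (forall r, 0 <= r -> f r = 1) /\
    (forall y, tuple_ball y -> g (with0 y) = rho 0) }.

(* The two constants below integrate over the m = j - 1 points y_2, ..., y_j. *)
Definition mu0 (m : nat) (g : 'M[R]_(m.+1, d) -> R)
    (V : finType) (Gamma : rel V) : \bar R :=
  (((m.+1)`!%:R^-1)%:E * \int[@lebesgue_mx R m d]_y
    ((\1_[set y | graph_iso (@geometric_graph R d (points (with0 y)) 1) Gamma] y
      * g (with0 y))%:E))%E.

Definition mu0_cech (m : nat) (g : 'M[R]_(m.+1, d) -> R)
    (V : finType) (Delta : {set {set V}}) : \bar R :=
  (((m.+1)`!%:R^-1)%:E * \int[@lebesgue_mx R m d]_y
    ((\1_[set y | complex_iso (cech (points (with0 y)) 1) Delta] y
      * g (with0 y))%:E))%E.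

End Scaling.

(* Main.v *)
From HB Require Import structures.
Require Import Defs.
From mathcomp Require Import ring lra measurable_realfun.

Set Implicit Arguments.
Unset Strict Implicit.
Unset Printing Implicit Defensive.

Local Open Scope ring_scope.

(** In the sparse regime a homology class is carried by the smallest vertex set
    that can carry it, and every other configuration costs at least one more
    point in a ball of radius of order [r n], that is, a factor [r n ^+ d].

    Deterministic part.  Let [p] be the least number of vertices of a complex
    with nonzero homology in degree [k]: [p = k + 2] for an arbitrary complex,
    where the hollow simplex is the only extremal one, and [p = 2k + 2] for a
    flag complex, where the cross-polytope is (lemmas [hollow_local] and
    [flag_cycle]).  Call the extremal vertex sets cores.  The cycles of isolated
    cores are independent modulo boundaries ([betti_ge]).  Conversely a cycle is
    a sum of boundaries, cycles of cores, and simplices whose component has more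
    than [p] vertices ([betti_le]).  Hence the Betti number differs from the
    number of cores by at most the number of [p + 1]-tuples of points whose
    mutual distances are of order [r n] ([betti_core_count]).  The number of
    cores is [1 / p!] times a number of ordered tuples of a given shape, and the
    shape is invariant under translation and scaling.

    Probabilistic part.  The expected number of ordered tuples in a Borel set is
    the integral of a joint intensity.  The substitution
    [y = (x, x + r z_2, ..., x + r z_p)] has Jacobian [r ^+ (d * (p - 1))]
    ([lebesgue_spread]); by translation invariance the variable [x] integrates to
    the volume of the window up to a boundary layer ([local_integral_le],
    [local_integral_ge]), and the integral over [z] converges after division by
    the scaling function, by dominated convergence ([profile_cvg]).  This gives
    the asymptotics of the expected counts ([expected_count_cvg]).  Applied to
    [p + 1]-tuples it makes the error term negligible, because
    [r ^+ d * f_{p+1} / f_p] tends to 0 ([near_count_negligible]); squeezing then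
    yields the limit ([sandwich_limit]).  In degree 0 the same argument applies
    with [p = 1], a core being a point. *)

(** * Chains over the field with two elements *)

Section Chains.
Variable T : finType.
Implicit Types (z w : {set T} -> 'F_2) (s t U : {set T}).

(** A chain is a function on all vertex sets and the boundary is not graded; a
    chain of dimension [k] is one supported on sets of [k + 1] elements.  The
    empty set is allowed, so that this is the reduced (augmented) boundary. *)
Definition bd z t : 'F_2 := \sum_(x | x \notin t) z (x |: t).

Lemma F2_addxx (a : 'F_2) : a + a = 0.
Proof. by rewrite -mulr2n -mulr_natr char_Zp ?mulr0. Qed.

Lemma F2_cases (a : 'F_2) : a = 0 \/ a = 1.
Proof. by case: a => -[|[|//]] i; [left|right]; apply/val_inj. Qed.

Lemma F2_eq (a b : 'F_2) : a + b = 0 -> a = b.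
Proof. by move=> ab; rewrite -[a]addr0 -(F2_addxx b) addrA ab add0r. Qed.

Lemma eq_bd z w : z =1 w -> bd z =1 bd w.
Proof. by move=> zw t; apply: eq_bigr => x _. Qed.

Lemma bdD z w t : bd (fun s => z s + w s) t = bd z t + bd w t.
Proof. exact: big_split. Qed.

Lemma bd0 t : bd (fun=> 0) t = 0.
Proof. exact: big1. Qed.

(** In characteristic 2 the terms of (x, y) and (y, x) cancel. *)
Lemma sum_sym_pairs (D : {set T}) (F : T -> T -> 'F_2) :
  (forall x y, F x y = F y x) ->
  \sum_(x in D) \sum_(y in D :\ x) F x y = 0.
Proof.
elim: {D}#|D| {-2}D (erefl #|D|) => [D|n IH D] cD Fs.
  by rewrite (cards0_eq cD) big_set0.
have [a aD] : exists a, a \in D by apply/card_gt0P; rewrite cD.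
rewrite (big_setD1 a) //=.
have cDa : #|D :\ a| = n by move: cD; rewrite (cardsD1 a) aD => -[].
rewrite [X in _ + X](eq_bigr (fun x => F x a + \sum_(y in D :\ a :\ x) F x y)); last first.
  move=> x; rewrite !inE => /andP[xa xD].
  rewrite (big_setD1 a) ?inE 1?eq_sym ?xa //; congr (_ + _).
  by apply: eq_bigl => y; rewrite !inE; case: (y == a); rewrite ?andbF.
rewrite big_split /= (IH _ cDa Fs) addr0 -[RHS](F2_addxx (\sum_(i in D :\ a) F a i)).
by congr (_ + _); apply: eq_bigr => x _.
Qed.

Lemma bd_bd z t : bd (bd z) t = 0.
Proof.
rewrite /bd -[RHS](sum_sym_pairs (~: t) (F := fun x y => z (y |: (x |: t)))).
  apply: eq_big => [x|x xt]; rewrite ?inE//.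
  by apply: eq_bigl => y; rewrite !inE negb_or.
by move=> x y; rewrite finset.setUCA.
Qed.

End Chains.

(** * Cycles of a flag complex on few vertices *)

Section Flag.
Variables (T : finType) (e : rel T).
Hypothesis e_sym : symmetric e.
Implicit Types (z w : {set T} -> 'F_2) (s t U : {set T}).

Definition clique s := [forall x in s, forall y in s, (x != y) ==> e x y].

Definition cliques n U : {set {set T}} :=
  [set s : {set T} | [&& s \subset U, #|s| == n & clique s]].

Definition link U v := [set y in U | (y != v) && e v y].

Definition non_neighbors U x := [set y in U | (y != x) && ~~ e x y].

(** The cross-polytope graph on [2n] vertices is characterized by the fact that
    each vertex has exactly one non-neighbour. *)
Definition cross n U := (#|U| == n.*2) && [forall x in U, #|non_neighbors U x| == 1%N].

Lemma cliqueP s :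
  reflect (forall x y, x \in s -> y \in s -> x != y -> e x y) (clique s).
Proof.
apply: (iffP forall_inP) => [H x y xs ys xy|H x xs].
  by have /forall_inP/(_ y ys)/implyP := H x xs; exact.
by apply/forall_inP => y ys; apply/implyP; exact: H.
Qed.

Lemma cliqueS s t : s \subset t -> clique t -> clique s.
Proof.
by move=> /fintype.subsetP st /cliqueP H; apply/cliqueP => x y xs ys;
  apply: H; exact: st.
Qed.

Lemma cliqueU1 x s : clique (x |: s) = clique s && [forall y in s, (x != y) ==> e x y].
Proof.
apply/idP/andP => [C|[/cliqueP C /forall_inP H]].
  split; first exact: cliqueS (finset.subsetUr _ _) C.
  apply/forall_inP => y ys; apply/implyP; apply: (cliqueP _ C).
    exact: setU11.
  exact: setU1r.
have {}H y : y \in s -> x != y -> e x y by move=> ys; apply/implyP/H.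
apply/cliqueP => a b /setU1P[->|aS] /setU1P[->|bS].
- by rewrite eqxx.
- exact: H.
- by rewrite eq_sym e_sym; exact: H.
- exact: C.
Qed.

Section Cross.
Variables (n : nat) (U : {set T}).
Hypothesis crossU : cross n U.

Let cardU : #|U| = n.*2. Proof. by case/andP: crossU => /eqP. Qed.

Definition antipode x := odflt x [pick y in non_neighbors U x].

Lemma non_neighborsE x : x \in U -> non_neighbors U x = [set antipode x].
Proof.
move=> xU; have /andP[_ /forall_inP/(_ x xU)/cards1P[y Hy]] := crossU.
rewrite /antipode Hy; case: pickP => [u|/(_ y)]; rewrite inE ?eqxx//.
by move=> /eqP->.
Qed.

Lemma antipodeP x y : x \in U -> y \in U ->
  (y == antipode x) = (y != x) && ~~ e x y.
Proof.
by move=> xU yU; rewrite -finset.in_set1 -non_neighborsE// inE yU.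
Qed.

Lemma antipode_in x : x \in U -> antipode x \in U.
Proof.
move=> xU; have : antipode x \in non_neighbors U x.
  by rewrite non_neighborsE// set11.
by rewrite inE => /andP[].
Qed.

Lemma antipodeK x : x \in U -> antipode (antipode x) = x.
Proof.
move=> xU; have aU := antipode_in xU; apply/esym/eqP.
by rewrite antipodeP// eq_sym e_sym -antipodeP.
Qed.

Lemma antipode_neq x : x \in U -> antipode x != x.
Proof. by move=> xU; have := eqxx (antipode x); rewrite {1}antipodeP ?antipode_in// => /andP[]. Qed.

Lemma antipode_nadj x : x \in U -> e x (antipode x) = false.
Proof. by move=> xU; have := eqxx (antipode x); rewrite {1}antipodeP ?antipode_in// => /andP[_ /negbTE]. Qed.

Definition extension t := [set u in U | (u \notin t) && [forall y in t, e u y]].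

(** The vertices outside a clique by which it cannot be extended are exactly the
    antipodes of its vertices, and there are as many of them as vertices. *)
Lemma card_extension t : t \subset U -> clique t ->
  (#|extension t| + #|t|.*2 = n.*2)%N.
Proof.
move=> /fintype.subsetP tU /cliqueP tC.
have inj : {in t &, injective antipode}.
  by move=> x y xt yt xy; rewrite -[x]antipodeK ?tU// xy antipodeK ?tU.
have E : U = extension t :|: (t :|: antipode @: t).
  apply/setP => u; rewrite !inE; apply/idP/idP.
    move=> uU; rewrite uU /=; case: (boolP (u \in t)) => ut //=; rewrite ?orbT//.
    case: (boolP [forall y in t, e u y]) => //= /forall_inPn[y yt nuy].
    apply/imsetP; exists y => //.
    apply/eqP; rewrite antipodeP ?(tU _ yt)// e_sym nuy andbT.
    by apply: contraNneq ut => ->.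
  case/orP => [/andP[]//|/orP[|/imsetP[y yt ->]]]; first exact: tU.
  by rewrite antipode_in ?tU.
rewrite -cardU [in RHS]E cardsU cardsU.
have -> : t :&: antipode @: t = finset.set0.
  apply/setP => u; rewrite !inE; apply/negP => /andP[ut /imsetP[y yt uy]].
  have yU := tU _ yt.
  have := antipode_nadj yU; rewrite -uy tC//.
  by apply/eqP => yu; have := antipode_neq yU; rewrite -uy yu eqxx.
rewrite cards0 subn0 (card_in_imset inj) addnn.
suff -> : extension t :&: (t :|: antipode @: t) = finset.set0 by rewrite cards0 subn0.
apply/setP => u; rewrite !inE; apply/negP => /andP[/andP[uU /andP[ut /forall_inP uadj]]].
rewrite (negbTE ut) /= => /imsetP[y yt uy].
by have := uadj _ yt; rewrite e_sym uy antipode_nadj ?tU.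
Qed.

Lemma cross_clique_card t : t \subset U -> clique t -> (#|t| <= n)%N.
Proof. by move=> tU tC; rewrite -leq_double -(card_extension tU tC) leq_addl. Qed.

Lemma cross_extend t : t \subset U -> clique t ->
  exists2 s, s \in cliques n U & t \subset s.
Proof.
move=> tU tC.
elim: {t}_.+1 {-2}t (ltnSn (n - #|t|)%N) tU tC => // m IH t tm tU tC.
have := card_extension tU tC; case: (posnP #|extension t|) => [-> /double_inj tn|].
  by exists t => //; rewrite inE tU tC tn eqxx.
case/card_gt0P => u; rewrite inE => /and3P[uU ut /forall_inP ue] tcard.
have utC : clique (u |: t).
  rewrite cliqueU1 tC /=; apply/forall_inP => y yt.
  by rewrite ue// implybT.
have utU : u |: t \subset U by rewrite finset.subUset finset.sub1set uU.
have le := cross_clique_card utU utC.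
have [||//|s sn uts] := IH (u |: t) => //.
  move: le; rewrite cardsU1 ut /= add1n => le.
  by rewrite -ltnS; apply: leq_trans tm; rewrite ltnS ltn_sub2l.
by exists s => //; apply: fintype.subset_trans uts; exact: finset.subsetUr.
Qed.

(** A clique with [n - 1] vertices lies in exactly two cliques with [n] vertices,
    which differ by an antipodal pair.  A cycle takes the same value on both, and
    any two cliques with [n] vertices are joined by such exchanges. *)
Lemma cross_cycle_const z :
  (forall s, z s != 0 -> s \in cliques n U) -> (forall t, bd z t = 0) ->
  {in cliques n U &, forall s s', z s = z s'}.
Proof.
move=> zsupp zcyc s s'.
elim: {s}_.+1 {-2}s (ltnSn #|s :\: s'|) => // m IH s sm sn s'n.
move: (sn) (s'n); rewrite !inE => /and3P[sU /eqP scard sC] /and3P[s'U /eqP s'card s'C].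
have [/eqP/eqP|/set0Pn[x]] := boolP (s :\: s' == finset.set0).
  rewrite finset.setD_eq0 => ss'; congr z.
  by apply/eqP; rewrite eqEcard ss' scard s'card leqnn.
rewrite inE => /andP[xs' xs].
have xU : x \in U by exact: (fintype.subsetP sU).
set y := antipode x; set t := s :\ x.
have yU : y \in U by exact: antipode_in.
have ys' : y \in s'.
  apply: contraT => ys'; have := card_extension s'U s'C.
  rewrite s'card -[RHS]add0n => /addIn /cards0_eq/setP/(_ y).
  rewrite !inE yU ys' /= => /negbT/forall_inPn[u us' nyu].
  have uU : u \in U by exact: (fintype.subsetP s'U).
  suff ux : u = x by rewrite -ux us' in xs'.
  rewrite -[x]antipodeK//; apply/eqP; rewrite antipodeP//.
  by rewrite nyu andbT; apply: contraNneq ys' => uy; rewrite /y -uy.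
have ys : y \notin s.
  apply/negP => ys; have := antipode_nadj xU; rewrite (cliqueP _ sC)//.
  by rewrite eq_sym antipode_neq.
have tU : t \subset U by apply: fintype.subset_trans sU; exact: subsetDl.
have tC : clique t by apply: cliqueS sC; exact: subsetDl.
have xt : x \notin t by rewrite !inE eqxx.
have yt : y \notin t by rewrite !inE (negbTE ys) andbF.
have xy : x != y by rewrite eq_sym antipode_neq.
have tcard : (#|t|.+1 = n)%N by rewrite -scard (cardsD1 x s) xs.
have xtE : x |: t = s by rewrite finset.setD1K.
have xext : x \in extension t.
  rewrite inE xU xt /=; apply/forall_inP => u; rewrite !inE => /andP[ux us].
  by apply: (cliqueP _ sC) => //; rewrite eq_sym.
have yext : y \in extension t.
  rewrite inE yU yt /=; apply/forall_inP => u; rewrite !inE => /andP[ux us].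
  have uU := fintype.subsetP sU _ us.
  apply/negPn/negP => nyu; have : u == antipode y.
    by rewrite antipodeP// nyu andbT; apply: contraNneq ys => <-.
  by rewrite antipodeK// (negbTE ux).
have extE : extension t = [set x; y].
  apply/esym/eqP; rewrite eqEcard finset.subUset !finset.sub1set xext yext /= cards2 xy.
  have := card_extension tU tC; rewrite -[in RHS]tcard doubleS -addn2 addnC.
  by move=> /addnI ->.
have ytn : y |: t \in cliques n U.
  rewrite inE finset.subUset finset.sub1set yU tU cardsU1 yt /= add1n tcard eqxx /=.
  rewrite cliqueU1 tC /=; apply/forall_inP => u ut.
  by move: yext; rewrite inE => /and3P[_ _ /forall_inP/(_ u ut)->]; rewrite implybT.
have : bd z t = z s + z (y |: t).
  rewrite /bd (bigD1 x)//= xtE (bigD1 y) ?yt 1?eq_sym//= big1 ?addr0// => u.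
  move=> /andP[/andP[ut ux] uy]; apply/eqP; apply: contraT => /zsupp.
  rewrite inE => /and3P[uU _ uC]; have : u \in extension t.
    rewrite inE ut (fintype.subsetP uU) ?setU11//=.
    apply/forall_inP => v vt; apply: (cliqueP _ uC); rewrite ?setU11 ?setU1r//.
    by apply: contraNneq ut => ->.
  by rewrite extE !inE (negbTE ux) (negbTE uy).
rewrite zcyc => /esym/F2_eq ->; apply: (IH (y |: t)) => //.
rewrite -ltnS; apply: leq_trans sm; rewrite ltnS.
have -> : (y |: t) :\: s' = (s :\: s') :\ x.
  apply/setP => u; rewrite !inE; case: (eqVneq u y) => [->|_]; first by rewrite ys' /= andbF.
  by rewrite /= andbCA.
by rewrite [X in (_ < X)%N](cardsD1 x) !inE xs xs'.
Qed.

Definition clique_cycle m s : 'F_2 := (s \in cliques m U)%:R.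

(** Each clique with [n - 1] vertices is a face of exactly two facets. *)
Lemma cross_cycle t : (0 < n)%N -> bd (clique_cycle n) t = 0.
Proof.
move=> n_gt0; rewrite /bd /clique_cycle.
have [/and3P[tU /eqP tcard tC]|] := boolP [&& t \subset U, #|t| == n.-1 & clique t]; last first.
  move=> H; apply: big1 => x xt; case: (boolP (_ \in _)) => // xtn; case/negP: H.
  move: xtn; rewrite inE => /and3P[U1 /eqP c1 C1].
  rewrite (fintype.subset_trans (finset.subsetUr _ _) U1) (cliqueS (finset.subsetUr _ _) C1).
  by rewrite -c1 cardsU1 xt /= eqxx.
rewrite (eq_bigr (fun x => (x \in extension t)%:R)); last first.
  move=> x xt; congr (_%:R); congr nat_of_bool; rewrite !inE xt /= finset.subUset finset.sub1set tU andbT.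
  rewrite cardsU1 xt tcard /= add1n prednK// eqxx /= cliqueU1 tC /=; congr (_ && _).
  apply: eq_forallb => y; case: (boolP (y \in t)) => //= yt.
  by have -> : x != y by apply: contraNneq xt => ->.
have := card_extension tU tC; rewrite tcard -[in RHS](prednK n_gt0) doubleS -addn2 addnC.
move=> /addnI ext2.
rewrite (bigID (mem (extension t))) /= [X in _ + X]big1 ?addr0; last by move=> x /andP[_ /negbTE->].
rewrite (eq_bigr (fun=> 1)); last by move=> x /andP[_ ->].
rewrite (eq_bigl (mem (extension t))); last first.
  by move=> x /=; case: (boolP (x \in extension t)); rewrite ?andbF// inE => /and3P[_ ->].
by rewrite sumr_const ext2 mulr2n F2_addxx.
Qed.

End Cross.

Definition chain_on (A : {set {set T}}) z := forall s, z s != 0 -> s \in A.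

(** If [z = v * a + b] with [a] and [b] avoiding the vertex [v], then [spoke v z]
    is [a], and [cone v w] is the join of [v] with [w]. *)
Definition spoke v z t : 'F_2 := if v \in t then 0 else z (v |: t).

Definition cone v w t : 'F_2 := if v \in t then w (t :\ v) else 0.

(** The terms of the boundary of [v * a + b] that contain [v] are those of
    [v] joined with the boundary of [a]. *)
Lemma bd_spoke v z : (forall t, bd z t = 0) -> forall t, bd (spoke v z) t = 0.
Proof.
move=> zcyc t; rewrite /bd /spoke; have [vt|vt] := boolP (v \in t).
  by apply: big1 => x _; rewrite inE vt orbT.
rewrite -[RHS](zcyc (v |: t)) /bd (bigD1 v)//= setU11 add0r.
apply: eq_big => [x|x /andP[xt xv]]; first by rewrite !inE negb_or andbC.
by rewrite !inE eq_sym (negbTE xv) (negbTE vt) finset.setUCA.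
Qed.

Lemma bd_cone v w t : (forall s, v \in s -> w s = 0) ->
  bd (cone v w) t = if v \in t then bd w (t :\ v) else w t.
Proof.
move=> wv; rewrite /bd /cone; case: ifPn => vt.
  rewrite [in RHS](bigD1 v) ?inE ?eqxx//= finset.setD1K// wv// add0r.
  apply: eq_big => [x|x xt].
    by rewrite !inE negb_and negbK; case: (eqVneq x v) => [->|]; rewrite ?vt ?andbF ?andbT.
  have xv : x != v by apply: contraNneq xt => ->.
  rewrite !inE vt orbT; congr w; apply/setP => u; rewrite !inE.
  by case: (eqVneq u v) => [->|_] //=; rewrite eq_sym (negbTE xv).
rewrite (bigD1 v)//= setU11 setU1K// big1 ?addr0// => x /andP[_ xv].
by rewrite !inE eq_sym (negbTE xv) (negbTE vt).
Qed.

Lemma spoke_chain n U v z : v \in U -> chain_on (cliques n.+1 U) z ->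
  chain_on (cliques n (link U v)) (spoke v z).
Proof.
move=> vU zc t; rewrite /spoke; case: ifPn => [_|vt /zc]; first by rewrite eqxx.
rewrite !inE finset.subUset cardsU1 vt add1n eqSS cliqueU1 => /and3P[/andP[_ tU] -> /andP[-> /forall_inP H]].
rewrite !andbT; apply/fintype.subsetP => x xt; rewrite inE (fintype.subsetP tU)//=.
have xv : x != v by apply: contraNneq vt => <-.
by have := H x xt; rewrite eq_sym xv.
Qed.

Lemma cone_chain n U v w : v \in U -> chain_on (cliques n (link U v)) w ->
  chain_on (cliques n.+1 U) (cone v w).
Proof.
move=> vU wc t; rewrite /cone; case: ifPn => [vt /wc|_]; last by rewrite eqxx.
rewrite inE => /and3P[/fintype.subsetP tU tn tC]; rewrite -(finset.setD1K vt) inE.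
rewrite finset.subUset finset.sub1set vU cardsU1 !inE eqxx add1n eqSS tn /= cliqueU1 tC.
apply/andP; split; last first.
  by apply/forall_inP => y /tU; rewrite inE => /and3P[_ _ ->]; rewrite implybT.
by apply/fintype.subsetP => y /tU; rewrite inE => /andP[].
Qed.

Lemma cliques_mono n U U' : U \subset U' -> cliques n U \subset cliques n U'.
Proof.
move=> UU'; apply/fintype.subsetP => s; rewrite !inE => /and3P[sU -> ->].
by rewrite (fintype.subset_trans sU UU').
Qed.

Lemma link_sub U v : link U v \subset U :\ v.
Proof. by apply/fintype.subsetP => x; rewrite !inE => /and3P[-> -> _]. Qed.

Lemma card_link U v : v \in U -> (#|link U v| + #|non_neighbors U v|).+1 = #|U|.
Proof.
move=> vU; rewrite (cardsD1 v U) vU -cardsUI; congr (_.+1).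
have -> : link U v :&: non_neighbors U v = finset.set0.
  by apply/setP => x; rewrite !inE; case: (e v x); rewrite ?andbF.
rewrite cards0 addn0; apply: eq_card => x; rewrite !inE.
by case: (e v x); rewrite /= ?andbT ?andbF ?orbF andbC.
Qed.

(** By induction on [n], then on the number of vertices.  Write [z = v * a + b],
    where [a] is a cycle in the link of [v].  If [a] bounds [w] in some link, then
    adding the boundary of [v * w] to [z] removes [v].  Otherwise every link has
    at least [2n - 2] vertices by induction, and no vertex is adjacent to all the
    others (if [v] were, [b] would bound [a] in the link); counting vertices,
    each of them has exactly one non-neighbour. *)
Lemma flag_cycle n U z : (#|U| <= n.*2)%N ->
  chain_on (cliques n U) z -> (forall t, bd z t = 0) ->
  (exists2 w, chain_on (cliques n.+1 U) w & bd w =1 z) \/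
  (cross n U /\ z =1 clique_cycle U n).
Proof.
elim: n U z => [|n IHn] U z.
  rewrite leqn0 => /eqP/cards0_eq -> zc _.
  have z0 s : s != finset.set0 -> z s = 0.
    move=> s0; apply/eqP; apply: contraT => /zc.
    by rewrite inE finset.subset0 (negbTE s0).
  have empty_clique : finset.set0 \in cliques 0 finset.set0.
    by rewrite inE finset.sub0set cards0 eqxx; apply/cliqueP => x; rewrite inE.
  have [zz|zz] := F2_cases (z finset.set0); [left|right].
    exists (fun=> 0) => [s|s]; first by rewrite eqxx.
    by rewrite bd0; have [->|/z0] := eqVneq s finset.set0.
  split.
    by rewrite /cross cards0 eqxx; apply/forall_inP => x; rewrite inE.
  move=> s; rewrite /clique_cycle; have [->|s0] := eqVneq s finset.set0.
    by rewrite empty_clique.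
  by rewrite z0// inE finset.subset0 (negbTE s0).
elim: {U}_.+1 {-2}U (ltnSn #|U|) z => // m IHm U Um z Un zc zcyc.
(* Eliminate a vertex whose spoke bounds in its link. *)
have [[v vU [w wc wE]]|no_bd] := EM (exists2 v, v \in U &
    exists2 w, chain_on (cliques n.+1 (link U v)) w & bd w =1 spoke v z).
  left; have wv s : v \in s -> w s = 0.
    move=> vs; apply/eqP; apply: contraT => /wc; rewrite inE => /andP[/fintype.subsetP/(_ v vs)].
    by rewrite inE eqxx andbF.
  pose z' t := z t + bd (cone v w) t.
  have UvU : U :\ v \subset U by exact: subsetDl.
  have cU : #|U| = #|U :\ v|.+1 by rewrite (cardsD1 v) vU.
  have z'c : chain_on (cliques n.+1 (U :\ v)) z'.
    move=> t; rewrite /z' bd_cone//; case: ifPn => [vt|vt].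
      by rewrite wE /spoke !inE eqxx finset.setD1K// F2_addxx eqxx.
    have [zt|] := eqVneq (z t) 0.
      rewrite zt add0r => /wc; apply/fintype.subsetP/cliques_mono/link_sub.
    move=> /zc; rewrite !inE => /and3P[tU -> ->] _; rewrite !andbT.
    by rewrite subsetD1 tU vt.
  have z'cyc t : bd z' t = 0 by rewrite /z' bdD zcyc bd_bd addr0.
  have lt1 : (#|U :\ v| < m)%N by rewrite -ltnS -cU.
  have lt2 : (#|U :\ v| <= n.+1.*2)%N by rewrite ltnW// -cU.
  have [[w' w'c w'E]|[/andP[/eqP cUv _] _]] := IHm _ lt1 z' lt2 z'c z'cyc; last first.
    by move: Un; rewrite cU cUv ltnn.
  exists (fun t => cone v w t + w' t) => [t|t]; last first.
    by rewrite bdD w'E /z' addrCA F2_addxx addr0.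
  have [ct|/(cone_chain vU wc)//] := eqVneq (cone v w t) 0.
  by rewrite ct add0r => /w'c; apply/fintype.subsetP/cliques_mono; exact: subsetDl.
(* A vertex adjacent to all the others would make [U] a cone. *)
have cone_free v : v \in U -> non_neighbors U v != finset.set0.
  move=> vU; apply/negP => /eqP nn0; apply: no_bd; exists v => //.
  have linkE : link U v = U :\ v.
    apply/setP => x; rewrite !inE; move/setP/(_ x): nn0; rewrite !inE.
    by case: (x \in U); case: (x == v); case: (e v x).
  exists (fun s => if v \in s then 0 else z s) => [s|t].
    case: ifPn => [_|vs /zc]; first by rewrite eqxx.
    by rewrite linkE !inE subsetD1 vs andbT.
  rewrite /bd /spoke; case: ifPn => vt.
    by apply: big1 => x _; rewrite !inE vt orbT.
  apply: F2_eq; rewrite addrC -[RHS](zcyc t) /bd [in RHS](bigD1 v)//=; congr (_ + _).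
  rewrite (bigD1 v)//= setU11 add0r; apply: eq_bigr => x /andP[_ xv].
  by rewrite !inE eq_sym (negbTE xv) (negbTE vt).
have link_big v : v \in U -> (n.*2 <= #|link U v|)%N.
  move=> vU; rewrite leqNgt; apply/negP => lt.
  have [//|[/andP[/eqP ce _] _]] := IHn _ _ (ltnW lt) (spoke_chain vU zc) (bd_spoke v zcyc).
    by move=> B; apply: no_bd; exists v.
  by rewrite ce ltnn in lt.
have [U0|[v0 v0U]] := set_0Vmem U.
  left; exists (fun=> 0) => [s|s]; first by rewrite eqxx.
  rewrite bd0; apply/esym/eqP; apply: contraT => /zc.
  rewrite inE U0 finset.subset0 => /and3P[/eqP ->]; rewrite cards0.
  by [].
have cUE : #|U| = n.+1.*2.
  apply/eqP; rewrite eqn_leq Un /= -(card_link v0U) doubleS ltnS -addn1 leq_add// ?link_big//.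
  by rewrite card_gt0 cone_free.
have crossU : cross n.+1 U.
  rewrite /cross cUE eqxx; apply/forall_inP => v vU; rewrite eqn_leq card_gt0 cone_free// andbT.
  rewrite -(leq_add2l n.*2) -ltnS addn1 -doubleS -cUE -(card_link vU) ltnS leq_add2r.
  exact: link_big.
have [z0|] := EM (forall s, z s = 0).
  left; exists (fun=> 0) => [s|s]; first by rewrite eqxx.
  by rewrite bd0 z0.
move=> /existsNP[s0 /eqP s0z]; right; split => // s.
have s0c := zc _ s0z.
rewrite /clique_cycle; case: (boolP (s \in _)) => sc; last first.
  by apply/eqP; apply: contraT => /zc; rewrite (negbTE sc).
rewrite (cross_cycle_const crossU zc zcyc sc s0c).
by have [z0|] := F2_cases (z s0); first by rewrite z0 eqxx in s0z.
Qed.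

End Flag.

(** * Upper bound on a Betti number *)

Section Complex.
Variables (T : finType) (K : {set {set T}}).
Implicit Types (z w : {set T} -> 'F_2) (s t U S : {set T}).

Definition adjacent x y := [set x; y] \in K.

Definition expand U := U :|: [set y | [exists x in U, adjacent x y]].

Definition nbhd i x := iter i expand [set x].

Definition adj_closed U := [forall x in U, forall y, adjacent x y ==> (y \in U)].

(** A simplex is crowded when its component has more than [p] vertices.  Iterating
    the one-step neighbourhood [p] times is enough to see it, and keeps the
    vertices at distance at most [p] edges. *)
Definition crowded p s := [exists x in s, p < #|nbhd p x|]%N.

Definition full_chain k S s : 'F_2 := ((s \subset S) && (s \in simplices K k))%:R.

Definition row_of_chain k z : 'rV['F_2]_#|simplices K k| := \row_i z (enum_val i).

Definition chain_of_row k (u : 'rV['F_2]_#|simplices K k|) s : 'F_2 :=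
  \sum_(i | enum_val i == s) u 0 i.

Lemma adj_closedP U :
  reflect (forall x y, x \in U -> adjacent x y -> y \in U) (adj_closed U).
Proof.
apply: (iffP forall_inP) => [H x y xU xy|H x xU].
  by have /forallP/(_ y)/implyP := H x xU; exact.
by apply/forallP => y; apply/implyP; exact: H.
Qed.

Lemma expand_fix U : adj_closed U -> expand U = U.
Proof.
move=> /adj_closedP H; apply/setP => y; rewrite !inE; case: (boolP (y \in U)) => //= yU.
by apply/negbTE/existsP => -[x /andP[xU xy]]; rewrite (H x y) in yU.
Qed.

Lemma expand_closed U : expand U = U -> adj_closed U.
Proof.
move=> E; apply/adj_closedP => x y xU xy; rewrite -E !inE.
by apply/orP; right; apply/exists_inP; exists x.
Qed.

(** Until it becomes closed, the neighbourhood grows by at least one vertex at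
    each step. *)
Lemma nbhd_closed p x : (#|nbhd p x| <= p)%N -> adj_closed (nbhd p x).
Proof.
have H i : (i < #|nbhd i x|)%N \/ adj_closed (nbhd i x).
  elim: i => [|i [IH|IH]]; first by left; rewrite /nbhd /= cards1.
    have [/expand_closed C|ne] := eqVneq (expand (nbhd i x)) (nbhd i x).
      by right; rewrite /nbhd iterS expand_fix.
    left; apply: leq_ltn_trans IH _; rewrite /nbhd iterS.
    by apply: proper_card; rewrite finset.properEneq eq_sym ne finset.subsetUl.
  by right; rewrite /nbhd iterS expand_fix.
by move=> le; have [|//] := H p; rewrite ltnNge le.
Qed.

Lemma sub_nbhd i j x : (i <= j)%N -> nbhd i x \subset nbhd j x.
Proof.
move=> /subnK <-; elim: (j - i)%N => // m IH; rewrite /nbhd addSn iterS.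
exact: fintype.subset_trans IH (finset.subsetUl _ _).
Qed.

Lemma chain_of_row_enum k (u : 'rV_#|simplices K k|) i :
  chain_of_row u (enum_val i) = u 0 i.
Proof.
by rewrite /chain_of_row (big_pred1 i)// => j; rewrite (inj_eq enum_val_inj).
Qed.

Lemma chain_of_rowK k (u : 'rV_#|simplices K k|) : row_of_chain k (chain_of_row u) = u.
Proof. by apply/rowP => i; rewrite mxE chain_of_row_enum. Qed.

Lemma chain_of_row_on k (u : 'rV_#|simplices K k|) :
  chain_on (simplices K k) (chain_of_row u).
Proof.
move=> s; apply: contraNT => sK; apply/eqP; rewrite /chain_of_row big1// => i /eqP si.
by rewrite -si enum_valP in sK.
Qed.

Lemma simplicesP k s : reflect (s \in K /\ #|s| = k.+1) (s \in simplices K k).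
Proof. by rewrite inE; apply: (iffP andP) => -[-> /eqP]. Qed.

Lemma card_facet t s : t \subset s -> #|s| = #|t|.+1 ->
  exists x, forall y, (y \notin t) && (s == y |: t) = (y == x).
Proof.
move=> ts cs; have /cards1P[x xE] : #|s :\: t| == 1%N.
  by rewrite cardsD (finset.setIidPr ts) cs subSnn.
exists x => y; have sE : s = x |: t.
  by rewrite -xE finset.setUC -[LHS](finset.setID s t) (finset.setIidPr ts).
have xt : x \notin t by have := set11 x; rewrite -xE inE => /andP[].
apply/andP/eqP => [[yt /eqP sy]|->]; last by rewrite xt sE.
have yst : y \in s :\: t by rewrite inE yt sy setU11.
by move: yst; rewrite xE inE => /eqP.
Qed.

Lemma row_of_chain_boundary k z : chain_on (simplices K k.+1) z ->
  row_of_chain k.+1 z *m boundary K k = row_of_chain k (bd z).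
Proof.
move=> zc; apply/rowP => j; rewrite !mxE.
set t : {set T} := enum_val j.
have /simplicesP[_ tk] : t \in simplices K k by exact: enum_valP.
rewrite (eq_bigr (fun i => z (enum_val i) * (t \subset (enum_val i : {set T}))%:R)); last first.
  by move=> i _; rewrite !mxE.
rewrite -(big_enum_val (A := mem (simplices K k.+1)) (fun s => z s * (t \subset s)%:R)) /=.
transitivity (\sum_(x | x \notin t) \sum_(s | (s \in simplices K k.+1) && (s == x |: t)) z s); last first.
  apply: eq_bigr => x xt; have [zx|/zc zx] := eqVneq (z (x |: t)) 0.
    by rewrite zx big1// => s /andP[_ /eqP->].
  rewrite (big_pred1 (x |: t))// => s.
  by rewrite andb_idl// => /eqP->.
rewrite (exchange_big_dep (mem (simplices K k.+1)))/=; last by move=> x s _ /andP[].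
apply: eq_bigr => s sk; have /simplicesP[_ ck] := sk.
have [ts|ts] := boolP (t \subset s).
  have [|x xE] := card_facet ts; first by rewrite ck tk.
  by rewrite (big_pred1 x) ?mulr1// => y; rewrite sk /= xE.
by rewrite mulr0 big_pred0// => y; apply/negP => /and3P[_ _ /eqP se]; rewrite se finset.subsetUr in ts.
Qed.

Hypothesis K_closed : forall s t, s \in K -> t \subset s -> t != finset.set0 -> t \in K.

Lemma row_cycle k z : chain_on (simplices K k.+1) z ->
  row_of_chain k.+1 z *m boundary K k = 0 -> forall t, bd z t = 0.
Proof.
move=> zc; rewrite row_of_chain_boundary// => E t.
have [tk|tk] := boolP (t \in simplices K k).
  have := congr1 (fun M : 'rV_#|simplices K k| => M 0 (enum_rank_in tk t)) E.
  by rewrite !mxE enum_rankK_in.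
apply: big1 => x xt; apply/eqP; apply: contraNT tk => /zc/simplicesP[xK].
rewrite cardsU1 xt /= add1n => -[ct]; apply/simplicesP; split => //.
by apply: K_closed xK _ _; rewrite ?finset.subsetUr// -card_gt0 ct.
Qed.

Section Bound.
Variables (k' p : nat) (Core : {set {set T}}).
Let k := k'.+1.
Hypothesis local_homology : forall U z, (#|U| <= p)%N ->
  chain_on (simplices K k) z -> (forall s, z s != 0 -> s \subset U) ->
  (forall t, bd z t = 0) ->
  (exists2 w, chain_on (simplices K k.+1) w & bd w =1 z) \/
  (U \in Core /\ z =1 full_chain k U).

Let core_mx := \matrix_(i < #|Core|) row_of_chain k (full_chain k (enum_val i)).

Let crowded_simplices := [set s in simplices K k | crowded p s].

Let crowded_mx := \matrix_(i < #|crowded_simplices|)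
  row_of_chain k (fun s => (s == enum_val i)%:R).

(** If the support of a cycle contains a simplex that is not crowded, the part of
    the cycle in the component of this simplex is itself a cycle on at most [p]
    vertices, hence a boundary or the cycle of a core; removing it makes the
    support smaller. *)
Lemma cycle_decomposition z : chain_on (simplices K k) z -> (forall t, bd z t = 0) ->
  (row_of_chain k z <= boundary K k + core_mx + crowded_mx)%MS.
Proof.
have [m] := ubnP #|[set s | z s != 0]|; elim: m z => // m IH z zm zc zcyc.
have [[s zs sncr]|no_s] := EM (exists2 s, z s != 0 & ~~ crowded p s); last first.
  have zE : row_of_chain k z =
      \sum_(i < #|crowded_simplices|) z (enum_val i) *: row i crowded_mx.
    apply/rowP => j; rewrite summxE mxE; set s : {set T} := enum_val j.
    rewrite (eq_bigr (fun i => z (enum_val i) * (s == enum_val i)%:R)); last first.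
      by move=> i _; rewrite !mxE.
    rewrite -(big_enum_val (A := mem crowded_simplices) (fun u => z u * (s == u)%:R)).
    have [zs|zs] := eqVneq (z s) 0.
      by rewrite zs big1// => u _; have [<-|_] := eqVneq; rewrite ?zs ?mulr0 ?mul0r.
    have sC : s \in crowded_simplices.
      rewrite inE zc//=; apply: contraT => sncr; exfalso.
      by apply: no_s; exists s.
    rewrite (bigD1 s)//= eqxx mulr1 big1 ?addr0// => u /andP[_ /negbTE].
    by rewrite eq_sym => ->; rewrite mulr0.
  rewrite zE summx_sub// => i _; apply: scalemx_sub.
  exact: submx_trans (row_sub _ _) (addsmxSr _ _).
have /simplicesP[sK scard] := zc _ zs.
have [x xs] : exists x, x \in s by apply/card_gt0P; rewrite scard.
have cardU : (#|nbhd p x| <= p)%N.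
  rewrite leqNgt; apply: contraNN sncr => lt; apply/exists_inP.
  by exists x.
set U := nbhd p x in cardU; have /adj_closedP Ucl : adj_closed U by exact: nbhd_closed.
have adj_in t u v : t \in K -> u \in t -> v \in t -> adjacent u v.
  move=> tK ut vt; apply: K_closed tK _ _.
    by rewrite finset.subUset !finset.sub1set ut vt.
  by apply/set0Pn; exists u; rewrite !inE eqxx.
have meet t u : t \in K -> u \in t -> u \in U -> t \subset U.
  move=> tK ut uU; apply/fintype.subsetP => v vt.
  by apply: Ucl uU _; exact: adj_in tK ut vt.
have xU : x \in U by apply: (fintype.subsetP (sub_nbhd x (leq0n p))); rewrite inE.
have sU : s \subset U by exact: meet sK xs xU.
pose zU t := if t \subset U then z t else 0.
have zUsupp t : zU t != 0 -> t \subset U /\ z t != 0 by rewrite /zU; case: ifP; rewrite ?eqxx.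
have zUc : chain_on (simplices K k) zU by move=> t /zUsupp[_ /zc].
have zUcyc t : bd zU t = 0.
  have [tU|tU] := boolP (t \subset U); last first.
    by apply: big1 => y yt; rewrite /zU finset.subUset (negbTE tU) andbF.
  have [t0|[u ut]] := set_0Vmem t.
    apply: big1 => y yt; apply/eqP; apply: contraT => /zUsupp[_ /zc/simplicesP[_]].
    by rewrite t0 finset.setU0 cards1.
  rewrite -[RHS](zcyc t); apply: eq_bigr => y yt; rewrite /zU.
  case: ifPn => // yU; apply/esym/eqP; apply: contraNT yU => /zc/simplicesP[yK _].
  by apply: meet yK (setU1r _ ut) _; exact: (fintype.subsetP tU).
have zU_sub : (row_of_chain k zU <= boundary K k + core_mx + crowded_mx)%MS.
  have [t /zUsupp[]//|||] := local_homology cardU zUc.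
  - exact: zUcyc.
  - move=> [w wc wE]; apply: submx_trans (addsmxSl _ _).
    apply: submx_trans (addsmxSl _ _).
    have -> : row_of_chain k zU = row_of_chain k (bd w).
      by apply/rowP => i; rewrite !mxE wE.
    by rewrite -row_of_chain_boundary// submxMl.
  - move=> [UC zUE]; apply: submx_trans (addsmxSl _ _).
    apply: submx_trans (addsmxSr _ _).
    suff -> : row_of_chain k zU = row (enum_rank_in UC U) core_mx by exact: row_sub.
    by apply/rowP => i; rewrite !mxE enum_rankK_in// zUE.
have -> : row_of_chain k z = row_of_chain k (fun t => z t + zU t) + row_of_chain k zU.
  by apply/rowP => i; rewrite !mxE -addrA F2_addxx addr0.
apply: addmx_sub => //; apply: IH => [|t|t]; last 2 first.
- have [zt|/zc//] := eqVneq (z t) 0.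
  by rewrite zt add0r; exact: zUc.
- by rewrite bdD zcyc zUcyc addr0.
rewrite -ltnS; apply: leq_trans zm; rewrite ltnS; apply: proper_card.
apply/fintype.properP; split.
  apply/fintype.subsetP => t; rewrite !inE; apply: contraNneq.
  by rewrite /zU => ->; case: ifP; rewrite addr0.
by exists s; rewrite !inE ?zs// /zU sU F2_addxx eqxx.
Qed.

Lemma betti_le : (betti K k <= #|Core| + #|[set s in simplices K k | crowded p s]|)%N.
Proof.
rewrite /betti /= leq_subLR.
have sub : (kermx (boundary K k') <= boundary K k + core_mx + crowded_mx)%MS.
  apply/row_subP => i; set u := row i _.
  have uker : u *m boundary K k' = 0 by apply/sub_kermxP; exact: row_sub.
  rewrite -[u]chain_of_rowK; apply: cycle_decomposition.
    exact: chain_of_row_on.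
  apply: row_cycle; first exact: chain_of_row_on.
  by rewrite chain_of_rowK.
apply: leq_trans (mxrankS sub) _.
apply: leq_trans (mxrank_adds_leqif _ _) _; rewrite addnA leq_add ?rank_leq_row//.
by apply: leq_trans (mxrank_adds_leqif _ _) _; rewrite leq_add ?rank_leq_row.
Qed.

End Bound.
End Complex.

(** * Lower bound on a Betti number *)

Section LowerBound.
Variables (T : finType) (K : {set {set T}}).
Implicit Types (z w : {set T} -> 'F_2) (s t U S : {set T}).
Hypothesis K_closed : forall s t, s \in K -> t \subset s -> t != finset.set0 -> t \in K.

Lemma bd_chain k w : chain_on (simplices K k.+1) w -> chain_on (simplices K k) (bd w).
Proof.
move=> wc t; apply: contraNT => tk; apply/eqP/big1 => x xt; apply/eqP.
apply: contraNT tk => /wc/simplicesP[xK]; rewrite cardsU1 xt add1n => -[ct].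
apply/simplicesP; split => //; apply: K_closed xK _ _; first exact: finset.subsetUr.
by rewrite -card_gt0 ct.
Qed.

Lemma row_boundary k i :
  row i (boundary K k) = row_of_chain K k (bd (fun s => (s == enum_val i)%:R)).
Proof.
rewrite -row_of_chain_boundary => [|s]; last first.
  by have [-> _|_] := eqVneq s (enum_val i); rewrite ?enum_valP ?eqxx.
rewrite rowE; congr (_ *m _); apply/rowP => j; rewrite !mxE eqxx.
by rewrite (inj_eq enum_val_inj).
Qed.

Lemma boundary_boundary k : boundary K k.+1 *m boundary K k = 0.
Proof.
apply/row_matrixP => i; rewrite row_mul row_boundary row_of_chain_boundary.
  by apply/rowP => j; rewrite !mxE bd_bd.
apply: bd_chain => s; by have [-> _|_] := eqVneq s (enum_val i); rewrite ?enum_valP ?eqxx.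
Qed.

Variables (k' : nat) (Core : {set {set T}}).
Let k := k'.+1.
Hypothesis core_cycle : forall S, S \in Core -> forall t, bd (full_chain K k S) t = 0.
Hypothesis core_face : forall S, S \in Core ->
  exists2 s, s \in simplices K k & s \subset S.
Hypothesis core_top : forall S s, S \in Core -> s \in simplices K k.+1 -> ~~ (s \subset S).
Hypothesis core_diam : forall S x y, S \in Core -> x \in S -> y \in S ->
  exists2 u, u \in S & (x = u \/ adjacent K x u) /\ (u = y \/ adjacent K u y).

Let isolated := [set S in Core | adj_closed K S].

Let isolated_mx := \matrix_(i < #|isolated|) row_of_chain K k (full_chain K k (enum_val i)).

Lemma simplex_in_isolated S u t : S \in isolated -> t \in K ->
  u \in t -> u \in S -> t \subset S.
Proof.
rewrite inE => /andP[_ /adj_closedP Scl] tK ut uS; apply/fintype.subsetP => v vt.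
apply: Scl uS _; apply: K_closed tK _ _.
  by rewrite finset.subUset !finset.sub1set ut vt.
by apply/set0Pn; exists u; rewrite !inE eqxx.
Qed.

(** Cores have diameter at most 2, so an isolated vertex set that meets a core
    contains it. *)
Lemma isolated_disjoint S S' x : S \in isolated -> S' \in isolated ->
  x \in S -> x \in S' -> S = S'.
Proof.
have sub A B : A \in isolated -> B \in isolated -> x \in A -> x \in B -> A \subset B.
  rewrite !inE => /andP[AC _] /andP[_ /adj_closedP Bcl] xA xB.
  apply/fintype.subsetP => y yA; have [u uA [xu uy]] := core_diam AC xA yA.
  have uB : u \in B by case: xu => [<-//|]; exact: Bcl.
  by case: uy => [<-//|]; exact: Bcl.
by move=> Si S'i xS xS'; apply/eqP; rewrite finset.eqEsubset !sub.
Qed.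

(** Evaluate at a face of one isolated core: the cycles of the others vanish there,
    and a boundary vanishes too because no simplex of dimension [k + 1] contains
    this face: such a simplex would lie inside the core. *)
Lemma isolated_free (a : 'rV_#|isolated|) b :
  a *m isolated_mx = b *m boundary K k -> a = 0.
Proof.
move=> ab; apply/rowP => i; rewrite mxE.
set S : {set T} := enum_val i; have Si : S \in isolated by exact: enum_valP.
have SC : S \in Core by move: Si; rewrite inE => /andP[].
have [s sk sS] := core_face SC; have /simplicesP[sK scard] := sk.
have [x xs] : exists x, x \in s by apply/card_gt0P; rewrite scard.
have xS := fintype.subsetP sS _ xs.
have := congr1 (fun M : 'rV_#|simplices K k| => M 0 (enum_rank_in sk s)) ab.
rewrite !mxE (bigD1 i)//= big1 ?addr0; last first.
  move=> j ji; rewrite !mxE enum_rankK_in// /full_chain.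
  have [/= sSj|_] := boolP (s \subset _); last by rewrite mulr0.
  case/negP: ji; apply/eqP/enum_val_inj; apply: (@isolated_disjoint _ _ x) => //.
  - exact: enum_valP.
  - exact: fintype.subsetP sSj _ xs.
rewrite !mxE enum_rankK_in// /full_chain sS sk mulr1 => ->; apply: big1 => j _.
rewrite !mxE enum_rankK_in//; set t : {set T} := enum_val j.
have tk : t \in simplices K k.+1 by exact: enum_valP.
have [st|_] := boolP (s \subset t); last by rewrite mulr0.
case/negP: (core_top SC tk); have /simplicesP[tK _] := tk.
apply: (@simplex_in_isolated S x) => //; exact: fintype.subsetP st _ xs.
Qed.

Lemma betti_ge : (#|[set S in Core | adj_closed K S]| <= betti K k)%N.
Proof.
rewrite -/isolated /betti /= leq_subRL; last first.
  by apply/mxrankS/sub_kermxP; exact: boundary_boundary.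
have free : \rank isolated_mx = #|isolated|.
  apply/eqP; rewrite -/(row_free _) -kermx_eq0; apply/eqP/row_matrixP => i.
  rewrite row0; apply: (@isolated_free _ 0); rewrite mul0mx.
  by apply/sub_kermxP; exact: row_sub.
have cap0 : (boundary K k :&: isolated_mx)%MS = 0.
  apply/row_matrixP => i; rewrite row0.
  have := row_sub i (boundary K k :&: isolated_mx)%MS.
  rewrite sub_capmx => /andP[/submxP[b ->] /submxP[a ab]].
  by rewrite ab (isolated_free (esym ab)) mul0mx.
rewrite -[X in (_ + X)%N]free -mxrank_disjoint_sum//; apply: mxrankS.
rewrite addsmx_sub; apply/andP; split.
  by apply/sub_kermxP; exact: boundary_boundary.
apply/row_subP => i; rewrite rowK; apply/sub_kermxP.
rewrite row_of_chain_boundary => [|s].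
  apply/rowP => j; rewrite !mxE core_cycle//.
  by have := enum_valP i; rewrite inE => /andP[].
by rewrite /full_chain; have [//|] := boolP (s \in simplices K k); rewrite andbF eqxx.
Qed.

End LowerBound.

(** * Hollow simplices as cores *)

Section Hollow.
Variables (T : finType) (K : {set {set T}}).
Implicit Types (z w : {set T} -> 'F_2) (s t U S : {set T}).
Hypothesis K_closed : forall s t, s \in K -> t \subset s -> t != finset.set0 -> t \in K.
Variable k : nat.

Definition hollow_cores : {set {set T}} :=
  [set S : {set T} | [&& #|S| == k.+2, S \notin K &
    [forall s : {set T}, (s \subset S) && (#|s| == k.+1) ==> (s \in K)]]].

Lemma hollow_coresP S : reflect
  [/\ #|S| = k.+2, S \notin K & forall s, s \subset S -> #|s| = k.+1 -> s \in K]
  (S \in hollow_cores).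
Proof.
rewrite inE; apply: (iffP and3P) => [[/eqP cS SK /forallP H]|[cS SK H]]; split => //.
- by move=> s sS /eqP sk; have := H s; rewrite sS sk.
- exact/eqP.
- by apply/forallP => s; apply/implyP => /andP[sS /eqP]; exact: H.
Qed.

Lemma bd_simplex S t : bd (fun s => (s == S)%:R) t =
  ((t \subset S) && (#|S| == #|t|.+1))%:R.
Proof.
rewrite /bd; have [/andP[tS /eqP cS]|H] := boolP (_ && _).
  have [x xE] := card_facet tS cS.
  rewrite (bigD1 x)/=; last by have := xE x; rewrite eqxx => /andP[].
  have /andP[_ Sx] : (x \notin t) && (S == x |: t) by rewrite xE.
  rewrite eq_sym Sx big1 ?addr0// => y /andP[yt yx]; have := xE y.
  by rewrite yt (negbTE yx) eq_sym /= => ->.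
apply: big1 => x xt; case: eqVneq => // SE; case/negP: H.
by rewrite -SE finset.subsetUr cardsU1 xt eqxx.
Qed.

(** For a simplex [s] in the support and [x] in [s], the face [s] minus [x] must
    belong to a second simplex of the support.  This forces a vertex [y] outside
    [s], so that [U = s + y], and then all faces of [U] to be in the support. *)
Lemma hollow_local U z : (#|U| <= k.+2)%N ->
  chain_on (simplices K k) z -> (forall s, z s != 0 -> s \subset U) ->
  (forall t, bd z t = 0) ->
  (exists2 w, chain_on (simplices K k.+1) w & bd w =1 z) \/
  (U \in hollow_cores /\ z =1 full_chain K k U).
Proof.
move=> cU zc zU zcyc.
have [z0|] := EM (forall s, z s = 0).
  left; exists (fun=> 0) => [s|s]; first by rewrite eqxx.
  by rewrite bd0 z0.
move=> /existsNP[s /eqP zs].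
have /simplicesP[sK scard] := zc _ zs.
have other x : x \in s -> exists y, [/\ y \in U, y \notin s & z (y |: s :\ x) != 0].
  move=> xs; have := zcyc (s :\ x); rewrite /bd (bigD1 x) ?inE ?eqxx//= finset.setD1K//.
  move=> H; apply: contra_notP (elimN eqP zs) => no; rewrite -[LHS]addr0 -[RHS]H.
  congr (_ + _); apply/esym/big1 => y; rewrite !inE negb_and negbK => /andP[ys yx].
  apply/eqP; apply: contra_notT no => zy; exists y; split => //.
    by apply: (fintype.subsetP (zU _ zy)); rewrite !inE eqxx.
  by move: ys; rewrite (negbTE yx).
have sU := zU _ zs.
have [x0 x0s] : exists x, x \in s by apply/card_gt0P; rewrite scard.
have [y [yU ys _]] := other x0 x0s.
have UE : U = y |: s.
  apply/esym/eqP; rewrite eqEcard finset.subUset finset.sub1set yU sU /=.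
  by rewrite cardsU1 ys scard.
have cUE : #|U| = k.+2 by rewrite UE cardsU1 ys scard.
have z1 t : t \subset U -> #|t| = k.+1 -> z t != 0.
  move=> tU ct; have [|x xE] := card_facet tU; first by rewrite cUE ct.
  have /andP[xt /eqP Ux] : (x \notin t) && (U == x |: t) by rewrite xE.
  have tE : t = U :\ x by rewrite Ux setU1K.
  have [xy|xy] := eqVneq x y; first by rewrite tE xy UE setU1K.
  have xs : x \in s.
    have : x \in U by rewrite Ux setU11.
    by rewrite UE !inE (negbTE xy).
  have [y' [y'U y's]] := other x xs.
  have -> : y' = y by move: y'U; rewrite UE !inE (negbTE y's) orbF => /eqP.
  suff -> : t = y |: s :\ x by [].
  rewrite tE UE; apply/setP => u; rewrite !inE.
  by case: (eqVneq u y) => [->|_] //=; rewrite (eq_sym y) xy.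
have zE : z =1 full_chain K k U.
  move=> t; rewrite /full_chain; have [/andP[tU tk]|H] := boolP (_ && _).
    have /simplicesP[_ ct] := tk.
    by have [z0|] := F2_cases (z t) => //; have := z1 t tU ct; rewrite z0 eqxx.
  apply/eqP; apply: contraNT H => zt; by rewrite zU// zc.
have faces t : t \subset U -> #|t| = k.+1 -> t \in K.
  by move=> tU ct; have /zc/simplicesP[] := z1 t tU ct.
have [UK|UK] := boolP (U \in K); [left|right].
  exists (fun s => (s == U)%:R) => [t|t].
    by have [->|_] := eqVneq t U; rewrite ?eqxx// => _; exact/simplicesP.
  rewrite bd_simplex zE /full_chain inE cUE eqSS; congr (_%:R); congr nat_of_bool.
  have [tU|//] := boolP (t \subset U); rewrite /= eq_sym.
  have [ct|] := eqVneq #|t| k.+1; last by rewrite andbF.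
  by rewrite faces.
by split => //; apply/hollow_coresP.
Qed.

Lemma hollow_cycle S t : S \in hollow_cores -> bd (full_chain K k S) t = 0.
Proof.
move=> /hollow_coresP[cS _ faces].
rewrite -[RHS](bd_bd (fun s => (s == S)%:R) t); apply: eq_bd => s.
rewrite bd_simplex cS eqSS /full_chain inE; congr (_%:R); congr nat_of_bool.
have [sS|//] := boolP (s \subset S); rewrite /= eq_sym.
have [cs|] := eqVneq #|s| k.+1; last by rewrite andbF.
by rewrite faces.
Qed.

Lemma hollow_face S : S \in hollow_cores ->
  exists2 s, s \in simplices K k & s \subset S.
Proof.
move=> /hollow_coresP[cS _ faces].
have [x xS] : exists x, x \in S by apply/card_gt0P; rewrite cS.
have c : #|S :\ x| = k.+1 by move: cS; rewrite (cardsD1 x) xS => -[].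
exists (S :\ x); last exact: subsetDl.
by apply/simplicesP; split => //; apply: faces => //; exact: subsetDl.
Qed.

Lemma hollow_top S s : S \in hollow_cores -> s \in simplices K k.+1 -> ~~ (s \subset S).
Proof.
move=> /hollow_coresP[cS SK _] /simplicesP[sK cs]; apply: contraNN SK => sS.
by have /eqP <- : s == S by rewrite eqEcard sS cS cs leqnn.
Qed.

Lemma hollow_adjacent S x y : (0 < k)%N -> S \in hollow_cores -> x \in S -> y \in S ->
  adjacent K x y.
Proof.
move=> k_gt0 /hollow_coresP[cS _ faces] xS yS.
have : (0 < #|S :\: [set x; y]|)%N.
  rewrite cardsD (finset.setIidPr _) ?cS; last by rewrite finset.subUset !finset.sub1set xS.
  by rewrite subn_gt0 cards2; case: (x != y).
case/card_gt0P => u; rewrite !inE negb_or => /andP[/andP[ux uy] uS].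
have c : #|S :\ u| = k.+1 by move: cS; rewrite (cardsD1 u) uS => -[].
apply: K_closed (faces _ (subsetDl _ _) c) _ _.
  by rewrite finset.subUset !finset.sub1set !inE xS yS ![_ == u]eq_sym ux uy.
by apply/set0Pn; exists x; rewrite !inE eqxx.
Qed.

End Hollow.

(** * Cross-polytopes as cores *)

Section FlagCore.
Variables (T : finType) (K : {set {set T}}).
Implicit Types (z w : {set T} -> 'F_2) (s t U S : {set T}).
Hypothesis K_flag : forall s, (s \in K) = (s != finset.set0) && clique (adjacent K) s.
Variable k : nat.

Let adj := adjacent K.

Lemma adjacent_sym : symmetric adj.
Proof. by move=> x y; rewrite /adj /adjacent finset.setUC. Qed.

Lemma flag_closed s t : s \in K -> t \subset s -> t != finset.set0 -> t \in K.
Proof.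
by rewrite !K_flag => /andP[_ sC] ts ->; exact: cliqueS sC.
Qed.

Lemma simplices_cliques U s m :
  (s \subset U) && (s \in simplices K m) = (s \in cliques adj m.+1 U).
Proof.
rewrite !inE K_flag -card_gt0; congr (_ && _).
by have [->|] := eqVneq #|s| m.+1; rewrite ?andbF ?andbT.
Qed.

Definition cross_cores : {set {set T}} := [set S : {set T} | cross adj k.+1 S].

Lemma flag_local U z : (#|U| <= k.+1.*2)%N ->
  chain_on (simplices K k) z -> (forall s, z s != 0 -> s \subset U) ->
  (forall t, bd z t = 0) ->
  (exists2 w, chain_on (simplices K k.+1) w & bd w =1 z) \/
  (U \in cross_cores /\ z =1 full_chain K k U).
Proof.
move=> cU zc zU zcyc.
have zc' : chain_on (cliques adj k.+1 U) z.
  by move=> s zs; rewrite -simplices_cliques zU// zc.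
have [[w wc wE]|[UC zE]] := flag_cycle adjacent_sym cU zc' zcyc; [left|right].
  by exists w => // s /wc; rewrite -simplices_cliques => /andP[].
by rewrite inE; split => // s; rewrite zE /clique_cycle -simplices_cliques.
Qed.

Lemma cross_core_cycle S t : S \in cross_cores -> bd (full_chain K k S) t = 0.
Proof.
rewrite inE => SC; rewrite -(cross_cycle adjacent_sym SC t)//; apply: eq_bd => s.
by rewrite /full_chain /clique_cycle -simplices_cliques.
Qed.

Lemma cross_core_face S : S \in cross_cores ->
  exists2 s, s \in simplices K k & s \subset S.
Proof.
rewrite inE => SC; have C0 : clique adj finset.set0 by apply/cliqueP => x; rewrite inE.
have [s sS _] := cross_extend adjacent_sym SC (finset.sub0set _) C0.
by move: sS; rewrite -simplices_cliques => /andP[]; exists s.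
Qed.

Lemma cross_core_top S s : S \in cross_cores -> s \in simplices K k.+1 -> ~~ (s \subset S).
Proof.
rewrite inE => SC sk; apply/negP => sS; have : s \in cliques adj k.+2 S.
  by rewrite -simplices_cliques sS.
rewrite inE => /and3P[_ /eqP cs sC].
by have := cross_clique_card adjacent_sym SC sS sC; rewrite cs ltnn.
Qed.

(** Two antipodal vertices have a common neighbour as soon as there is a second
    antipodal pair. *)
Lemma cross_core_diam S x y : (0 < k)%N -> S \in cross_cores -> x \in S -> y \in S ->
  exists2 u, u \in S & (x = u \/ adjacent K x u) /\ (u = y \/ adjacent K u y).
Proof.
move=> k_gt0; rewrite inE => SC xS yS; have /andP[/eqP cS _] := SC.
have adjE a b : a \in S -> b \in S -> b != a -> b != antipode adj S a -> adj a b.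
  by move=> aS bS ba; rewrite (antipodeP SC aS bS) ba /= negbK.
have [->|xy] := eqVneq x y; first by exists y => //; split; left.
have [yx|yx] := eqVneq y (antipode adj S x); last first.
  by exists y => //; split; [right; apply: adjE; rewrite // eq_sym|left].
have : (0 < #|S :\: [set x; y]|)%N.
  rewrite cardsD (finset.setIidPr _) ?cS; last by rewrite finset.subUset !finset.sub1set xS.
  by rewrite subn_gt0 cards2 xy doubleS !ltnS double_gt0.
case/card_gt0P => u; rewrite !inE negb_or => /andP[/andP[ux uy] uS].
exists u => //; split; right; apply: adjE => //; first by rewrite -yx.
  by rewrite eq_sym.
apply: contraNneq ux => yu; rewrite -[u](antipodeK adjacent_sym SC)// -yu.
by rewrite yx (antipodeK adjacent_sym SC).

Qed.

End FlagCore.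

(** * Euclidean balls and the two complexes *)

Section EuclideanNorm.
Context {R : realType} {d : nat}.
Implicit Types (x y z : 'rV[R]_d).

Lemma enorm_ge0 x : 0 <= enorm x. Proof. exact: sqrtr_ge0. Qed.

Lemma sqr_enorm x : enorm x ^+ 2 = \sum_(i < d) x ord0 i ^+ 2.
Proof. by rewrite sqr_sqrtr// sumr_ge0// => i _; exact: sqr_ge0. Qed.

Lemma enormZ a x : enorm (a *: x) = `|a| * enorm x.
Proof.
rewrite /enorm -sqrtr_sqr -sqrtrM ?sqr_ge0//; congr (Num.sqrt _).
by rewrite mulr_sumr; apply: eq_bigr => i _; rewrite mxE exprMn.
Qed.

Lemma enormN x : enorm (- x) = enorm x.
Proof. by rewrite -scaleN1r enormZ normrN1 mul1r. Qed.

Lemma enorm0 : enorm (0 : 'rV[R]_d) = 0.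
Proof. by rewrite -(scale0r 0) enormZ normr0 mul0r. Qed.

Lemma enormC x y : enorm (x - y) = enorm (y - x).
Proof. by rewrite -enormN opprB. Qed.

Lemma cauchy_schwarz x y :
  \sum_(i < d) x ord0 i * y ord0 i <= enorm x * enorm y.
Proof.
set C := \sum_(i < d) _.
have [y0|y0] := eqVneq (enorm y) 0.
  rewrite y0 mulr0 le_eqVlt; apply/orP; left; apply/eqP/big1 => i _.
  have : \sum_(i < d) y ord0 i ^+ 2 = 0 by rewrite -sqr_enorm y0 expr0n.
  move/eqP; rewrite psumr_eq0 => [/allP/(_ i)|j _]; last exact: sqr_ge0.
  by rewrite mem_index_enum sqrf_eq0 => /(_ isT)/eqP->; rewrite mulr0.
have yy : 0 < enorm y by rewrite lt_neqAle eq_sym y0 enorm_ge0.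
apply: le_trans (ler_norm _) _.
rewrite -(@ler_sqr R) ?nnegrE ?mulr_ge0 ?enorm_ge0// real_normK ?num_real// exprMn.
pose t := C / enorm y ^+ 2.
have y2 : enorm y ^+ 2 != 0 by rewrite sqrf_eq0.
have : 0 <= \sum_(i < d) (x ord0 i - t * y ord0 i) ^+ 2.
  by apply: sumr_ge0 => i _; exact: sqr_ge0.
under eq_bigr do rewrite sqrrB -addrA.
rewrite !big_split /= -sqr_enorm.
have -> : \sum_(i < d) - (x ord0 i * (t * y ord0 i) *+ 2) = - (t * C *+ 2).
  rewrite sumrN sumrMnl; congr (- (_ *+ 2)); rewrite mulr_sumr.
  by apply: eq_bigr => i _; rewrite mulrCA.
have -> : \sum_(i < d) (t * y ord0 i) ^+ 2 = t * C.
  under eq_bigr do rewrite exprMn; rewrite -mulr_sumr -sqr_enorm expr2 -mulrA.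
  by congr (_ * _); rewrite /t divfK.
rewrite mulr2n opprD -addrA addNr addr0 subr_ge0 /t mulrAC -expr2.
by rewrite ler_pdivrMr// exprn_gt0.
Qed.

Lemma enormD x y : enorm (x + y) <= enorm x + enorm y.
Proof.
rewrite -(@ler_sqr R) ?nnegrE ?addr_ge0 ?enorm_ge0// sqrrD !sqr_enorm.
under eq_bigr do rewrite mxE sqrrD.
rewrite !big_split /= -mulr2n lerD2r lerD2l lerMn2r /=.
exact: cauchy_schwarz.
Qed.

Lemma enorm_dist x y z : enorm (x - z) <= enorm (x - y) + enorm (y - z).
Proof. by apply: le_trans (enormD _ _); rewrite addrA subrK. Qed.

Lemma enorm_coord x i : `|x ord0 i| <= enorm x.
Proof.
rewrite -sqrtr_sqr ler_sqrt ?sumr_ge0//; last by move=> j _; exact: sqr_ge0.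
by rewrite (bigD1 i)//= lerDl sumr_ge0// => j _; exact: sqr_ge0.
Qed.

(** The midpoint of two points is in both balls. *)
Lemma balls_meet x y (r : R) : 0 <= r ->
  (eball x (r / 2) `&` eball y (r / 2) !=set0)%classic <-> enorm (x - y) <= r.
Proof.
move=> r0; split => [[z [/= xz yz]]|xy].
  apply: le_trans (enorm_dist _ z _) _; rewrite enormC [leRHS](splitr r).
  exact: lerD.
exists (2^-1 *: (x + y)); split; rewrite /eball /=.
  have -> : 2^-1 *: (x + y) - x = 2^-1 *: (y - x).
    by apply/rowP => i; rewrite !mxE; lra.
  by rewrite enormZ ger0_norm ?invr_ge0// mulrC ler_pM2r ?invr_gt0// enormC.
have -> : 2^-1 *: (x + y) - y = 2^-1 *: (x - y).
  by apply/rowP => i; rewrite !mxE; lra.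
by rewrite enormZ ger0_norm ?invr_ge0// mulrC ler_pM2r ?invr_gt0.
Qed.

End EuclideanNorm.

Section GeometricComplexes.
Context {R : realType} {d : nat}.
Variables (P : {fset 'rV[R]_d}) (r : R).
Hypothesis r_gt0 : 0 < r.
Implicit Types (s t : {set P}) (x y : P).

Lemma cechP s : reflect (s != finset.set0 /\
    exists z, forall x, x \in s -> eball (val x) (r / 2) z) (s \in cech P r).
Proof.
rewrite finset.in_set card_gt0; apply: (iffP andP) => -[s0 H]; split => //.
  by have /asboolP := H.
exact/asboolP.
Qed.

Lemma cech_closed s t : s \in cech P r -> t \subset s -> t != finset.set0 ->
  t \in cech P r.
Proof.
move=> /cechP[_ [z zs]] /fintype.subsetP ts t0; apply/cechP; split => //.
by exists z => x /ts; exact: zs.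
Qed.

Lemma ripsP s : reflect (s != finset.set0 /\
    forall x y, x \in s -> y \in s -> enorm (val x - val y) <= r) (s \in rips P r).
Proof.
rewrite finset.in_set card_gt0; apply: (iffP andP) => -[s0 H]; split => //.
  move/asboolP: H => H x y xs ys; apply/balls_meet; first exact: ltW.
  exact: H.
apply/asboolP => x y xs ys; apply/balls_meet; first exact: ltW.
exact: H.
Qed.

Lemma set2_neq0 x y : [set x; y] != finset.set0.
Proof. by apply/set0Pn; exists x; rewrite !inE eqxx. Qed.

Lemma adjacent_cech x y : adjacent (cech P r) x y = (enorm (val x - val y) <= r).
Proof.
apply/cechP/idP => [[_ [z H]]|xy].
  apply/balls_meet; first exact: ltW.
  by exists z; split; apply: H; rewrite !inE eqxx ?orbT.
split; first exact: set2_neq0.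
have /balls_meet[|z [xz yz]] := xy; first exact: ltW.
by exists z => u; rewrite !inE => /orP[] /eqP->.
Qed.

Lemma adjacent_rips x y : adjacent (rips P r) x y = (enorm (val x - val y) <= r).
Proof.
apply/ripsP/idP => [[_ H]|xy]; first by apply: H; rewrite !inE eqxx ?orbT.
split; first exact: set2_neq0.
have r0 := ltW r_gt0.
by move=> u v; rewrite !inE => /orP[] /eqP-> /orP[] /eqP->; rewrite ?subrr ?enorm0// enormC.
Qed.

Lemma rips_flag s :
  (s \in rips P r) = (s != finset.set0) && clique (adjacent (rips P r)) s.
Proof.
apply/ripsP/andP => -[s0 H]; split => //.
  by apply/cliqueP => x y xs ys _; rewrite adjacent_rips H.
move=> x y xs ys; have [->|xy] := eqVneq x y; first by rewrite subrr enorm0 ltW.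
by rewrite -adjacent_rips (cliqueP _ _ H).
Qed.

End GeometricComplexes.

(** * Counting ordered tuples of points *)

Definition near_tuples (R : realType) (d n : nat) (r : R) : set 'M[R]_(n.+1, d) :=
  [set y | forall a, enorm (row a y - row ord0 y) <= n.+1%:R * r]%classic.
Arguments near_tuples : clear implicits.

Section NearTuples.
Context {R : realType} {d : nat}.

Definition tuple_of (P : {fset 'rV[R]_d}) j (f : {ffun 'I_j -> P}) : 'M[R]_(j, d) :=
  \matrix_a val (f a).
Definition tuple_count (P : {fset 'rV[R]_d}) j (Q : set 'M[R]_(j, d)) : nat :=
  #|[set f : {ffun 'I_j -> P} | injectiveb f && `[< Q (tuple_of f) >]]|.

Variable (P : {fset 'rV[R]_d}).
Implicit Types (s t U : {set P}) (x y : P).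

Lemma row_tuple_of j (f : {ffun 'I_j -> P}) a : row a (tuple_of f) = val (f a).
Proof. by rewrite rowK. Qed.

(** To each [s] corresponds an enumeration of a set [U] around it that lists the
    [m] elements of [s] first, so that [s] can be read off and the first point of
    the tuple is in [s]. *)
Lemma card_le_near_tuples n m (r : R) (B : {set {set P}}) :
  (0 < m)%N ->
  (forall s, s \in B -> #|s| = m /\ exists U, [/\ s \subset U, #|U| = n.+1 &
    forall x y, x \in s -> y \in U -> enorm (val y - val x) <= n.+1%:R * r]) ->
  (#|B| <= tuple_count P (near_tuples R d n r))%N.
Proof.
set j := n.+1; move=> m_gt0 HB; case: (posnP #|B|) => [->//|/card_gt0P[s0 s0B]].
have [s0m _] := HB _ s0B.
have [x0 _] : exists x, x \in s0 by apply/card_gt0P; rewrite s0m.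
have good s : s \in B -> {f : {ffun 'I_j -> P} | [/\ injective f,
    near_tuples R d n r (tuple_of f) & forall x, (x \in s) = [exists a : 'I_j, (a < m)%N && (f a == x)]]}.
  move=> sB; apply: cid; have [sm [U [sU Uj UD]]] := HB _ sB.
  pose q := enum s ++ enum (U :\: s).
  have sizes : size (enum s) = m by rewrite -cardE.
  have sizeq : size q = j.
    by rewrite size_cat sizes -cardE cardsD (finset.setIidPr sU) Uj sm subnKC// -sm -Uj subset_leq_card.
  have uq : uniq q.
    rewrite cat_uniq !enum_uniq /= andbT; apply/hasPn => x; rewrite !mem_enum.
    by rewrite inE => /andP[].
  have qU a : (a < j)%N -> nth x0 q a \in U.
    move=> aj; have : nth x0 q a \in q by rewrite mem_nth// sizeq.
    by rewrite mem_cat !mem_enum inE => /orP[/(fintype.subsetP sU)//|/andP[]].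
  exists [ffun a : 'I_j => nth x0 q a]; split.
  - move=> a b; rewrite !ffunE => /eqP; rewrite nth_uniq ?sizeq// => /eqP ab.
    exact/val_inj.
  - move=> a; rewrite !row_tuple_of !ffunE; apply: UD; last exact: qU.
    by rewrite nth_cat sizes m_gt0 -mem_enum mem_nth// sizes.
  - move=> x; apply/idP/existsP => [xs|[a /andP[am /eqP]]].
      have xe : x \in enum s by rewrite mem_enum.
      have im : (index x (enum s) < m)%N by rewrite -sizes index_mem.
      have ij : (index x (enum s) < j)%N.
        by apply: leq_trans im _; rewrite -sizeq size_cat sizes leq_addr.
      exists (Ordinal ij); rewrite im /= ffunE /= nth_cat index_mem xe nth_index//.
    rewrite ffunE nth_cat sizes am => <-.
    by rewrite -mem_enum mem_nth// sizes.
pose F s : {ffun 'I_j -> P} := if pselect (s \in B) is left sB then sval (good s sB) else [ffun=> x0].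
have FP s : s \in B -> [/\ injective (F s), near_tuples R d n r (tuple_of (F s)) &
    forall x, (x \in s) = [exists a : 'I_j, (a < m)%N && (F s a == x)]].
  by move=> sB; rewrite /F; case: pselect => // p; exact: (svalP (good s p)).
rewrite -(card_in_imset (f := F)) => [|s s' /FP[_ _ sE] /FP[_ _ s'E] FF]; last first.
  by apply/setP => x; rewrite sE s'E FF.
apply: subset_leq_card; apply/fintype.subsetP => _ /imsetP[s sB ->].
have [Fi Fn _] := FP _ sB; rewrite inE; apply/andP; split; first exact/injectiveP.
exact/asboolP.
Qed.

(** Each core has [j!] enumerations. *)
Lemma tuple_count_cores j (Core : {set {set P}}) (Q : set 'M[R]_(j, d)) :
  (forall S, S \in Core -> #|S| = j) ->
  (forall f : {ffun 'I_j -> P}, injective f ->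
     (Q (tuple_of f) <-> (f @: [set: 'I_j] \in Core))) ->
  tuple_count P Q = (j`! * #|Core|)%N.
Proof.
move=> Cj QC; rewrite /tuple_count -sum1_card.
rewrite (partition_big (fun f : {ffun 'I_j -> P} => f @: [set: 'I_j]) (mem Core)) /=; last first.
  by move=> f; rewrite inE => /andP[/injectiveP fi /asboolP/QC->].
rewrite mulnC -sum_nat_const; apply: eq_bigr => S SC.
rewrite sum1_card -[RHS]ffactnn -[X in (X ^_ _)%N](Cj _ SC) -[in RHS](card_ord j).
rewrite -card_inj_ffuns_on; apply: eq_card => f; rewrite [LHS]unfold_in /= !inE.
apply/andP/andP => [[/andP[fi _] /eqP fS]|[fo fi]].
  split => //; apply/forallP => a; rewrite -fS.
  by apply/imsetP; exists a; rewrite ?inE.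
have /injectiveP finj := fi.
have fS : f @: [set: 'I_j] = S.
  apply/eqP; rewrite eqEcard card_imset// cardsT card_ord Cj// leqnn andbT.
  by apply/fintype.subsetP => _ /imsetP[a _ ->]; exact: (forallP fo).
split; last exact/eqP.
by rewrite fi; apply/asboolP/QC => //; rewrite fS.
Qed.

End NearTuples.

Lemma set_interpolation (T : finType) (s N : {set T}) m : s \subset N ->
  (#|s| <= m <= #|N|)%N -> exists U : {set T}, [/\ s \subset U, U \subset N & #|U| = m].
Proof.
move=> sN /andP[sm mN]; elim: m sm mN => [|m IH] sm mN.
  by exists s; split => //; apply/eqP; rewrite -leqn0.
move: sm; rewrite leq_eqVlt => /predU1P[sm|sm]; first by exists s; split.
have [U [sU UN cU]] := IH sm (ltnW mN).
have /card_gt0P[x] : (0 < #|N :\: U|)%N by rewrite cardsD (finset.setIidPr UN) cU subn_gt0.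
rewrite inE => /andP[xU xN]; exists (x |: U); split.
- exact: fintype.subset_trans sU (finset.subsetUr _ _).
- by rewrite finset.subUset finset.sub1set xN.
- by rewrite cardsU1 xU cU.
Qed.

(** Choose the vertex of lower rank in each antipodal pair, and number the pairs. *)
Lemma cross_labelling (T : finType) (e : rel T) (n : nat) (S : {set T}) :
  symmetric e -> cross e n S ->
  exists h : bool * 'I_n -> T, [/\ injective h, forall u, h u \in S &
    forall u v, (u.2 != v.2) = (h u != h v) && e (h u) (h v)].
Proof.
move=> e_sym SC; pose anti := antipode e S.
pose R := [set x in S | (enum_rank x < enum_rank (anti x))%N].
have RS x : x \in R -> x \in S by rewrite inE => /andP[].
have antiS x : x \in S -> anti x \in S by exact: (antipode_in SC).
have antiK x : x \in S -> anti (anti x) = x by exact: (antipodeK e_sym SC).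
have antiR x : x \in S -> (anti x \in R) = (x \notin R).
  move=> xS; rewrite !inE antiS// antiK// xS /= -leqNgt ltn_neqAle.
  rewrite andb_idl// => _; apply: contra_neq (antipode_neq SC xS).
  by move=> /val_inj/enum_rank_inj.
have cR : #|R| = n.
  apply: double_inj; have /andP[/eqP <- _] := SC.
  have -> : S = R :|: anti @: R.
    apply/setP => x; rewrite finset.in_setU; apply/idP/orP => [xS|[/RS//|/imsetP[u /RS uS ->]]].
      have [xR|xR] := boolP (x \in R); [by left|right].
      by apply/imsetP; exists (anti x); rewrite ?antiR// antiK.
    exact: antiS.
  rewrite cardsU card_in_imset => [|x u /RS xS /RS uS xu]; last first.
    by rewrite -[x]antiK// xu antiK.
  have -> : R :&: anti @: R = finset.set0.
    apply/setP => x; rewrite finset.in_setI [in RHS]inE; apply/negP.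
    by move=> /andP[xR /imsetP[u uR xu]]; move: xR; rewrite xu antiR ?uR// RS.
  by rewrite cards0 subn0 addnn.
pose r (i : 'I_n) : T := enum_val (cast_ord (esym cR) i).
have rR i : r i \in R by exact: enum_valP.
have r_inj : injective r by move=> i j /enum_val_inj/cast_ord_inj.
pose h (u : bool * 'I_n) := if u.1 then r u.2 else anti (r u.2).
have hS u : h u \in S by rewrite /h; case: u.1; rewrite ?antiS// RS.
have h_anti u : h (~~ u.1, u.2) = anti (h u).
  by rewrite /h /=; case: u.1 => //=; rewrite antiK// RS.
have h_inj : injective h.
  move=> [b i] [c j]; rewrite /h /=; case: b; case: c => E.
  - by rewrite (r_inj _ _ E).
  - by have := antiR _ (RS _ (rR j)); rewrite rR -E rR.
  - by have := antiR _ (RS _ (rR i)); rewrite rR E rR.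
  - by congr (_, _); apply: r_inj; rewrite -[LHS]antiK ?RS// E antiK ?RS.
exists h; split => // u v.
have := antipodeP SC (hS u) (hS v); rewrite -/(anti _) -h_anti !(inj_eq h_inj) => A.
have -> : (u != v) && e (h u) (h v) = (v != u) && (v != (~~ u.1, u.2)).
  by rewrite A eq_sym; case: (v != u); case: (e _ _).
case: u v {A} => [b i] [c j]; rewrite -!pair_eqE /pair_eq /= (eq_sym j i).
by case: (i == j); case: b; case: c.
Qed.

(** * Betti numbers and numbers of cores *)

Section CoreCount.
Context {R : realType} {d : nat}.
Variables (P : {fset 'rV[R]_d}) (r : R).
Hypothesis r_gt0 : 0 < r.
Implicit Types (s t U S : {set P}) (x y : P).

Variable K : {set {set P}}.
Hypothesis K_closed : forall s t, s \in K -> t \subset s -> t != finset.set0 -> t \in K.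
Hypothesis K_adj : forall x y, adjacent K x y = (enorm (val x - val y) <= r).

Lemma simplex_adjacent s x y : s \in K -> x \in s -> y \in s -> adjacent K x y.
Proof.
move=> sK xs ys; apply: K_closed sK _ _.
  by rewrite finset.subUset !finset.sub1set xs ys.
by apply/set0Pn; exists x; rewrite !inE eqxx.
Qed.

Lemma nbhd_dist i x y : y \in nbhd K i x -> enorm (val y - val x) <= i%:R * r.
Proof.
elim: i y => [|i IH] y; first by rewrite inE => /eqP->; rewrite subrr enorm0 mul0r.
rewrite /nbhd iterS -/(nbhd K i x) !inE => /orP[/IH yx|/existsP[z /andP[/IH zx]]].
  by apply: le_trans yx _; rewrite ler_pM2r// ler_nat.
rewrite K_adj => zy; rewrite -[i.+1]addn1 natrD mulrDl mul1r [leRHS]addrC.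
by apply: le_trans (enorm_dist _ (val z) _) _; rewrite lerD// enormC.
Qed.

(** The component of a crowded simplex [s] contains a set of [p + 1] vertices around
    [s], at most [p] edges away from one vertex of [s] and hence at most [p + 1]
    edges away from all of them. *)
Lemma crowded_le k p : (k <= p)%N -> (0 < p)%N ->
  (#|[set s in simplices K k | crowded K p s]| <= tuple_count P (near_tuples R d p r))%N.
Proof.
move=> kp p0; apply: (@card_le_near_tuples _ _ _ _ k.+1) => // s.
rewrite finset.in_set => /andP[/simplicesP[sK cs] /existsP[x /andP[xs cr]]]; split => //.
have sN : s \subset nbhd K p x.
  apply/fintype.subsetP => y ys; apply: (fintype.subsetP (sub_nbhd K x p0)).
  rewrite /nbhd /= !inE; apply/orP; right; apply/existsP; exists x.
  by rewrite inE eqxx (simplex_adjacent sK).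
have [|U [sU UN cU]] := set_interpolation (m := p.+1) sN.
  by rewrite cs ltnS kp.
exists U; split => // a b aS bU.
apply: le_trans (enorm_dist _ (val x) _) _; rewrite -[p.+1]addn1 natrD mulrDl mul1r lerD//.
  by apply: nbhd_dist; exact: (fintype.subsetP UN).
by rewrite -K_adj (simplex_adjacent sK).
Qed.

(** A core that is not isolated has a neighbour outside it, and the two together are
    [p + 1] points; their distances to a point of the core are at most [3 * r],
    and [3 <= p + 1]. *)
Lemma open_cores_le (Core : {set {set P}}) p : (1 < p)%N ->
  (forall S, S \in Core -> #|S| = p) ->
  (forall S x y, S \in Core -> x \in S -> y \in S ->
    exists2 u, u \in S & (x = u \/ adjacent K x u) /\ (u = y \/ adjacent K u y)) ->
  (#|[set S in Core | ~~ adj_closed K S]| <= tuple_count P (near_tuples R d p r))%N.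
Proof.
move=> p1 Cp Cdiam; apply: (@card_le_near_tuples _ _ _ _ p); first exact: ltnW.
move=> S; rewrite finset.in_set => /andP[SC /adj_closedP ncl]; split; first exact: Cp.
have [x [v [xS xv vS]]] : exists x v, [/\ x \in S, adjacent K x v & v \notin S].
  apply: contra_notP ncl => no x v xS xv; apply: contra_notT no => vS.
  by exists x, v; split.
exists (v |: S); split.
- exact: finset.subsetUr.
- by rewrite cardsU1 vS (Cp _ SC).
have adj_le (a b : P) : a = b \/ adjacent K a b -> enorm (val a - val b) <= r.
  by case=> [->|]; [rewrite subrr enorm0 ltW|rewrite K_adj].
have diam a b : a \in S -> b \in S -> enorm (val b - val a) <= 2 * r.
  move=> aS bS; have [u uS [au ub]] := Cdiam _ _ _ SC bS aS.
  apply: le_trans (enorm_dist _ (val u) _) _; rewrite mulr_natl mulr2n.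
  by rewrite lerD// adj_le.
have le3 : 2 * r + r <= p.+1%:R * r.
  by rewrite -[X in _ + X]mul1r -mulrDl ler_pM2r// -[2 + 1]/(2%:R + 1%:R) -natrD ler_nat addn1.
move=> a b aS /setU1P[->|bS]; apply: le_trans le3; last first.
  by apply: le_trans (diam _ _ aS bS) _; rewrite lerDl ltW.
apply: le_trans (enorm_dist _ (val x) _) _; rewrite [leRHS]addrC; apply: lerD.
  by rewrite enormC -K_adj.
exact: diam.
Qed.

Lemma betti_core_count k' p (Core : {set {set P}}) (k := k'.+1) :
  (1 < p)%N -> (k <= p)%N ->
  (forall U z, (#|U| <= p)%N ->
    chain_on (simplices K k) z -> (forall s, z s != 0 -> s \subset U) ->
    (forall t, bd z t = 0) ->
    (exists2 w, chain_on (simplices K k.+1) w & bd w =1 z) \/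
    (U \in Core /\ z =1 full_chain K k U)) ->
  (forall S, S \in Core -> #|S| = p) ->
  (forall S, S \in Core -> forall t, bd (full_chain K k S) t = 0) ->
  (forall S, S \in Core -> exists2 s, s \in simplices K k & s \subset S) ->
  (forall S s, S \in Core -> s \in simplices K k.+1 -> ~~ (s \subset S)) ->
  (forall S x y, S \in Core -> x \in S -> y \in S ->
    exists2 u, u \in S & (x = u \/ adjacent K x u) /\ (u = y \/ adjacent K u y)) ->
  (#|Core| <= betti K k + tuple_count P (near_tuples R d p r))%N /\
  (betti K k <= #|Core| + tuple_count P (near_tuples R d p r))%N.
Proof.
move=> p1 kp Hloc Cp Ccyc Cface Ctop Cdiam; split; last first.
  have b := betti_le K_closed Hloc.
  by apply: leq_trans b _; rewrite leq_add2l; apply: crowded_le kp _; exact: ltnW.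
have CE : Core = [set S in Core | adj_closed K S] :|: [set S in Core | ~~ adj_closed K S].
  by apply/setP => S; rewrite !inE -andb_orr orbN andbT.
rewrite [X in (X <= _)%N](congr1 (fun C : {set {set P}} => #|C|) CE) cardsU; apply: leq_trans (leq_subr _ _) _.
apply: leq_add; first exact: (betti_ge K_closed Ccyc Cface Ctop Cdiam).
exact: open_cores_le.
Qed.

End CoreCount.

(** * Cores and shapes of tuples *)

Section Shapes.
Context {R : realType} {d : nat}.
Implicit Types (r : R).

Section Points.
Variables (j : nat) (y : 'M[R]_(j, d)).

Lemma row_in_points a : row a y \in points y.
Proof. by apply/imfsetP; exists a. Qed.

Definition point a : points y := [` row_in_points a]%fset.

Lemma point_surj (x : points y) : exists a, x = point a.
Proof.
have /imfsetP[a _ xa] := valP x.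
by exists a; apply: val_inj; rewrite /= xa.
Qed.

Lemma point_inj : injective (fun a => row a y) -> injective point.
Proof. by move=> yi a b /(congr1 val)/yi. Qed.

Lemma point_bij : injective (fun a => row a y) -> bijective point.
Proof.
move=> yi; pose g x := sval (cid (point_surj x)).
have gK x : point (g x) = x by rewrite /g; case: cid.
exists g => // a; exact: point_inj.
Qed.

Lemma card_points_inj : #|{: points y}| = j -> injective (fun a => row a y).
Proof.
move=> cj a b ab; have /image_injP/(_ a b) : #|[seq point c | c in 'I_j]| == #|'I_j|.
  rewrite card_ord -[X in _ == X]cj; apply/eqP/eq_card => x; rewrite inE.
  by have [c ->] := point_surj x; rewrite fintype.image_f.
by rewrite !inE; apply => //; apply: val_inj.
Qed.

Lemma point_set (s : {set points y}) : exists I : {set 'I_j}, s = point @: I.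
Proof.
exists [set a | point a \in s]; apply/setP => x; apply/idP/imsetP => [xs|[a]].
  by have [a xa] := point_surj x; exists a; rewrite // inE -xa.
by rewrite inE => ay ->.
Qed.

End Points.

Section Transfer.
Variables (P : {fset 'rV[R]_d}) (j : nat) (f : {ffun 'I_j -> P}) (r : R).
Hypothesis f_inj : injective f.
Hypothesis r_gt0 : 0 < r.
Let y := tuple_of f.

Let rowE a : row a y = val (f a). Proof. exact: row_tuple_of. Qed.

Let pt_inj : injective (point y).
Proof. by apply: point_inj => a b; rewrite !rowE => /val_inj/f_inj. Qed.

Lemma cech_points (I : {set 'I_j}) :
  (point y @: I \in cech (points y) r) = (f @: I \in cech P r).
Proof.
apply/cechP/cechP => -[I0 [z zI]]; split.
- by move: I0; rewrite -!card_gt0 !card_imset.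
- by exists z => _ /imsetP[a aI ->]; rewrite -rowE; apply: (zI (point y a)); exact: imset_f.
- by move: I0; rewrite -!card_gt0 !card_imset.
- by exists z => _ /imsetP[a aI ->]; rewrite /= rowE; apply: zI; exact: imset_f.
Qed.

End Transfer.

(** The points of an injective tuple are in bijection with its indices, and the
    complex built on them is the restriction to them of the complex of [P]. *)
Lemma hollow_shape (P : {fset 'rV[R]_d}) k r (f : {ffun 'I_k.+2 -> P}) :
  0 < r -> injective f ->
  complex_iso (cech (points (tuple_of f)) r) (hollow_simplex k.+2) <->
  f @: [set: 'I_k.+2] \in hollow_cores (cech P r) k.
Proof.
move=> r_gt0 f_inj; set y := tuple_of f.
have pt_inj : injective (point y).
  by apply: point_inj => a b; rewrite !row_tuple_of => /val_inj/f_inj.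
split.
  move=> [h h_bij hE]; have hi := bij_inj h_bij.
  have H (I : {set 'I_k.+2}) : (f @: I \in cech P r) = (0 < #|I| < k.+2)%N.
    by rewrite -cech_points// -hE finset.in_set !card_imset.
  apply/hollow_coresP; split.
  - by rewrite card_imset// cardsT card_ord.
  - by rewrite H cardsT card_ord ltnn andbF.
  - move=> s sf sk; have sE : s = f @: (f @^-1: s).
      apply/setP => x; apply/idP/imsetP => [xs|[a]]; last by rewrite inE => ? ->.
      have /imsetP[a _ xa] := fintype.subsetP sf _ xs.
      by exists a; rewrite // inE -xa.
    by rewrite sE H -(card_imset _ f_inj) -sE sk ltnSn.
move=> /hollow_coresP[cS SK faces].
have [g gK pK] : bijective (point y).
  by apply: point_bij => a b; rewrite !row_tuple_of => /val_inj/f_inj.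
exists g; first by exists (point y).
move=> s; have [I ->] := point_set s.
have -> : g @: (point y @: I) = I.
  by rewrite -imset_comp (eq_imset (g := id)) ?imset_id.
rewrite cech_points// finset.in_set; apply/idP/idP => [/andP[I0 Ik]|].
  have [a aI] : exists a, a \notin I.
    have /card_gt0P[a] : (0 < #|~: I|)%N by rewrite cardsCs finset.setCK card_ord subn_gt0.
    by rewrite inE; exists a.
  apply: (@cech_closed _ _ _ _ (f @: (~: [set a]))).
  - apply: faces; first by apply: imsetS; exact: finset.subsetT.
    by rewrite card_imset// cardsC1 card_ord.
  - by apply: imsetS; rewrite finset.subsetC finset.sub1set inE.
  - by rewrite -card_gt0 card_imset.
move=> IK; have /cechP[I0 _] := IK; move: I0; rewrite -card_gt0 card_imset// => ->/=.
have := max_card I; rewrite card_ord leq_eqVlt => /predU1P[cI|//].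
suff IT : I = [set: 'I_k.+2] by rewrite IT (negbTE SK) in IK.
by apply/eqP; rewrite eqEcard finset.subsetT cardsT card_ord cI leqnn.
Qed.

(** In one direction, the unique non-neighbour of a vertex labelled by [(b, i)] is
    the one labelled by [(~~ b, i)]; the other direction is [cross_labelling]. *)
Lemma cross_shape (P : {fset 'rV[R]_d}) k r (f : {ffun 'I_k.*2.+2 -> P}) :
  0 < r -> injective f ->
  graph_iso (@geometric_graph R d (points (tuple_of f)) r) (@cross_polytope_graph k) <->
  f @: [set: 'I_k.*2.+2] \in cross_cores (rips P r) k.
Proof.
move=> r_gt0 f_inj; set y := tuple_of f.
have rowE a : row a y = val (f a) by exact: row_tuple_of.
have pt_inj : injective (point y).
  by apply: point_inj => a b; rewrite !rowE => /val_inj/f_inj.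
have cS : #|f @: [set: 'I_k.*2.+2]| = k.+1.*2 by rewrite card_imset// cardsT card_ord.
rewrite finset.in_set; split.
  move=> [h [g hK gK] hE]; rewrite /cross cS eqxx /=.
  apply/forall_inP => _ /imsetP[a _ ->].
  have [b bE] := point_surj (g (~~ (h (point y a)).1, (h (point y a)).2)).
  apply/cards1P; exists (f b); apply/setP => x; rewrite !inE.
  have -> : (x \in f @: [set: 'I_k.*2.+2]) && ((x != f a) && ~~ adjacent (rips P r) (f a) x) =
      [exists c, (x == f c) && ((c != a) && ~~ adjacent (rips P r) (f a) (f c))].
    apply/andP/existsP => [[/imsetP[c _ ->]]|[c /andP[/eqP->]]].
      by rewrite (inj_eq f_inj) => H; exists c; rewrite eqxx.
    by rewrite (inj_eq f_inj) => H; rewrite imset_f.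
  have adjE c : (c != a) && ~~ adjacent (rips P r) (f a) (f c) = (c == b).
    have := hE (point y a) (point y c); rewrite /geometric_graph /= !rowE -adjacent_rips//.
    rewrite (inj_eq pt_inj) -(inj_eq pt_inj c b) -bE -(inj_eq (can_inj hK) (point y c)) gK.
    rewrite -(inj_eq pt_inj c a) -(inj_eq (can_inj hK) (point y c)) -(inj_eq pt_inj a c).
    rewrite -(inj_eq (can_inj hK) (point y a) (point y c)).
    case: (h (point y a)) (h (point y c)) => [u i] [v l]; rewrite /cross_polytope_graph /=.
    rewrite -!pair_eqE /pair_eq /= (eq_sym l i) (eq_sym v u).
    by case: (i == l); case: u; case: v; case: (adjacent _ _ _).
  apply/existsP/eqP => [[c]|->]; first by rewrite adjE => /andP[/eqP-> /eqP->].
  by exists b; rewrite adjE !eqxx.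
move=> SC; have [h [h_inj hS hE]] := cross_labelling (@adjacent_sym _ _) SC.
have idx u : {a | f a = h u}.
  by apply: cid; have /imsetP[a _ ->] := hS u; exists a.
pose H u := point y (sval (idx u)).
have H_inj : injective H.
  move=> u v /pt_inj uv; apply: h_inj.
  by rewrite -(svalP (idx u)) -(svalP (idx v)) uv.
have pt_bij : bijective (point y).
  by apply: point_bij => a b; rewrite !rowE => /val_inj/f_inj.
have H_bij : bijective H.
  apply: inj_card_bij => //; rewrite card_prod card_bool card_ord mul2n.
  by rewrite -(bij_eq_card pt_bij) card_ord.
have [g HK gK] := H_bij; exists g; first by exists H.
move=> x z; rewrite -{2}[x]gK -{2}[z]gK; set u := g x; set v := g z.
rewrite /cross_polytope_graph hE /geometric_graph (inj_eq H_inj) (inj_eq h_inj).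
by congr (_ && _); rewrite adjacent_rips// /H /= !rowE !(svalP (idx _)).
Qed.

End Shapes.

(** * Comparison of Betti numbers with numbers of tuples *)

Section PointwiseBounds.
Context {R : realType} {d : nat}.
Variables (P : {fset 'rV[R]_d}) (r : R).
Hypothesis r_gt0 : 0 < r.

Lemma dist_of_count (b c T N p : nat) : T = (p`! * c)%N ->
  (c <= b + N)%N -> (b <= c + N)%N -> `|b%:R - (p`!%:R)^-1 * T%:R| <= N%:R :> R.
Proof.
move=> -> cb bc; rewrite natrM mulKf ?pnatr_eq0 -?lt0n ?fact_gt0//.
by rewrite ler_distl lerBlDr -!natrD !ler_nat cb bc.
Qed.

Lemma cech_betti_count k : (0 < k)%N ->
  `|(betti (cech P r) k)%:R - ((k.+2)`!%:R)^-1 *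
     (tuple_count P (fun y : 'M[R]_(k.+2, d) => complex_iso (cech (points y) r) (hollow_simplex k.+2)))%:R|
  <= (tuple_count P (near_tuples R d k.+2 r))%:R :> R.
Proof.
case: k => // k _.
have K_closed := @cech_closed _ _ P r.
have cores S : S \in hollow_cores (cech P r) k.+1 -> #|S| = k.+3 by case/hollow_coresP.
have [le1 le2] : (#|hollow_cores (cech P r) k.+1| <= betti (cech P r) k.+1 +
    tuple_count P (near_tuples R d k.+3 r))%N /\
  (betti (cech P r) k.+1 <= #|hollow_cores (cech P r) k.+1| +
    tuple_count P (near_tuples R d k.+3 r))%N.
  apply: betti_core_count => //.
  - exact: adjacent_cech.
  - exact: ltnW.
  - by move=> U z; exact: hollow_local.
  - by move=> S SC t; exact: hollow_cycle.
  - by move=> S; exact: hollow_face.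
  - by move=> S s; exact: hollow_top.
  - move=> S x y SC xS yS; exists y => //; split; last by left.
    by right; apply: hollow_adjacent SC xS yS.
apply: dist_of_count le1 le2; apply: tuple_count_cores => // f f_inj.
exact: hollow_shape.
Qed.

Lemma rips_betti_count k : (0 < k)%N ->
  `|(betti (rips P r) k)%:R - ((k.*2.+2)`!%:R)^-1 *
     (tuple_count P (fun y : 'M[R]_(k.*2.+2, d) => graph_iso (@geometric_graph R d (points y) r)
        (@cross_polytope_graph k)))%:R|
  <= (tuple_count P (near_tuples R d k.*2.+2 r))%:R :> R.
Proof.
case: k => // k _.
have flag := @rips_flag _ _ P r r_gt0.
have K_closed := @flag_closed _ _ flag.
have cores S : S \in cross_cores (rips P r) k.+1 -> #|S| = k.+1.*2.+2.
  by rewrite inE => /andP[/eqP].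
have [le1 le2] : (#|cross_cores (rips P r) k.+1| <= betti (rips P r) k.+1 +
    tuple_count P (near_tuples R d k.+1.*2.+2 r))%N /\
  (betti (rips P r) k.+1 <= #|cross_cores (rips P r) k.+1| +
    tuple_count P (near_tuples R d k.+1.*2.+2 r))%N.
  apply: betti_core_count => //.
  - exact: adjacent_rips.
  - by rewrite -addnn !addSn addnS ltnS -addnS leqW// leqW// leq_addr.
  - by move=> U z; rewrite -doubleS; exact: (flag_local flag).
  - by move=> S SC t; exact: (cross_core_cycle flag).
  - by move=> S; exact: (cross_core_face flag).
  - by move=> S s; exact: (cross_core_top flag).
  - by move=> S x y; exact: cross_core_diam.
apply: dist_of_count le1 le2; apply: tuple_count_cores => // f f_inj.
exact: cross_shape.
Qed.

(** The number of vertices exceeds the number of components by the rank of the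
    boundary of edges, which is at most the number of edges. *)
Lemma components_count (K : {set {set P}}) :
  (forall x, [set x] \in K) -> (forall x y, adjacent K x y = (enorm (val x - val y) <= r)) ->
  `|(betti K 0)%:R - (1`!%:R)^-1 * (tuple_count P (@setT 'M[R]_(1, d)))%:R|
  <= (tuple_count P (near_tuples R d 1 r))%:R :> R.
Proof.
move=> K0 Kadj.
have s0 : #|simplices K 0| = #|[set: {set P}] :&: [set s : {set P} | #|s| == 1%N]|.
  apply: eq_card => s; rewrite !inE; apply/andP/idP => [[]//|s1].
  by split => //; have /cards1P[x ->] := s1.
set c := #|_ :&: _| in s0.
have cE : tuple_count P (@setT 'M[R]_(1, d)) = (1`! * c)%N.
  rewrite /c finset.setTI; apply: tuple_count_cores => [S|f f_inj].
    by rewrite inE => /eqP.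
  by rewrite inE card_imset// cardsT card_ord.
have bE : betti K 0 = (c - \rank (boundary K 0))%N by rewrite -s0.
have rc : (\rank (boundary K 0) <= c)%N by rewrite -s0; exact: rank_leq_col.
have le1 : (c <= betti K 0 + tuple_count P (near_tuples R d 1 r))%N.
  rewrite bE -[X in (X <= _)%N](subnK rc) leq_add2l.
  apply: leq_trans (rank_leq_row _) _.
  apply: (@card_le_near_tuples _ _ _ _ 2) => // s /simplicesP[sK s2]; split => //.
  exists s; split => // x y xs ys; have [->|xy] := eqVneq x y.
    by rewrite subrr enorm0 mulr_ge0// ltW.
  apply: (@le_trans _ _ r); last by rewrite ler_peMl ?ler1n// ltW.
  rewrite enormC -Kadj /adjacent; suff <- : s = [set x; y] by [].
  by apply/esym/eqP; rewrite eqEcard finset.subUset !finset.sub1set xs ys s2 cards2 xy.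
apply: dist_of_count cE le1 _.
by apply: leq_trans (leq_addr _ _); rewrite bE leq_subr.
Qed.

Lemma cech_components_count :
  `|(betti (cech P r) 0)%:R - (1`!%:R)^-1 * (tuple_count P (@setT 'M[R]_(1, d)))%:R|
  <= (tuple_count P (near_tuples R d 1 r))%:R :> R.
Proof.
apply: components_count; last exact: adjacent_cech.
move=> x; apply/cechP; split; first by apply/set0Pn; exists x; rewrite inE.
by exists (val x) => y; rewrite inE => /eqP->; rewrite /eball /= subrr enorm0 divr_ge0// ltW.
Qed.

Lemma rips_components_count :
  `|(betti (rips P r) 0)%:R - (1`!%:R)^-1 * (tuple_count P (@setT 'M[R]_(1, d)))%:R|
  <= (tuple_count P (near_tuples R d 1 r))%:R :> R.
Proof.
apply: components_count; last exact: adjacent_rips.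
move=> x; apply/ripsP => //; split; first by apply/set0Pn; exists x; rewrite inE.
by move=> a b; rewrite !inE => /eqP-> /eqP->; rewrite subrr enorm0 ltW.
Qed.

End PointwiseBounds.

(** * Dependence of shapes on finitely many relations *)

Section ShapeTransfer.
Context {R : realType} {d j : nat}.
Variables (y y' : 'M[R]_(j, d)) (r r' : R) (V : finType).
Hypothesis cV : #|V| = j.
Hypothesis same_rows : forall a b, row a y = row b y <-> row a y' = row b y'.

(** A bijection onto a set of [j] elements forces the [j] rows to be distinct, so the
    points of both tuples are in bijection with their indices. *)
Lemma point_relabelling (h : points y -> V) : bijective h ->
  exists2 phi : points y' -> points y, bijective phi & forall a, phi (point y' a) = point y a.
Proof.
move=> h_bij; have yi : injective (fun a => row a y).
  by apply: card_points_inj; rewrite (bij_eq_card h_bij) cV.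
have y'i : injective (fun a => row a y') by move=> a b /same_rows/yi.
have [g gK pK] := point_bij y'i.
exists (point y \o g); first by apply: bij_comp; [exact: point_bij|exists (point y')].
by move=> a; rewrite /= gK.
Qed.

Lemma complex_iso_transfer (L : {set {set V}}) :
  (forall I : {set 'I_j}, (exists z, forall a, a \in I -> eball (row a y) (r / 2) z) <->
     (exists z, forall a, a \in I -> eball (row a y') (r' / 2) z)) ->
  complex_iso (cech (points y) r) L -> complex_iso (cech (points y') r') L.
Proof.
move=> same [h h_bij hE]; have [phi phi_bij phiE] := point_relabelling h_bij.
exists (h \o phi); first exact: bij_comp.
move=> s; rewrite imset_comp hE; have [I ->] := point_set s.
have -> : phi @: (point y' @: I) = point y @: I.
  by rewrite -imset_comp; apply: eq_imset => a; rewrite /= phiE.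
have E (x : 'M[R]_(j, d)) (q : R) : (point x @: I \in cech (points x) q) =
    (I != finset.set0) && `[< exists z, forall a, a \in I -> eball (row a x) (q / 2) z >].
  apply/cechP/andP => -[I0 H]; split.
  - by apply: contraNneq I0 => ->; rewrite imset0.
  - by apply/asboolP; have [z zI] := H; exists z => a aI; exact: (zI (point x a) (imset_f _ aI)).
  - by have [a aI] := set0Pn _ I0; apply/set0Pn; exists (point x a); exact: imset_f.
  - by have /asboolP[z zI] := H; exists z => _ /imsetP[a aI ->]; exact: zI.
by rewrite !E; congr (_ && _); apply: asbool_equiv_eq.
Qed.

Lemma graph_iso_transfer (e : rel V) :
  (forall a b, (enorm (row a y - row b y) <= r) = (enorm (row a y' - row b y') <= r')) ->
  graph_iso (@geometric_graph R d (points y) r) e ->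
  graph_iso (@geometric_graph R d (points y') r') e.
Proof.
move=> same [h h_bij hE]; have [phi phi_bij phiE] := point_relabelling h_bij.
exists (h \o phi); first exact: bij_comp.
move=> u v; rewrite /= hE /geometric_graph (inj_eq (bij_inj phi_bij)).
have [a ->] := point_surj u; have [b ->] := point_surj v.
by rewrite !phiE /= same.
Qed.

End ShapeTransfer.

Local Open Scope classical_set_scope.
Local Open Scope ring_scope.

(** * Measurability of shapes *)

Section MeasurableShapes.
Context {R : realType} {d j : nat}.
Implicit Types (y : 'M[R]_(j, d)).

(** Such a set is a finite union of cells of the partition generated by the [E i]. *)
Lemma measurable_of_data disp (T : measurableType disp) (I : finType) (E : I -> set T) (Q : set T) :
  (forall i, measurable (E i)) ->
  (forall x x', (forall i, E i x <-> E i x') -> Q x -> Q x') -> measurable Q.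
Proof.
move=> mE EQ; pose data x : {ffun I -> bool} := [ffun i => `[< E i x >]].
have -> : Q = \bigcup_(b in data @` Q) \bigcap_i (if b i then E i else ~` E i).
  apply/seteqP; split => [x Qx|x [_ [x0 Qx0 <-] H]].
    exists (data x); first by exists x.
    by move=> i _; rewrite ffunE; case: asboolP.
  apply: (EQ x0) => // i; have := H i Logic.I; rewrite ffunE.
  by case: asboolP.
apply: fin_bigcup_measurable; first exact: finite_finset.
move=> b _; apply: fin_bigcap_measurable; first exact: finite_finset.
by move=> i _; case: (b i) => //; exact: measurableC.
Qed.

Lemma enorm_le_coord (x : 'rV[R]_d) e : (forall i, `|x ord0 i| <= e) -> 0 <= e ->
  enorm x <= d%:R * e.
Proof.
move=> xe e0; rewrite -(@ler_sqr R) ?nnegrE ?enorm_ge0 ?mulr_ge0// sqr_enorm.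
apply: (@le_trans _ _ (\sum_(i < d) e ^+ 2)).
  apply: ler_sum => i _; rewrite -[x ord0 i ^+ 2]real_normK ?num_real//.
  by rewrite ler_sqr ?nnegrE.
rewrite sumr_const card_ord exprMn -[X in X <= _]mulr_natl ler_wpM2r ?sqr_ge0//.
by rewrite -natrX ler_nat; case: (d) => // n; rewrite leq_pmull.
Qed.

Lemma measurable_enorm_le disp (T : measurableType disp) (F : T -> 'rV[R]_d) c :
  (forall i, measurable_fun setT (fun x => F x ord0 i)) ->
  measurable [set x | enorm (F x) <= c].
Proof.
move=> mF; have [c0|c0] := leP 0 c; last first.
  rewrite (_ : [set _ | _] = set0)//; apply/seteqP; split => // x /= xc.
  by have := le_lt_trans xc c0; rewrite ltNge enorm_ge0.
have -> : [set x | enorm (F x) <= c] =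
    (fun x => \sum_(i < d) F x ord0 i ^+ 2) @^-1` [set` `]-oo, c ^+ 2]].
  apply/seteqP; split => x; rewrite /= in_itv /= -sqr_enorm ler_sqr ?nnegrE ?enorm_ge0//.
rewrite -[X in measurable X]setTI; apply: measurable_sum => // i.
exact: measurable_funX.
Qed.

Lemma measurable_row_dist a b c : measurable [set y : 'M[R]_(j, d) | enorm (row a y - row b y) <= c].
Proof.
apply: measurable_enorm_le => i.
under eq_fun do rewrite !mxE; apply: measurable_funB; exact: measurable_mx_entry.
Qed.

Lemma measurable_row_eq a b : measurable [set y : 'M[R]_(j, d) | row a y = row b y].
Proof.
have -> : [set y : 'M[R]_(j, d) | row a y = row b y] = [set y : 'M[R]_(j, d) | enorm (row a y - row b y) <= 0].
  apply/seteqP; split => y /= => [->|ab]; first by rewrite subrr enorm0.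
  apply/rowP => i; apply/eqP; rewrite -subr_eq0 -normr_le0.
  by apply: le_trans ab; have := enorm_coord (row a y - row b y) i; rewrite !mxE.
exact: measurable_row_dist.
Qed.

(** Closed balls have a common point as soon as all slightly larger balls have
    a common rational point, by compactness. *)
Lemma common_point_approx (I : {set 'I_j}) y c :
  (exists z, forall a, a \in I -> eball (row a y) c z) <->
  (forall n, exists q : 'rV[rat]_d, forall a, a \in I ->
     enorm (map_mx ratr q - row a y) <= c + n.+1%:R^-1).
Proof.
split=> [[z zI] n|H].
  pose e : R := (d.+1%:R)^-1 * (n.+1%:R)^-1.
  have e0 : 0 < e by rewrite mulr_gt0// invr_gt0.
  have [q qz] : exists q : 'rV[rat]_d, forall i, `|ratr (q ord0 i) - z ord0 i| <= e.
    have H i : exists q : rat, `|ratr q - z ord0 i| <= e.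
      have lt : z ord0 i - e < z ord0 i + e by lra.
      have [q] := rat_in_itvoo lt; rewrite in_itv /= => /andP[q1 q2].
      by exists q; rewrite ler_norml; apply/andP; split; lra.
    have [q qE] := choice H; exists (\row_i q i) => i; rewrite mxE; exact: qE.
  exists q => a aI; apply: le_trans (enorm_dist _ z _) _; rewrite addrC lerD ?zI//.
  have {}qz i : `|(map_mx ratr q - z) ord0 i| <= e by rewrite !mxE.
  apply: le_trans (enorm_le_coord qz (ltW e0)) _.
  by rewrite /e mulrA ler_piMl ?invr_ge0// ler_pdivrMr ?ltr0n// mul1r ler_nat.
have [->|[a0 a0I]] := set_0Vmem I; first by exists 0 => a; rewrite inE.
have [q qE] := choice H; pose z n : 'rV[R]_d := map_mx ratr (q n).
have zE n a : a \in I -> enorm (z n - row a y) <= c + n.+1%:R^-1 by exact: qE.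
pose M := enorm (row a0 y) + `|c| + 1.
have zM n i : z n ord0 i \in `[- M, M].
  rewrite in_itv /= -ler_norml; apply: le_trans (enorm_coord _ _) _.
  have -> : z n = z n - row a0 y + row a0 y by rewrite subrK.
  apply: le_trans (enormD _ _) _; rewrite addrC /M -addrA lerD2l.
  apply: le_trans (zE _ _ a0I) _; rewrite lerD ?ler_norm// invf_le1 ?ltr0n//.
  by rewrite ler1n.
have Kc : compact [set v : 'rV[R]_d | forall i, `[- M, M]%classic (v ord0 i)].
  by apply: (@rV_compact R d (fun=> `[- M, M]%classic)) => i; exact: segment_compact.
have [|w [_ wc]] := Kc (z @ \oo) _; first by exists 0%N => // n _ i /=; exact: zM.
exists w => a aI; rewrite /eball /=.
rewrite leNgt; apply/negP => cw; pose e := (enorm (w - row a y) - c) / 2.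
have e0 : 0 < e by rewrite divr_gt0// subr_gt0.
pose del := e / d.+1%:R.
have del0 : 0 < del by rewrite divr_gt0.
have tail : \forall n \near \oo, enorm (z n - row a y) < c + e.
  near=> n; apply: le_lt_trans (zE n a aI) _; rewrite ltrD2l.
  near: n; exact: (near_infty_natSinv_lt (PosNum e0)).
have [v [/= v1 v2]] := wc [set v | enorm (v - row a y) < c + e] _ tail (nbhsx_ballx w del del0).
have wv : enorm (w - v) <= e.
  have wvi i : `|(w - v) ord0 i| <= del by rewrite !mxE ltW//; case: v2 => _ v2; exact: v2.
  apply: le_trans (enorm_le_coord wvi (ltW del0)) _.
  rewrite /del mulrCA; apply: ler_piMr; first exact: ltW.
  by rewrite ler_pdivrMr ?ltr0n// mul1r ler_nat.
have := enorm_dist w v (row a y).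
have : e + e = enorm (w - row a y) - c by rewrite /e -splitr.
by move: wv v1; lra.
Unshelve. all: by end_near.
Qed.

(** [common_point_approx] expresses the condition by countable unions and
    intersections of conditions on distances to fixed points. *)
Lemma measurable_common_point (I : {set 'I_j}) c :
  measurable [set y : 'M[R]_(j, d) | exists z, forall a, a \in I -> eball (row a y) c z].
Proof.
have -> : [set y : 'M[R]_(j, d) | exists z, forall a, a \in I -> eball (row a y) c z] =
    \bigcap_n \bigcup_(q : 'rV[rat]_d) \bigcap_(a in [set` I])
      [set y : 'M[R]_(j, d) | enorm (map_mx ratr q - row a y) <= c + n.+1%:R^-1].
  apply/seteqP; split => y /=.
    by move=> /common_point_approx H n _; have [q qI] := H n; exists q.
  move=> H; apply/common_point_approx => n; have [q _ qI] := H n Logic.I.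
  by exists q.
apply: bigcapT_measurable => n; apply: countable_bigcupT_measurable => //.
move=> q; apply: fin_bigcap_measurable; first exact: finite_finpred.
move=> a _; apply: measurable_enorm_le => i.
under eq_fun do rewrite !mxE; apply: measurable_funB => //; exact: measurable_mx_entry.
Qed.

Lemma measurable_complex_iso (V : finType) (L : {set {set V}}) (r : R) : #|V| = j ->
  measurable [set y : 'M[R]_(j, d) | complex_iso (cech (points y) r) L].
Proof.
move=> cV; pose E (i : 'I_j * 'I_j + {set 'I_j}) : set 'M[R]_(j, d) :=
  match i with
  | inl ab => [set y : 'M[R]_(j, d) | row ab.1 y = row ab.2 y]
  | inr J => [set y : 'M[R]_(j, d) | exists z, forall a, a \in J -> eball (row a y) (r / 2) z]
  end.
apply: (@measurable_of_data _ _ _ E).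
  case=> [[a b]|I]; [exact: measurable_row_eq|exact: measurable_common_point].
move=> y y' same; apply: complex_iso_transfer => // [a b|I].
- exact: (same (inl (a, b))).
- exact: (same (inr I)).
Qed.

Lemma measurable_graph_iso (V : finType) (e : rel V) (r : R) : #|V| = j ->
  measurable [set y : 'M[R]_(j, d) | graph_iso (@geometric_graph R d (points y) r) e].
Proof.
move=> cV; pose E (i : 'I_j * 'I_j + 'I_j * 'I_j) : set 'M[R]_(j, d) :=
  match i with
  | inl ab => [set y : 'M[R]_(j, d) | row ab.1 y = row ab.2 y]
  | inr ab => [set y : 'M[R]_(j, d) | enorm (row ab.1 y - row ab.2 y) <= r]
  end.
apply: (@measurable_of_data _ _ _ E).
  case=> [[a b]|[a b]]; [exact: measurable_row_eq|exact: measurable_row_dist].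
move=> y y' same; apply: graph_iso_transfer => // [a b|a b].
- exact: (same (inl (a, b))).
- by apply/idP/idP => /(same (inr (a, b))).
Qed.

End MeasurableShapes.

Lemma measurable_near_tuples (R : realType) d n (r : R) :
  measurable (near_tuples R d n r).
Proof.
have -> : near_tuples R d n r = \bigcap_(a : 'I_n.+1)
    [set y : 'M[R]_(n.+1, d) | enorm (row a y - row ord0 y) <= n.+1%:R * r].
  by apply/seteqP; split => y /= H a; [move=> _|]; exact: H.
apply: fin_bigcap_measurable; first exact: finite_finset.
by move=> a _; exact: measurable_row_dist.
Qed.

(** * Measurability of the numbers of tuples *)

Section MeasurableCounts.
Context {R : realType} {d : nat} {disp : measure_display} {Omega : measurableType disp}.

Lemma measurable_row m n (a : 'I_m) : measurable_fun setT (fun y : 'M[R]_(m, n) => row a y).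
Proof.
apply: measurable_fun_mx => i k; under eq_fun do rewrite mxE.
exact: measurable_mx_entry.
Qed.

Definition rectangles (j : nat) : set (set 'M[R]_(j, d)) :=
  [set A | exists2 B : 'I_j -> set 'rV[R]_d, (forall a, measurable (B a)) &
    A = [set y | forall a, B a (row a y)]].

Lemma rectangles_setI j : setI_closed (@rectangles j).
Proof.
move=> _ _ [B mB ->] [C mC ->]; exists (fun a => B a `&` C a).
  by move=> a; exact: measurableI.
by apply/seteqP; split => y /= => [[yB yC] a|H]; [split|split => a; have [] := H a].
Qed.

Lemma measurable_rectangles j : @measurable _ 'M[R]_(j, d) = <<s @rectangles j >>.
Proof.
apply/seteqP; split.
  suff sub : @mx_cylinder R j d `<=` <<s @rectangles j >>.
    exact: (smallest_sub (smallest_sigma_algebra setT (@rectangles j)) sub).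
  move=> _ [i [k [B [mB ->]]]]; apply: sub_gen_smallest.
  exists (fun a => if a == i then [set v : 'rV[R]_d | B (v ord0 k)] else setT).
    move=> a; case: ifP => // _.
    by have := @measurable_mx_entry R 1 d ord0 k measurableT _ mB; rewrite setTI.
  apply/seteqP; split => y /= => [yB a|/(_ i)]; last by rewrite eqxx /= mxE.
  by case: eqP => // ->; rewrite /= mxE.
apply: smallest_sub; first exact: sigma_algebra_measurable.
move=> _ [B mB ->]; rewrite (_ : [set y | _] = \bigcap_a [set y | B a (row a y)]); last first.
  by apply/seteqP; split => y /= H a; [move=> _|]; exact: H.
apply: fin_bigcap_measurable; first exact: finite_finset.
move=> a _; by have := measurable_row a measurableT (mB a); rewrite setTI.
Qed.

Variable F : Omega -> {fset 'rV[R]_d}.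
Hypothesis mF : forall B : set 'rV[R]_d, measurable B ->
  measurable_fun setT (fun w => \sum_(x : F w) \1_B (val x) : R).

Let all_count j w (A : set 'M[R]_(j, d)) : R :=
  \sum_(f : {ffun 'I_j -> F w}) \1_A (tuple_of f).

(** On a rectangle the number of all tuples, distinct or not, is a product of numbers
    of points; the general case follows from the pi-lambda theorem. *)
Let measurable_all_count j (A : set 'M[R]_(j, d)) : measurable A ->
  measurable_fun setT (fun w => all_count w A).
Proof.
rewrite measurable_rectangles; move: A.
have rect (B : 'I_j -> set 'rV[R]_d) : (forall a, measurable (B a)) ->
    measurable_fun setT (fun w => all_count w [set y | forall a, B a (row a y)]).
  move=> mB; rewrite (_ : (fun w => _) = (fun w => \prod_(a < j) \sum_(x : F w) \1_(B a) (val x))).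
    by apply: measurable_prod => a _; exact: mF.
  apply/funext => w; rewrite bigA_distr_bigA; apply: eq_bigr => f _.
  have [fB|] := pselect (forall a, B a (val (f a))).
    rewrite big1 => [|a _]; first by rewrite indicE mem_set// => a /=; rewrite row_tuple_of.
    by rewrite indicE mem_set.
  move=> /existsNP[a nBa].
  rewrite (bigD1 a)//= !indicE (memNset nBa) mul0r memNset// => /(_ a).
  by rewrite row_tuple_of.
have total : measurable_fun setT (fun w => all_count w [set: 'M[R]_(j, d)]).
  have -> : [set: 'M[R]_(j, d)] = [set y | forall a, [set: 'rV[R]_d] (row a y)].
    by apply/seteqP; split.
  by apply: (rect (fun=> setT)) => a; exact: measurableT.
apply: (@dynkin_induction _ _ (@rectangles j)).
- exact: measurable_rectangles.
- exact: rectangles_setI.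
- exact: total.
- by move=> _ [B mB ->]; exact: rect.
- move=> S mS mcS.
  have -> : (fun w => all_count w (~` S)) = (fun w => all_count w [set: 'M[R]_(j, d)] - all_count w S).
    apply/funext => w; rewrite /all_count -sumrB; apply: eq_bigr => f _.
    by rewrite !indicE in_setT in_setC; case: (_ \in S); rewrite ?subrr ?subr0.
  by apply: measurable_funB => //; exact: total.
- move=> E mE tE mcE; apply/measurable_EFinP.
  rewrite (_ : _ \o _ = (fun w => \sum_(0 <= n <oo | n \in xpredT) (all_count w (E n))%:E)%E).
    apply: ge0_emeasurable_sum => [n w _ _|n _]; last exact/measurable_EFinP.
    by rewrite lee_fin sumr_ge0.
  apply/funext => w /=; rewrite /all_count -sumEFin.
  under eq_eseriesr do rewrite -sumEFin.
  rewrite nneseries_sum//; apply: eq_bigr => f _.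
  have EE : \d_(tuple_of f) (\bigcup_k E k) =
      (\sum_(0 <= n <oo | n \in [set: nat]) \d_(tuple_of f) (E n))%E :> \bar R.
    by apply: measure_bigcup.
  rewrite /dirac in EE; rewrite EE.
  by apply: eq_eseriesl => n; rewrite in_setT.
Qed.

Lemma measurable_tuple_count j (Q : set 'M[R]_(j, d)) : measurable Q ->
  measurable_fun setT (fun w => (tuple_count (F w) Q)%:R : R).
Proof.
move=> mQ; pose D := [set y : 'M[R]_(j, d) | injective (fun a => row a y)].
have mD : measurable D.
  apply: (@measurable_of_data _ _ _ (fun ab : 'I_j * 'I_j =>
    [set y : 'M[R]_(j, d) | row ab.1 y = row ab.2 y])).
    by move=> ab; exact: measurable_row_eq.
  by move=> y y' H yi a b /(H (a, b))/yi.
rewrite (_ : (fun w => _) = (fun w => all_count w (D `&` Q))).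
  by apply: measurable_all_count; exact: measurableI.
apply/funext => w; rewrite /tuple_count -sum1_card natr_sum big_mkcond /=.
apply: eq_bigr => f _; rewrite finset.in_set indicE in_setI.
have -> : injectiveb f = (tuple_of f \in D).
  apply/injectiveP/idP => [fi|/set_mem fi a b ab].
    by apply/mem_set => a b; rewrite !row_tuple_of => /val_inj/fi.
  by apply: fi; rewrite !row_tuple_of ab.
have -> : `[< Q (tuple_of f) >] = (tuple_of f \in Q).
  by apply/asboolP/idP => [/mem_set|/set_mem].
by case: (_ && _); rewrite ?natr1.
Qed.

End MeasurableCounts.

Lemma counting_image (R : realType) (I : finType) (T : choiceType) (g : I -> T) (A : {set I}) :
  injective g -> counting [set g x | x in [set` A]] = #|A|%:R%:E :> \bar R.
Proof.
move=> gi; have -> : [set g x | x in [set` A]] = [set` [fset g x | x in A]%fset].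
  apply/seteqP; split => y /=.
    by move=> [x /= xA <-]; apply/imfsetP; exists x.
  by move=> /imfsetP[x /= xA ->]; exists x.
rewrite /counting asboolT; last exact: finite_fset.
by rewrite set_fsetK card_imfset//= -cardE.
Qed.

(** * Numbers of tuples of a point process *)

Section PointProcessCounts.
Context {R : realType} {d : nat} {disp : measure_display} {Omega : measurableType disp}.
Variables (P : probability Omega R) (Phi : {RV P >-> configuration R d}).
Hypothesis Phi_lf : forall w, locally_finite (Phi w).
Variable (W : set 'rV[R]_d) (M : R).
Hypothesis mW : measurable W.
Hypothesis W_bounded : W `<=` eball 0 M.

Let F w := fset_set ((Phi w : set 'rV[R]_d) `&` W).

Let finite_points w : finite_set ((Phi w : set 'rV[R]_d) `&` W).
Proof. by apply: sub_finite_set (Phi_lf w M) => x [Px /W_bounded]. Qed.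

Let FP w x : (x \in F w) = `[< Phi w x /\ W x >].
Proof. by rewrite in_fset_set//; apply/idP/asboolP => [/set_mem|/mem_set]. Qed.

Lemma counting_tuples j w (Q : set 'M[R]_(j, d)) :
  counting (@distinct_tuples R d j (Phi w) `&` ([set y | forall a, W (row a y)] `&` Q)) =
  (tuple_count (F w) Q)%:R%:E :> \bar R.
Proof.
rewrite -(counting_image _ _ (g := fun f : {ffun 'I_j -> F w} => tuple_of f)); last first.
  move=> f g fg; apply/ffunP => a; apply: val_inj.
  by rewrite -!row_tuple_of fg.
congr counting; apply/seteqP; split => [y /= [[yPhi yi] [yW yQ]]|_ /= [f + <-]].
  have yF a : row a y \in F w by rewrite FP; apply/asboolP; split.
  have fy : tuple_of [ffun a => [` yF a]%fset] = y.
    by apply/row_matrixP => a; rewrite row_tuple_of ffunE.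
  exists [ffun a => [` yF a]%fset] => //=; rewrite finset.in_set fy.
  apply/andP; split; last exact/asboolP.
  by apply/injectiveP => a b; rewrite !ffunE => /(congr1 val)/yi.
rewrite finset.in_set => /andP[/injectiveP fi /asboolP fQ].
have FPa a : Phi w (val (f a)) /\ W (val (f a)).
  by apply/asboolP; rewrite -FP; exact: valP.
split; first split.
- by move=> a; rewrite row_tuple_of; case: (FPa a).
- by move=> a b; rewrite !row_tuple_of => /val_inj/fi.
- by split => // a; rewrite row_tuple_of; case: (FPa a).
Qed.

(** The level sets of the number of points are the generating events of the
    sigma-algebra of configurations. *)
Lemma measurable_point_count (B : set 'rV[R]_d) : measurable B ->
  measurable_fun setT (fun w => \sum_(x : F w) \1_B (val x) : R).
Proof.
move=> mB; pose n w := #|finset (fun x : F w => val x \in B)|.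
have nE w : \sum_(x : F w) \1_B (val x) = (n w)%:R :> R.
  rewrite /n -sum1_card natr_sum [RHS]big_mkcond /=; apply: eq_bigr => x _.
  by rewrite indicE finset.in_set; case: (_ \in B).
have level k : measurable [set w | n w = k].
  have -> : [set w | n w = k] = Phi @^-1`
      [set phi : configuration R d | counting ((phi : set _) `&` (W `&` B)) = k%:R%:E :> \bar R].
    have cE w : counting ((Phi w : set 'rV[R]_d) `&` (W `&` B)) = (n w)%:R%:E :> \bar R.
      have -> : (Phi w : set 'rV[R]_d) `&` (W `&` B) =
          [set val x | x in [set` finset (fun x : F w => val x \in B)]].
        apply/seteqP; split => [x [Px [Wx Bx]]|_ /= [x + <-]].
          have xF : x \in F w by rewrite FP; apply/asboolP.
          by exists [` xF]%fset => //=; rewrite finset.in_set mem_set.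
        rewrite finset.in_set => /set_mem xB.
        by have : val x \in F w := valP x; rewrite FP => /asboolP[].
      by rewrite counting_image//; exact: val_inj.
    apply/seteqP; split => w /=; rewrite cE; first by move=> ->.
    by move=> [/eqP]; rewrite eqr_nat => /eqP.
  rewrite -[X in measurable X]setTI; apply: (measurable_funP Phi) => //.
  by apply: sub_sigma_algebra; exists (W `&` B), k; split => //; exact: measurableI.
move=> _ Y mY; rewrite setTI.
have -> : (fun w => \sum_(x : F w) \1_B (val x) : R) @^-1` Y =
    \bigcup_(k in [set k | Y k%:R]) [set w | n w = k].
  apply/seteqP; split => w /=; first by rewrite nE => Yn; exists (n w).
  by move=> [k /= Yk nk]; rewrite nE nk.
by apply: bigcup_measurable.
Qed.

Lemma measurable_process_count j (Q : set 'M[R]_(j, d)) : measurable Q ->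
  measurable_fun setT (fun w => (tuple_count (F w) Q)%:R : R).
Proof. by apply: measurable_tuple_count; exact: measurable_point_count. Qed.

Lemma measurable_rows_in j : measurable [set y : 'M[R]_(j, d) | forall a, W (row a y)].
Proof.
rewrite (_ : [set y | _] = \bigcap_a [set y : 'M[R]_(j, d) | W (row a y)]); last first.
  by apply/seteqP; split => y /= H a; [move=> _|]; exact: H.
apply: fin_bigcap_measurable; first exact: finite_finset.
by move=> a _; have := measurable_row a measurableT mW; rewrite setTI.
Qed.

Lemma expectation_tuple_count j (rho : 'M[R]_(j, d) -> R) (Q : set 'M[R]_(j, d)) :
  joint_intensity P Phi rho -> measurable Q ->
  (\int[P]_w (tuple_count (F w) Q)%:R%:E =
   \int[@lebesgue_mx R j d]_(y in [set y | forall a, W (row a y)] `&` Q) (rho y)%:E)%E.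
Proof.
move=> rhoP mQ; rewrite -(joint_intensity_density rhoP); last first.
  by apply: measurableI => //; exact: measurable_rows_in.
by apply: eq_integral => w _; rewrite counting_tuples.
Qed.

End PointProcessCounts.

(** * Lebesgue measure on tuples of points *)

Section LebesgueMatrix.
Context {R : realType}.

Definition boxes (m n : nat) : set (set 'M[R]_(m, n)) :=
  [set B | exists2 A : 'I_m -> 'I_n -> set R, (forall i j, measurable (A i j)) &
    B = [set M : 'M[R]_(m, n) | forall i j, A i j (M i j)]].

Lemma boxes_setI m n : setI_closed (@boxes m n).
Proof.
move=> _ _ [A mA ->] [B mB ->]; exists (fun i j => A i j `&` B i j).
  by move=> i j; exact: measurableI.
apply/seteqP; split => y /= => [[yB yC] i j|H]; first by split.
by split => i j; have [] := H i j.
Qed.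

Lemma measurable_box m n (A : 'I_m -> 'I_n -> set R) : (forall i j, measurable (A i j)) ->
  measurable [set M : 'M[R]_(m, n) | forall i j, A i j (M i j)].
Proof.
move=> mA; rewrite (_ : [set M | _] =
    \bigcap_i \bigcap_j [set M : 'M[R]_(m, n) | A i j (M i j)]).
  apply: fin_bigcap_measurable => [|i _]; first exact: finite_finset.
  apply: fin_bigcap_measurable => [|j _]; first exact: finite_finset.
  by have := @measurable_mx_entry R m n i j measurableT _ (mA i j); rewrite setTI.
by apply/seteqP; split => y /= H i => [_ j _|j]; exact: H.
Qed.

Lemma measurable_boxes m n : @measurable _ 'M[R]_(m, n) = <<s @boxes m n >>.
Proof.
apply/seteqP; split.
  suff sub : @mx_cylinder R m n `<=` <<s @boxes m n >>.
    exact: (smallest_sub (smallest_sigma_algebra setT (@boxes m n)) sub).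
  move=> _ [i [k [B [mB ->]]]]; apply: sub_gen_smallest.
  exists (fun a b => if (a == i) && (b == k) then B else setT).
    by move=> a b; case: ifP.
  apply/seteqP; split => y /= => [yB a b|/(_ i k)]; last by rewrite !eqxx.
  by case: ifP => // /andP[/eqP-> /eqP->].
apply: smallest_sub; first exact: sigma_algebra_measurable.
by move=> _ [B mB ->]; exact: measurable_box.
Qed.

Let cube m n (k : nat) : set 'M[R]_(m, n) :=
  [set M : 'M[R]_(m, n) | forall i j, `[- k%:R, k%:R]%classic (M i j)].

Let cube_cover m n : \bigcup_k @cube m n k = setT.
Proof.
apply/seteqP; split => // y _.
pose b := \sum_i \sum_j `|y i j|.
exists (Num.truncn b).+1 => // i j; rewrite /= in_itv /= -ler_norml.
apply: (@le_trans _ _ b); last first.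
  by rewrite ltW// truncnS_gt.
rewrite /b (bigD1 i)//= (bigD1 j)//= -addrA lerDl addr_ge0//.
  by apply: sumr_ge0.
by apply: sumr_ge0 => a _; apply: sumr_ge0.
Qed.

Let cube_fin m n k : (@lebesgue_mx R m n (@cube m n k) < +oo)%E.
Proof.
rewrite (@lebesgue_mx_box R m n (fun _ _ => `[- k%:R, k%:R]%classic))// -ge0_fin_numE; last first.
  by apply: prode_ge0 => i _; apply: prode_ge0.
apply: prode_fin_num => i _; apply: prode_fin_num => j _.
by rewrite lebesgue_measure_itv/=; case: ifP => //; rewrite -EFinD.
Qed.

Lemma lebesgue_mx_unique m n (mu : {measure set 'M[R]_(m, n) -> \bar R}) :
  (forall A : 'I_m -> 'I_n -> set R, (forall i j, measurable (A i j)) ->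
    mu [set M : 'M[R]_(m, n) | forall i j, A i j (M i j)] =
    (\prod_(i < m) \prod_(j < n) lebesgue_measure (A i j))%E) ->
  forall B, measurable B -> @lebesgue_mx R m n B = mu B.
Proof.
move=> muE B mB; apply: (measure_unique (@boxes m n) (@cube m n)) => //.
- exact: measurable_boxes.
- exact: boxes_setI.
- by move=> k; exists (fun _ _ => `[- k%:R, k%:R]%classic).
- exact: cube_cover.
- by move=> _ [A mA ->]; rewrite muE//; exact: lebesgue_mx_box.
- by move=> k; exact: cube_fin.
Qed.

Lemma lebesgue_mx_sigma_finite m n : sigma_finite setT (@lebesgue_mx R m n).
Proof.
exists (@cube m n); first by rewrite cube_cover.
move=> k; split; last exact: cube_fin.
by apply: (@measurable_box m n (fun _ _ => `[- k%:R, k%:R]%classic)).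
Qed.

HB.instance Definition _ m n := @Measure_isSigmaFinite.Build _ _ _ (@lebesgue_mx R m n)
  (@lebesgue_mx_sigma_finite m n).

(** Both sides, multiplied by [r], are measures of [A] that agree on intervals. *)
Lemma lebesgue_measure_affine (x r : R) (A : set R) : 0 < r -> measurable A ->
  lebesgue_measure ((fun t => x + r * t) @^-1` A) = ((r^-1)%:E * lebesgue_measure A)%E.
Proof.
move=> r_gt0 mA.
have mphi : measurable_fun setT (fun t : measurableTypeR R => x + r * t : measurableTypeR R).
  by apply: measurable_funD => //; exact: measurable_funM.
pose image := measure_function_pushforward__canonical__measure_function_Measure
  (@lebesgue_measure R) mphi.
pose nu := mscale (NngNum (ltW r_gt0)) image.
have r0 : r != 0 by rewrite gt_eqF.
have -> : lebesgue_measure A = nu A.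
  apply: lebesgue_measure_unique => // _ [[a b] _ <-] /=.
  rewrite /nu /mscale /= /pushforward.
  have -> : (fun t => x + r * t) @^-1` `]a, b] = `](a - x) / r, (b - x) / r]%classic.
    apply/seteqP; split => t; rewrite /= !in_itv /= ltr_pdivrMr// ler_pdivlMr//;
      by rewrite ltrBlDl lerBrDl (mulrC t).
  rewrite !lebesgue_measure_itv /= !lte_fin ltr_pM2r ?invr_gt0// ltrD2r.
  case: ifP => ab; last by rewrite mule0.
  by rewrite -!EFinD -EFinM -mulrBl mulrC divfK// opprB addrA subrK.
by rewrite /nu /mscale /= muleA -EFinM mulVf// mul1e.
Qed.

End LebesgueMatrix.

Section Spread.
Context {R : realType} {d m : nat}.
Variable (r : R).
Hypothesis r_gt0 : 0 < r.

Definition spread (p : 'rV[R]_d * 'M[R]_(m, d)) : 'M[R]_(m.+1, d) :=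
  \matrix_i (row i (r *: with0 p.2) + p.1).

Lemma with0_first (z : 'M[R]_(m, d)) k : with0 z ord0 k = 0.
Proof.
have := col_mxEu (0 : 'rV[R]_d) z ord0 k; rewrite [RHS]mxE => <-.
by congr (with0 z _ k); exact: val_inj.
Qed.

Lemma with0_next (z : 'M[R]_(m, d)) i k : with0 z (lift ord0 i) k = z i k.
Proof.
rewrite -(col_mxEd (0 : 'rV[R]_d) z i k).
by congr (with0 z _ k); exact: val_inj.
Qed.

Lemma spreadE p i k : spread p i k = p.1 ord0 k + r * with0 p.2 i k.
Proof. by rewrite !mxE addrC. Qed.

Lemma measurable_with0 : measurable_fun setT (fun z : 'M[R]_(m, d) => with0 z).
Proof.
apply: measurable_fun_mx => i k; case: (unliftP ord0 i) => [a|] ->.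
  by under eq_fun do rewrite with0_next; exact: measurable_mx_entry.
by under eq_fun do rewrite with0_first; exact: measurable_cst.
Qed.

Lemma measurable_scale_with0 (q : R) :
  measurable_fun setT (fun z : 'M[R]_(m, d) => q *: with0 z).
Proof.
apply: measurable_fun_mx => i k; under eq_fun do rewrite mxE.
apply: measurable_funM => //.
exact: (measurableT_comp (@measurable_mx_entry R m.+1 d i k) measurable_with0).
Qed.

Lemma measurable_spread : measurable_fun setT spread.
Proof.
apply: measurable_fun_mx => i k; under eq_fun do rewrite spreadE.
apply: measurable_funD.
  exact: (measurableT_comp (@measurable_mx_entry R 1 d ord0 k) measurable_fst).
apply: measurable_funM => //.
apply: (measurableT_comp (@measurable_mx_entry R m.+1 d i k)).
exact: (measurableT_comp measurable_with0 measurable_snd).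
Qed.

Let image := measure_function_pushforward__canonical__measure_function_Measure
  (product_measure1 (@lebesgue_mx R 1 d) (@lebesgue_mx R m d)) measurable_spread.

(** Both sides are measures of [B] that agree on boxes: for [x] in the projection of a
    box to the first row, the section in [z] is the product of the other sides, each
    translated and scaled by [1 / r]. *)
Lemma lebesgue_spread (B : set 'M[R]_(m.+1, d)) : measurable B ->
  @lebesgue_mx R m.+1 d B = mscale (NngNum (exprn_ge0 (d * m) (ltW r_gt0))) image B.
Proof.
apply: lebesgue_mx_unique => A mA.
transitivity ((r ^+ (d * m))%:E * product_measure1 (@lebesgue_mx R 1 d) (@lebesgue_mx R m d)
    (spread @^-1` [set M : 'M[R]_(m.+1, d) | forall i k, A i k (M i k)]))%E; first by [].
pose A0 := [set x : 'rV[R]_d | forall i k, A ord0 k (x i k)].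
pose c : \bar R := (\prod_(i < m) \prod_(k < d) ((r^-1)%:E * lebesgue_measure (A (lift ord0 i) k)))%E.
have mA0 : measurable A0.
  by apply: (@measurable_box R 1 d (fun _ k => A ord0 k)) => i k; exact: mA.
have c0 : (0 <= c)%E.
  apply: prode_ge0 => i _; apply: prode_ge0 => k _.
  by rewrite mule_ge0// lee_fin invr_ge0 ltW.
have -> : product_measure1 (@lebesgue_mx R 1 d) (@lebesgue_mx R m d)
    (spread @^-1` [set M : 'M[R]_(m.+1, d) | forall i k, A i k (M i k)]) = (c * lebesgue_mx A0)%E.
  rewrite /product_measure1 -[in RHS](setIT A0) -integral_indic// -ge0_integralZl//; last first.
    by apply/measurable_EFinP; exact: measurable_indic.
  apply: eq_integral => x _ /=; rewrite indicE.
  have [/set_mem xA|/negP xA] := boolP (x \in A0).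
    rewrite mule1 (_ : xsection _ _ = [set z : 'M[R]_(m, d) | forall i k,
        ((fun t => x ord0 k + r * t) @^-1` A (lift ord0 i) k) (z i k)]).
      rewrite (@lebesgue_mx_box R m d (fun i k => (fun t => x ord0 k + r * t) @^-1` A (lift ord0 i) k)).
        by apply: eq_bigr => i _; apply: eq_bigr => k _; rewrite lebesgue_measure_affine.
      move=> i k; rewrite -[X in measurable X]setTI.
      have mphi : measurable_fun setT (fun t : measurableTypeR R => x ord0 k + r * t : measurableTypeR R).
        by apply: measurable_funD => //; exact: measurable_funM.
      exact: (mphi measurableT _ (mA _ _)).
    apply/seteqP; split => z; rewrite xsectionP.
      by move=> H i k; have := H (lift ord0 i) k; rewrite spreadE with0_next.
    move=> H i k; rewrite spreadE; case: (unliftP ord0 i) => [a|] -> /=.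
      by rewrite with0_next; exact: H.
    by rewrite with0_first mulr0 addr0; exact: xA.
  rewrite mule0 (_ : xsection _ _ = set0) ?measure0//.
  apply/seteqP; split => // z; rewrite xsectionP => H; apply: xA; apply/mem_set => i k.
  by have := H ord0 k; rewrite spreadE with0_first mulr0 addr0 (ord1 i).
have -> : lebesgue_mx A0 = (\prod_(k < d) lebesgue_measure (A ord0 k))%E.
  by rewrite /A0 (@lebesgue_mx_box R 1 d (fun _ k => A ord0 k))// big_ord1.
have -> : c = ((r ^- (d * m))%:E * \prod_(i < m) \prod_(k < d) lebesgue_measure (A (lift ord0 i) k))%E.
  rewrite /c; under eq_bigr do rewrite big_split/=; rewrite big_split/=; congr (_ * _)%E.
  rewrite (eq_bigr (fun=> (r ^- d)%:E)) => [|i _]; last first.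
    by rewrite prodEFin prodr_const card_ord exprVn.
  by rewrite prodEFin prodr_const card_ord -exprVn -exprM exprVn.
rewrite !muleA -EFinM mulfV ?mul1e; last by rewrite expf_neq0// gt_eqF.
by rewrite big_ord_recl muleC.
Qed.

End Spread.

Definition centered_cube (R : realType) (d : nat) (h : R) : set 'rV[R]_d :=
  [set x | forall i, `|x ord0 i| <= h].
Arguments centered_cube : clear implicits.

Lemma centered_cubeE (R : realType) d (h : R) :
  centered_cube R d h = [set x : 'rV[R]_d | forall i k, `[- h, h]%classic (x i k)].
Proof.
apply/seteqP; split => x /= H => [i k|k].
  by rewrite /= in_itv /= -ler_norml (ord1 i).
by have := H ord0 k; rewrite /= in_itv /= -ler_norml.
Qed.

Lemma measurable_centered_cube (R : realType) d (h : R) :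
  measurable (centered_cube R d h).
Proof. by rewrite centered_cubeE; apply: (@measurable_box R 1 d (fun _ _ => `[- h, h]%classic)) => i k; exact: measurable_itv. Qed.

Lemma lebesgue_centered_cube (R : realType) d (h : R) : 0 <= h ->
  @lebesgue_mx R 1 d (centered_cube R d h) = ((2 * h) ^+ d)%:E.
Proof.
move=> h0; rewrite centered_cubeE (@lebesgue_mx_box R 1 d (fun _ _ => `[- h, h]%classic))// big_ord1.
rewrite (eq_bigr (fun=> (2 * h)%:E)); first by rewrite prodEFin prodr_const card_ord.
move=> i _; rewrite lebesgue_measure_itv /= lte_fin.
case: ltP => hh; first by rewrite -EFinD opprK mulr_natl mulr2n.
have -> : h = 0 by lra. rewrite mulr0. reflexivity.
Qed.

(** * Integrals of an intensity over tuples of a given shape *)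

Section LocalIntegral.
Context {R : realType} {d m : nat}.
Variables (rho : 'M[R]_(m.+1, d) -> R) (r : R) (Qr Q : set 'M[R]_(m.+1, d)).
Hypothesis r_gt0 : 0 < r.
Hypothesis rho_ge0 : forall y, 0 <= rho y.
Hypothesis m_rho : measurable_fun setT rho.
Hypothesis rho_inv : translation_invariant rho.
Hypothesis mQr : measurable Qr.
Hypothesis mQ : measurable Q.
Hypothesis Q_spread : forall x z, Qr (spread r (x, z)) <-> Q (with0 z).
Hypothesis Q_near : forall z, Q (with0 z) -> tuple_ball z.

Let prof (z : 'M[R]_(m, d)) : R := \1_Q (with0 z) * rho (r *: with0 z).

Let prof_ge0 z : 0 <= prof z. Proof. by rewrite mulr_ge0// indicE. Qed.

Let m_prof : measurable_fun setT prof.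
Proof.
apply: measurable_funM.
  exact: (measurableT_comp (measurable_indic mQ) measurable_with0).
exact: (measurableT_comp m_rho (@measurable_scale_with0 R d m r)).
Qed.

Let H : \bar R := (\int[@lebesgue_mx R m d]_z (prof z)%:E)%E.

Let mu1 : {sigma_finite_measure set 'rV[R]_d -> \bar R} := @lebesgue_mx R 1 d.
Let mu2 : {sigma_finite_measure set 'M[R]_(m, d) -> \bar R} := @lebesgue_mx R m d.

Let split_integral (C : set 'rV[R]_d) : measurable C ->
  (\int[mu1 \x mu2]_p (\1_C p.1 * prof p.2)%:E = mu1 C * H)%E.
Proof.
move=> mC; have H0 : (0 <= H)%E by apply: integral_ge0 => z _; rewrite lee_fin.
rewrite fubini_tonelli1//; last first.
- by move=> p; rewrite lee_fin mulr_ge0// indicE.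
- apply/measurable_EFinP; apply: measurable_funM.
    exact: (measurableT_comp (measurable_indic mC) measurable_fst).
  exact: (measurableT_comp m_prof measurable_snd).
transitivity (\int[mu1]_x ((\1_C x)%:E * H))%E.
  apply: eq_integral => x _; rewrite /fubini_F /=.
  under eq_integral do rewrite EFinM.
  rewrite ge0_integralZl//; first exact/measurable_EFinP.
  by move=> z _; rewrite lee_fin.
rewrite ge0_integralZr//; last first.
  by apply/measurable_EFinP; exact: measurable_indic.
by rewrite integral_indic// setIT.
Qed.

Let S (h : R) := [set y : 'M[R]_(m.+1, d) | forall a, centered_cube R d h (row a y)] `&` Qr.

Let mS h : measurable (S h).
Proof.
apply: measurableI => //; exact: (measurable_rows_in (@measurable_centered_cube R d h)).
Qed.

Let spread_integral h :
  (\int[@lebesgue_mx R m.+1 d]_(y in S h) (rho y)%:E =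
   (r ^+ (d * m))%:E * \int[mu1 \x mu2]_p (\1_(S h) (spread r p) * prof p.2)%:E)%E.
Proof.
have mG : measurable_fun setT (fun y => (\1_(S h) y * rho y)%:E).
  by apply/measurable_EFinP/measurable_funM => //; exact: measurable_indic.
have G0 y : (0 <= (\1_(S h) y * rho y)%:E)%E by rewrite lee_fin mulr_ge0// indicE.
transitivity (\int[@lebesgue_mx R m.+1 d]_y (\1_(S h) y * rho y)%:E)%E.
  rewrite integral_mkcond; apply: eq_integral => y _; rewrite /patch indicE.
  by case: (y \in S h); rewrite ?mul1r ?mul0r.
rewrite (eq_measure_integral (mscale (NngNum (exprn_ge0 (d * m) (ltW r_gt0)))
  (measure_function_pushforward__canonical__measure_function_Measure
     (product_measure1 mu1 mu2) (@measurable_spread R d m r)))); last first.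
  by move=> B mB _; exact: lebesgue_spread.
rewrite ge0_integral_mscale//; congr (_ * _)%E.
rewrite ge0_integral_pushforward//=; last exact: measurable_spread.
rewrite preimage_setT; apply: eq_integral => -[x z] _ /=; congr (_%:E).
have -> : rho (spread r (x, z)) = rho (r *: with0 z) by rewrite /spread /= rho_inv.
rewrite /prof !indicE mulrA; congr (_ * _).
case: (boolP (_ \in S h)) => [/set_mem[_ /Q_spread Qz]|_]; last by rewrite mul0r.
by rewrite mem_set// mulr1.
Qed.

Let mI h : measurable_fun setT (fun p : 'rV[R]_d * 'M[R]_(m, d) =>
  (\1_(S h) (spread r p) * prof p.2)%:E).
Proof.
apply/measurable_EFinP/measurable_funM.
  exact: (measurableT_comp (measurable_indic (mS h)) (@measurable_spread R d m r)).
exact: (measurableT_comp m_prof measurable_snd).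
Qed.

Let mJ C : measurable C -> measurable_fun setT (fun p : 'rV[R]_d * 'M[R]_(m, d) =>
  (\1_C p.1 * prof p.2)%:E).
Proof.
move=> mC; apply/measurable_EFinP/measurable_funM.
  exact: (measurableT_comp (measurable_indic mC) measurable_fst).
exact: (measurableT_comp m_prof measurable_snd).
Qed.

(** Keep, among the constraints that all points of the tuple lie in the cube, only the
    one on the first point. *)
Lemma local_integral_le h : 0 <= h ->
  (\int[@lebesgue_mx R m.+1 d]_(y in
      [set y : 'M[R]_(m.+1, d) | forall a, centered_cube R d h (row a y)] `&` Qr) (rho y)%:E <=
   (r ^+ (d * m) * (2 * h) ^+ d)%:E * \int[@lebesgue_mx R m d]_z (\1_Q (with0 z) * rho (r *: with0 z))%:E)%E.
Proof.
move=> h0; rewrite -/(S h) spread_integral EFinM -muleA lee_pmul2l//; last first.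
  by rewrite lte_fin exprn_gt0.
rewrite -lebesgue_centered_cube// -split_integral; last exact: measurable_centered_cube.
apply: ge0_le_integral.
- exact: measurableT.
- by move=> p _; rewrite lee_fin mulr_ge0// indicE.
- exact: mI.
- by apply: mJ; exact: measurable_centered_cube.
- move=> [x z] _; rewrite lee_fin ler_wpM2r// !indicE ler_nat.
  case: (boolP (_ \in S h)) => // /set_mem[/(_ ord0) xh _].
  rewrite mem_set//= => k; have := xh k; rewrite mxE spreadE with0_first mulr0 addr0.
  by [].
Qed.

(** A tuple of the given shape whose first point is in the cube of half-side [h] has
    all its points in the cube enlarged by the diameter bound [m.+1%:R * r]. *)
Lemma local_integral_ge h : 0 <= h ->
  ((r ^+ (d * m) * (2 * h) ^+ d)%:E * \int[@lebesgue_mx R m d]_z (\1_Q (with0 z) * rho (r *: with0 z))%:E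
   <= \int[@lebesgue_mx R m.+1 d]_(y in
      [set y : 'M[R]_(m.+1, d) | forall a, centered_cube R d (h + m.+1%:R * r) (row a y)] `&` Qr) (rho y)%:E)%E.
Proof.
move=> h0; rewrite -/(S _) spread_integral EFinM -muleA lee_pmul2l//; last first.
  by rewrite lte_fin exprn_gt0.
rewrite -lebesgue_centered_cube// -split_integral; last exact: measurable_centered_cube.
apply: ge0_le_integral.
- exact: measurableT.
- by move=> p _; rewrite lee_fin mulr_ge0// indicE.
- by apply: mJ; exact: measurable_centered_cube.
- exact: mI.
- move=> [x z] _; rewrite lee_fin /prof /= !mulrA ler_wpM2r// !indicE -!natrM ler_nat.
  case: (boolP (_ \in centered_cube _ _ _)) => // /set_mem xh.
  case: (boolP (_ \in Q)) => // /set_mem Qz.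
  rewrite mem_set//=; split; last exact/Q_spread.
  move=> a k; rewrite mxE spreadE /=; apply: le_trans (ler_normD _ _) _; apply: lerD => //.
  rewrite normrM gtr0_norm// mulrC ler_pM2r//; case: (unliftP ord0 a) => [b|] ->.
    rewrite with0_next; have := Q_near Qz b; rewrite /eball /= subr0 => zb.
    by apply: le_trans zb; have := enorm_coord (row b z) k; rewrite mxE.
  by rewrite with0_first normr0 ler0n.
Qed.

End LocalIntegral.

Lemma cvg_at_right0 (R : realType) (r : nat -> R) : (forall n, 0 < r n) ->
  r @ \oo --> 0 -> r @ \oo --> (0 : R)^'+.
Proof.
move=> r_gt0 r0 A A0; change (\forall n \near \oo, A (r n)).
move: (r0 _ A0 : \forall n \near \oo, 0 < r n -> A (r n)).
by apply: filterS => n /(_ (r_gt0 n)).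
Qed.

Section ProfileLimit.
Context {R : realType} {d m : nat}.
Variables (rho : 'M[R]_(m.+1, d) -> R) (f : R -> R) (g : 'M[R]_(m.+1, d) -> R).
Hypothesis fg : scaling_functions rho f g.
Hypothesis rho_ge0 : forall y, 0 <= rho y.
Hypothesis m_rho : measurable_fun setT rho.
Variable Q : set 'M[R]_(m.+1, d).
Hypothesis mQ : measurable Q.
Hypothesis Q_near : forall z : 'M[R]_(m, d), Q (with0 z) -> tuple_ball z.
Variable r : nat -> R.
Hypothesis r_gt0 : forall n, 0 < r n.
Hypothesis r_to0 : r @ \oo --> 0.

Let r_right : r @ \oo --> (0 : R)^'+. Proof. exact: cvg_at_right0. Qed.

Lemma profile_f_gt0 : \forall n \near \oo, 0 < f (r n).
Proof. exact: r_right (scaling_f_gt0 fg). Qed.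

Let scaled n (z : 'M[R]_(m, d)) : R := \1_Q (with0 z) * rho (r n *: with0 z) / f (r n).

Let m_scaled n : measurable_fun setT (scaled n).
Proof.
apply: measurable_funM => //; apply: measurable_funM.
  exact: (measurableT_comp (measurable_indic mQ) measurable_with0).
exact: (measurableT_comp m_rho (@measurable_scale_with0 R d m (r n))).
Qed.

Let cube := [set z : 'M[R]_(m, d) | forall i k, `[- m.+1%:R, m.+1%:R]%classic (z i k)].

Let cube_near z : tuple_ball z -> cube z.
Proof.
move=> zb i k; rewrite /= in_itv /= -ler_norml; apply: le_trans (zb i).
by rewrite /eball subr0; have := enorm_coord (row i z) k; rewrite mxE.
Qed.

(** Dominated convergence: on the bounded set of shapes the rescaled intensity
    is bounded by the upper scaling estimate. *)
Lemma profile_cvg :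
  ((\int[@lebesgue_mx R m d]_z (\1_Q (with0 z) * rho (r n *: with0 z))%:E) *
     ((f (r n))^-1)%:E)%E @[n --> \oo] -->
  (\int[@lebesgue_mx R m d]_z (\1_Q (with0 z) * g (with0 z))%:E)%E /\
  (\int[@lebesgue_mx R m d]_z (\1_Q (with0 z) * g (with0 z))%:E)%E \is a fin_num.
Proof.
have [C C0 HC] := scaling_upper fg.
have [N _ HN] : \forall n \near \oo, 0 < f (r n) /\
    forall z : 'M[R]_(m, d), tuple_ball z -> rho (r n *: with0 z) <= C * f (r n).
  near=> n; split; first by near: n; exact: profile_f_gt0.
  by near: n; exact: r_right HC.
pose F n z := (scaled (n + N)%N z)%:E; pose G z := (\1_Q (with0 z) * g (with0 z))%:E.
have mcube : measurable cube.
  by apply: (@measurable_box R m d (fun _ _ => `[- m.+1%:R, m.+1%:R]%classic)).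
have cube_fin : @lebesgue_mx R m d cube \is a fin_num.
  rewrite (@lebesgue_mx_box R m d (fun _ _ => `[- m.+1%:R, m.+1%:R]%classic))//.
  apply/prode_fin_num => i _; apply/prode_fin_num => k _.
  by rewrite lebesgue_measure_itv/=; case: ifP => //; rewrite -EFinD.
have mF n : measurable_fun setT (F n) by exact/measurable_EFinP.
have FG z : setT z -> F ^~ z @ \oo --> G z.
  move=> _; rewrite /F (cvg_shiftn N (fun n => (scaled n z)%:E)).
  suff S : scaled ^~ z @ \oo --> \1_Q (with0 z) * g (with0 z).
    by apply: cvg_EFin; first exact: nearW.
  rewrite indicE; case: (boolP (with0 z \in Q)) => [Qz|/negbTE Qz].
    have zb := Q_near (set_mem Qz).
    have -> : scaled ^~ z = (fun q => rho (q *: with0 z) / f q) \o r.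
      by apply/funext => n; rewrite /scaled indicE Qz /= mul1r.
    rewrite mul1r; exact: cvg_comp r_right (scaling_limit fg zb).
  have -> : scaled ^~ z = cst 0.
    by apply/funext => n; rewrite /scaled indicE Qz !mul0r.
  rewrite mul0r; exact: cvg_cst.
have mG : measurable_fun setT G by exact: emeasurable_fun_cvg mF FG.
pose dom z := (C * \1_cube z)%:E.
have mdom : measurable_fun setT dom.
  by apply/measurable_EFinP/measurable_funM => //; exact: measurable_indic.
have idom : (@lebesgue_mx R m d).-integrable setT dom.
  apply/integrableP; split => //.
  have d0 z : 0 <= C * \1_cube z by rewrite mulr_ge0 ?(ltW C0)// indicE.
  rewrite (eq_integral (fun z => C%:E * (\1_cube z)%:E)%E) => [|z _]; last first.
    by rewrite /dom gee0_abs ?lee_fin// EFinM.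
  rewrite ge0_integralZl//; last first.
  - by rewrite lee_fin ltW.
  - by apply/measurable_EFinP; exact: measurable_indic.
  rewrite integral_indic// setIT ltey_eq fin_numM//; exact: cube_fin.
have FD z n : setT z -> (`|F n z| <= dom z)%E.
  move=> _; have [fpos Hn] := HN (n + N)%N (leq_addl _ _).
  rewrite /F /dom /scaled /= lee_fin normrM (@gtr0_norm _ (f (r (n + N)%N))^-1) ?invr_gt0// ler_pdivrMr//.
  rewrite !indicE; case: (boolP (with0 z \in Q)) => [/set_mem/Q_near zb|_]; last first.
    by rewrite mul0r normr0 !mulr_ge0// ltW.
  rewrite mul1r mem_set; last exact: cube_near.
  by rewrite mulr1 ger0_norm// Hn.
have [iG _ cv] := dominated_convergence measurableT mF mG
  (aeW _ (fun z Dz => FG z Dz)) idom (aeW _ (fun z n Dz => FD z n Dz)).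
split; last by exact: integrable_fin_num iG.
rewrite -(cvg_shiftn N) /=; rewrite (_ : (fun n => _) = (fun n => \int[@lebesgue_mx R m d]_z F n z)%E) //.
apply/funext => n; have [fpos _] := HN (n + N)%N (leq_addl _ _).
rewrite -ge0_integralZr//.
- apply/measurable_EFinP; apply: measurable_funM.
    exact: (measurableT_comp (measurable_indic mQ) measurable_with0).
  exact: (measurableT_comp m_rho (@measurable_scale_with0 R d m _)).
- by move=> z _; rewrite lee_fin mulr_ge0// indicE.
- by rewrite lee_fin invr_ge0 ltW.
Unshelve. all: by end_near.
Qed.

End ProfileLimit.

(** * Expected numbers of tuples *)

Section ExpectedCounts.
Context {R : realType} {d : nat} {disp : measure_display} {Omega : measurableType disp}.
Hypothesis d_gt0 : (0 < d)%N.
Variables (P : probability Omega R) (Phi : {RV P >-> configuration R d}).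
Hypothesis Phi_lf : forall w, locally_finite (Phi w).
Variable r : nat -> R.
Hypothesis r_gt0 : forall n, 0 < r n.
Hypothesis r_to0 : r @ \oo --> 0.

Definition process_points n w := fset_set ((Phi w : set 'rV[R]_d) `&` window n).

Let side n : R := n%:R `^ d%:R^-1.

Let side_ge0 n : 0 <= side n. Proof. exact: powR_ge0. Qed.

Let side_pow n : side n ^+ d = n%:R.
Proof.
by rewrite /side -powR_mulrn ?powR_ge0// -powRrM mulVf ?powRr1// pnatr_eq0 -lt0n.
Qed.

Let side_ge1 n : (0 < n)%N -> 1 <= side n.
Proof.
move=> n0; have := side_pow n; rewrite -(@expr_ge1 _ d)// => ->.
by rewrite ler1n.
Qed.

Lemma measurable_window n : measurable (@window R d n).
Proof. exact: (@measurable_centered_cube R d (side n / 2)). Qed.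

Lemma window_bounded n : exists M, @window R d n `<=` eball 0 M.
Proof.
exists (d%:R * (side n / 2)) => x xW; rewrite /eball /= subr0.
by apply: enorm_le_coord => //; rewrite divr_ge0.
Qed.

Lemma measurable_expected j n (Q : set 'M[R]_(j, d)) : measurable Q ->
  measurable_fun setT (fun w => (tuple_count (process_points n w) Q)%:R : R).
Proof.
move=> mQ; have [M WM] := window_bounded n.
exact: (measurable_process_count Phi_lf (measurable_window n) WM mQ).
Qed.

Section OneOrder.
Variables (m : nat) (rho : 'M[R]_(m.+1, d) -> R) (f : R -> R) (g : 'M[R]_(m.+1, d) -> R).
Hypothesis rhoP : joint_intensity P Phi rho.
Hypothesis rho_inv : translation_invariant rho.
Hypothesis fg : scaling_functions rho f g.
Variables (Q : set 'M[R]_(m.+1, d)) (Qn : nat -> set 'M[R]_(m.+1, d)).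
Hypothesis mQ : measurable Q.
Hypothesis mQn : forall n, measurable (Qn n).
Hypothesis Qn_spread : forall n x z, Qn n (spread (r n) (x, z)) <-> Q (with0 z).
Hypothesis Q_near : forall z : 'M[R]_(m, d), Q (with0 z) -> tuple_ball z.

Let expected n : \bar R := (\int[P]_w (tuple_count (process_points n w) (Qn n))%:R%:E)%E.
Let profile n : \bar R := (\int[@lebesgue_mx R m d]_z (\1_Q (with0 z) * rho (r n *: with0 z))%:E)%E.

Let rho_ge0 := joint_intensity_ge0 rhoP.
Let m_rho := joint_intensity_measurable rhoP.

Let expectedE n : (expected n = \int[@lebesgue_mx R m.+1 d]_(y in
  [set y : 'M[R]_(m.+1, d) | forall a, centered_cube R d (side n / 2) (row a y)] `&` Qn n) (rho y)%:E)%E.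
Proof.
have [M WM] := window_bounded n.
exact: (expectation_tuple_count Phi_lf (measurable_window n) WM rhoP (mQn n)).
Qed.

Let expected_le n : (expected n <= (r n ^+ (d * m) * n%:R)%:E * profile n)%E.
Proof.
rewrite expectedE -side_pow.
have := local_integral_le (r_gt0 n) rho_ge0 m_rho rho_inv (mQn n) mQ (Qn_spread n)
  (h := side n / 2).
by rewrite (mulrC 2) divfK ?pnatr_eq0//; apply; rewrite divr_ge0.
Qed.

Let expected_ge n : 0 <= side n / 2 - m.+1%:R * r n ->
  ((r n ^+ (d * m) * (side n - 2 * (m.+1%:R * r n)) ^+ d)%:E * profile n <= expected n)%E.
Proof.
move=> h0; rewrite expectedE.
have := local_integral_ge (r_gt0 n) rho_ge0 m_rho rho_inv (mQn n) mQ (Qn_spread n) Q_near h0.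
by rewrite subrK mulrBr (mulrC 2 (_ / _)) divfK// pnatr_eq0.
Qed.

(** The window has volume [n].  The first points for which the whole tuple stays
    inside fill a cube of volume at least [n * (1 - 2 * (m + 1) * r n) ^+ d], since
    the side of the window is at least 1. *)
Lemma expected_count_cvg :
  (expected n * ((n%:R * r n ^+ (d * m) * f (r n))^-1)%:E)%E @[n --> \oo] -->
  (\int[@lebesgue_mx R m d]_z (\1_Q (with0 z) * g (with0 z))%:E)%E.
Proof.
have [prof_cvg limfin] := profile_cvg fg rho_ge0 m_rho mQ Q_near r_gt0 r_to0.
pose a n := (profile n * ((f (r n))^-1)%:E)%E.
pose k n : R := (1 - 2 * (m.+1%:R * r n)) ^+ d.
have k1 : k @ \oo --> (1 : R).
  rewrite (_ : (1 : R) = (1 - 2 * (m.+1%:R * 0)) ^+ d); last by rewrite !mulr0 subr0 expr1n.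
  apply: (@cvg_comp _ _ _ (fun n => 1 - 2 * (m.+1%:R * r n)) (fun x => x ^+ d)); last first.
    exact: exprn_continuous.
  apply: cvgB; first exact: cvg_cst.
  by apply: cvgMl_tmp; apply: cvgMl_tmp.
have small_near : \forall n \near \oo, 2 * (m.+1%:R * r n) <= 1.
  have H : (fun n => 2 * (m.+1%:R * r n)) @ \oo --> (0 : R).
    have -> : (0 : R) = 2 * (m.+1%:R * 0) by rewrite !mulr0.
    by apply: cvgMl_tmp; apply: cvgMl_tmp.
  exact: (cvgr_le _ H _ ltr01).
have prof0 n : (0 <= profile n)%E.
  by apply: integral_ge0 => z _; rewrite lee_fin mulr_ge0// indicE.
apply: (@squeeze_cvge _ _ _ _ (fun n => (k n)%:E * a n)%E _ a); last first.
- exact: prof_cvg.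
- rewrite -[X in _ --> X]mul1e; apply: cvgeM => //.
    by rewrite mule_def_fin.
  by apply: cvg_EFin; [exact: nearW|].
near=> n.
have fpos : 0 < f (r n) by near: n; exact: (profile_f_gt0 fg r_gt0 r_to0).
have n0 : (0 < n)%N by near: n; exact: nbhs_infty_gt.
have n0R : 0 < n%:R :> R by rewrite ltr0n.
have small : 2 * (m.+1%:R * r n) <= 1.
  by near: n; exact: small_near.
have s1 := side_ge1 n0.
have rp : 0 < r n ^+ (d * m) by rewrite exprn_gt0.
set c := (n%:R * r n ^+ (d * m) * f (r n))^-1.
have c0 : 0 <= c by rewrite invr_ge0 !mulr_ge0// ltW.
apply/andP; split; last first.
  apply: le_trans (lee_wpmul2r _ (expected_le n)) _; first by rewrite lee_fin.
  rewrite muleAC -EFinM muleC /a.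
  rewrite (_ : r n ^+ (d * m) * n%:R * c = (f (r n))^-1)//.
  by rewrite /c !invfM; field; rewrite !gt_eqF.
have h0 : 0 <= side n / 2 - m.+1%:R * r n by lra.
apply: le_trans (lee_wpmul2r _ (expected_ge h0)); last by rewrite lee_fin.
rewrite [leRHS]muleAC -EFinM /a muleCA [leRHS]muleC; apply: lee_wpmul2l => //.
rewrite -EFinM lee_fin.
rewrite (_ : r n ^+ (d * m) * (side n - 2 * (m.+1%:R * r n)) ^+ d * c =
   ((side n - 2 * (m.+1%:R * r n)) / side n) ^+ d * (f (r n))^-1); last first.
  rewrite expr_div_n side_pow /c !invfM; field; rewrite !gt_eqF//.
rewrite ler_wpM2r ?invr_ge0 ?(ltW fpos)// /k.
apply: lerXn2r; rewrite ?nnegrE.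
- by rewrite subr_ge0.
- by rewrite divr_ge0// subr_ge0 (le_trans small).
- rewrite mulrBl divff; last by rewrite gt_eqF// (lt_le_trans ltr01).
  rewrite lerD2l lerN2 ler_pdivrMr ?(lt_le_trans ltr01)//.
  by rewrite ler_peMr// mulr_ge0// mulr_ge0// ltW.
Unshelve. all: by end_near.
Qed.

End OneOrder.
End ExpectedCounts.

(** * Squeezing the expected Betti numbers *)

Section NearTuplesSpread.
Context {R : realType} {d m : nat}.

Lemma row_spread (q : R) (x : 'rV[R]_d) (z : 'M[R]_(m, d)) a :
  row a (spread q (x, z)) = q *: row a (with0 z) + x.
Proof. by apply/rowP => k; rewrite !mxE. Qed.

Lemma near_tuples_spread (q : R) (x : 'rV[R]_d) (z : 'M[R]_(m, d)) : 0 < q ->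
  near_tuples R d m q (spread q (x, z)) <-> near_tuples R d m 1 (with0 z).
Proof.
move=> q0; have E a : (enorm (row a (spread q (x, z)) - row ord0 (spread q (x, z))) <= m.+1%:R * q) =
    (enorm (row a (with0 z) - row ord0 (with0 z)) <= m.+1%:R * 1).
  rewrite !row_spread opprD addrACA subrr addr0 -scalerBr enormZ gtr0_norm// mulr1.
  by rewrite mulrC ler_pM2r.
by split => H a; have := H a; rewrite E.
Qed.

Lemma near_tuples_ball (z : 'M[R]_(m, d)) : near_tuples R d m 1 (with0 z) -> tuple_ball z.
Proof.
move=> H i; have := H (lift ord0 i); rewrite mulr1 /eball /= subr0.
have -> : row (lift ord0 i) (with0 z) = row i z.
  by apply/rowP => k; rewrite [LHS]mxE with0_next mxE.
have -> : row ord0 (with0 z) = 0 by apply/rowP => k; rewrite [LHS]mxE with0_first mxE.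
by rewrite subr0.
Qed.

End NearTuplesSpread.

(** The integral of a nonnegative function is the supremum of the integrals of the
    simple functions below it. *)
Lemma ge0_integral_mono disp (T : measurableType disp) (R : realType)
    (mu : {measure set T -> \bar R}) (f1 f2 : T -> \bar R) :
  (forall x, 0 <= f1 x)%E -> (forall x, f1 x <= f2 x)%E ->
  (\int[mu]_x f1 x <= \int[mu]_x f2 x)%E.
Proof.
move=> f10 f12; have f20 x : (0 <= f2 x)%E by exact: le_trans (f10 x) (f12 x).
rewrite !ge0_integralTE//; apply: ereal_sup_le => _ [h hf <-].
by exists h => // x; exact: le_trans (hf x) (f12 x).
Qed.

Section Limit.
Context {R : realType} {d : nat} {disp : measure_display} {Omega : measurableType disp}.
Hypothesis d_gt0 : (0 < d)%N.
Variables (P : probability Omega R) (Phi : {RV P >-> configuration R d}).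
Hypothesis Phi_lf : forall w, locally_finite (Phi w).
Variable r : nat -> R.
Hypothesis r_gt0 : forall n, 0 < r n.
Hypothesis r_to0 : r @ \oo --> 0.

(** The expected count of near tuples with one more point is of order
    [n * r n ^+ (d * m.+1) * f' (r n)]; relative to [n * r n ^+ (d * m) * f (r n)]
    this is [r n ^+ d] times a bounded factor. *)
Lemma near_count_negligible m (rho : 'M[R]_(m.+2, d) -> R) (f f' : R -> R) g :
  joint_intensity P Phi rho -> translation_invariant rho ->
  scaling_functions rho f' g -> (\forall q \near 0^'+, 0 < f q) ->
  f' =O_ (0^'+) f ->
  ((\int[P]_w (tuple_count (process_points Phi n w) (near_tuples R d m.+1 (r n)))%:R%:E) *
     ((n%:R * r n ^+ (d * m) * f (r n))^-1)%:E)%E @[n --> \oo] --> 0%E.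
Proof.
move=> rhoP rho_inv fg fpos f'f.
have r_right : r @ \oo --> (0 : R)^'+ by exact: cvg_at_right0.
have cv := expected_count_cvg d_gt0 Phi_lf r_gt0 r_to0 rhoP rho_inv fg
  (@measurable_near_tuples R d m.+1 1) (fun n => @measurable_near_tuples R d m.+1 (r n))
  (fun n x z => near_tuples_spread x z (r_gt0 n)) (@near_tuples_ball R d m.+1).
have [_ Lfin] := profile_cvg fg (joint_intensity_ge0 rhoP) (joint_intensity_measurable rhoP)
  (@measurable_near_tuples R d m.+1 1) (@near_tuples_ball R d m.+1) r_gt0 r_to0.
pose kap n : R := r n ^+ d * (f' (r n) / f (r n)).
have kap0 : kap @ \oo --> (0 : R).
  have [C [C0 HC]] : exists C, 0 < C /\ \forall q \near 0^'+, `|f' q| <= C * `|f q|.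
    by have /eqO_exP[C C0 HC] := f'f; exists C.
  have rd0 : (fun n => r n ^+ d * C) @ \oo --> (0 : R).
    have -> : (0 : R) = 0 ^+ d * C by rewrite expr0n eqn0Ngt d_gt0 mul0r.
    apply: cvgMr_tmp; apply: (@cvg_comp _ _ _ r (fun x => x ^+ d)) r_to0 _.
    exact: exprn_continuous.
  apply: (@squeeze_cvgr _ _ _ _ (fun n => - (r n ^+ d * C)) (fun n => r n ^+ d * C)) => //; last first.
    by rewrite -[X in _ --> X]oppr0; exact: cvgN.
  near=> n; have fn : 0 < f (r n) by near: n; exact: r_right fpos.
  have Cn : `|f' (r n)| <= C * `|f (r n)| by near: n; exact: r_right HC.
  rewrite -ler_norml /kap normrM ger0_norm ?exprn_ge0 ?(ltW (r_gt0 n))//.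
  rewrite ler_wpM2l ?exprn_ge0 ?(ltW (r_gt0 n))// normrM normfV ler_pdivrMr//.
  by rewrite normr_gt0 gt_eqF.
have kapE : (fun n => (kap n)%:E) @ \oo --> 0%E.
  by apply: cvg_EFin; first exact: nearW.
have := cvgeM (mule_def_fin Lfin (isT : (0 : \bar R) \is a fin_num)) cv kapE.
rewrite mule0 => cv0.
pose EN n : \bar R := (\int[P]_w
  (tuple_count (process_points Phi n w) (near_tuples R d m.+1 (r n)))%:R%:E)%E.
suff E : {near \oo, (fun n => EN n * ((n%:R * r n ^+ (d * m.+1) * f' (r n))^-1)%:E * (kap n)%:E)%E =1
    (fun n => EN n * ((n%:R * r n ^+ (d * m) * f (r n))^-1)%:E)%E}.
  by have H := near_eq_cvg E; apply: cvg_trans; [exact: H|exact: cv0].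
near=> n.
have fn : 0 < f (r n) by near: n; exact: r_right fpos.
have f'n : 0 < f' (r n) by near: n; exact: r_right (scaling_f_gt0 fg).
rewrite -muleA -EFinM; congr (_ * _%:E)%E.
have rn := r_gt0 n; have rd : r n ^+ d != 0 by rewrite gt_eqF// exprn_gt0.
have rdm : r n ^+ (d * m) != 0 by rewrite gt_eqF// exprn_gt0.
rewrite /kap mulnS exprD !invfM.
have -> : n%:R^-1 * ((r n ^+ d)^-1 * (r n ^+ (d * m))^-1) * (f' (r n))^-1 *
    (r n ^+ d * (f' (r n) / f (r n))) =
  n%:R^-1 * (r n ^+ (d * m))^-1 * (f (r n))^-1 *
    (((r n ^+ d)^-1 * r n ^+ d) * ((f' (r n))^-1 * f' (r n))) by ring.
by rewrite !mulVf ?mulr1// gt_eqF.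
Unshelve. all: by end_near.
Qed.

Section Sandwich.
Variables (m : nat) (rho : 'M[R]_(m.+1, d) -> R) (f : R -> R) (g : 'M[R]_(m.+1, d) -> R).
Variables (rho' : 'M[R]_(m.+2, d) -> R) (f' : R -> R) (g' : 'M[R]_(m.+2, d) -> R).
Hypotheses (rhoP : joint_intensity P Phi rho) (rho'P : joint_intensity P Phi rho').
Hypotheses (rho_inv : translation_invariant rho) (rho'_inv : translation_invariant rho').
Hypotheses (fg : scaling_functions rho f g) (f'g' : scaling_functions rho' f' g').
Hypothesis f'f : f' =O_ (0^'+) f.
Variables (Q : set 'M[R]_(m.+1, d)) (Qn : nat -> set 'M[R]_(m.+1, d)).
Hypothesis mQ : measurable Q.
Hypothesis mQn : forall n, measurable (Qn n).
Hypothesis Qn_spread : forall n x z, Qn n (spread (r n) (x, z)) <-> Q (with0 z).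
Hypothesis Q_near : forall z : 'M[R]_(m, d), Q (with0 z) -> tuple_ball z.
Variable b : nat -> Omega -> nat.
Hypothesis b_count : forall n w,
  `|(b n w)%:R - (m.+1`!%:R)^-1 * (tuple_count (process_points Phi n w) (Qn n))%:R| <=
  (tuple_count (process_points Phi n w) (near_tuples R d m.+1 (r n)))%:R :> R.

(** The integral of [b] is a lower integral, monotone but not additive.  So [b] is
    bounded above and below by measurable functions of the two counts, to which
    additivity applies. *)
Lemma sandwich_limit :
  ('E_P[fun w => (b n w)%:R] * ((n%:R * r n ^+ (d * m) * f (r n))^-1)%:E)%E @[n --> \oo] -->
  (((m.+1)`!%:R^-1)%:E * \int[@lebesgue_mx R m d]_z (\1_Q (with0 z) * g (with0 z))%:E)%E.
Proof.
set q : R := (m.+1)`!%:R^-1; have q0 : 0 <= q by rewrite invr_ge0.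
pose J n w : R := (tuple_count (process_points Phi n w) (Qn n))%:R.
pose N n w : R := (tuple_count (process_points Phi n w) (near_tuples R d m.+1 (r n)))%:R.
pose c n : R := (n%:R * r n ^+ (d * m) * f (r n))^-1.
have mJ n : measurable_fun setT (fun w => (J n w)%:E).
  by apply/measurable_EFinP; exact: measurable_expected.
have mN n : measurable_fun setT (fun w => (N n w)%:E).
  by apply/measurable_EFinP; apply: measurable_expected => //; exact: measurable_near_tuples.
have mqJ n : measurable_fun setT (fun w => (q * J n w)%:E).
  by apply/measurable_EFinP; apply: measurable_funM => //; exact: measurable_expected.
have J0 n w : 0 <= J n w by [].
have N0 n w : 0 <= N n w by [].
have qJ0 n w : 0 <= q * J n w by rewrite mulr_ge0.
pose EJ n : \bar R := (\int[P]_w (J n w)%:E)%E.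
pose EN n : \bar R := (\int[P]_w (N n w)%:E)%E.
pose Eb n : \bar R := (\int[P]_w ((b n w)%:R)%:E)%E.
have EqJ n : (\int[P]_w (q * J n w)%:E = q%:E * EJ n)%E.
  by under eq_integral do rewrite EFinM; rewrite ge0_integralZl// => w _; rewrite lee_fin.
have upper n : (Eb n <= q%:E * EJ n + EN n)%E.
  rewrite -EqJ /EN -ge0_integralD//; last 2 first.
  - by move=> w _; rewrite lee_fin.
  - by move=> w _; rewrite lee_fin.
  apply: ge0_integral_mono => w; first by rewrite lee_fin.
  by rewrite -EFinD lee_fin; have := b_count n w; rewrite ler_distl => /andP[].
have lower n : (q%:E * EJ n <= Eb n + EN n)%E.
  (* The positive part keeps the lower bound nonnegative, where the integral is
     monotone. *)
  pose L w := Num.max (q * J n w - N n w) 0.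
  have mL : measurable_fun setT (fun w => (L w)%:E).
    apply/measurable_EFinP; apply: measurable_maxr => //; apply: measurable_funB.
      by apply/measurable_EFinP; exact: mqJ.
    by apply/measurable_EFinP; exact: mN.
  have L0 w : 0 <= L w by rewrite le_max lexx orbT.
  have Lb : (\int[P]_w (L w)%:E <= Eb n)%E.
    apply: ge0_integral_mono => w; first by rewrite lee_fin.
    rewrite lee_fin ge_max ler0n andbT.
    by have := b_count n w; rewrite ler_distl => /andP[].
  apply: le_trans (leeD2r _ Lb); rewrite -EqJ /EN -ge0_integralD//; last 2 first.
  - by move=> w _; rewrite lee_fin.
  - by move=> w _; rewrite lee_fin.
  apply: ge0_integral_mono => w; first by rewrite lee_fin.
  by rewrite -EFinD lee_fin -lerBlDr le_max lexx.
have EbE n : ('E_P[fun w => (b n w)%:R] = Eb n)%E by rewrite unlock.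
have cvJ : (q%:E * (EJ n * (c n)%:E))%E @[n --> \oo] -->
    (q%:E * \int[@lebesgue_mx R m d]_z (\1_Q (with0 z) * g (with0 z))%:E)%E.
  apply: cvgeZl => //.
  exact: (expected_count_cvg d_gt0 Phi_lf r_gt0 r_to0 rhoP rho_inv fg mQ mQn Qn_spread Q_near).
have [_ Lfin] := profile_cvg fg (joint_intensity_ge0 rhoP) (joint_intensity_measurable rhoP)
  mQ Q_near r_gt0 r_to0.
have cvN : (EN n * (c n)%:E)%E @[n --> \oo] --> 0%E.
  exact: (near_count_negligible rho'P rho'_inv f'g' (scaling_f_gt0 fg) f'f).
set limit := (X in _ --> X) in cvJ *.
have limfin : limit \is a fin_num by rewrite fin_numM.
have [Nfin _] := (fine_cvgP _ _).1 cvN.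
apply: (@squeeze_cvge _ _ _ _ (fun n => q%:E * (EJ n * (c n)%:E) - EN n * (c n)%:E)%E _
   (fun n => q%:E * (EJ n * (c n)%:E) + EN n * (c n)%:E)%E).
- near=> n.
  have fn : 0 < f (r n).
    by near: n; exact: (profile_f_gt0 fg r_gt0 r_to0).
  have c0 : (0 <= (c n)%:E)%E.
    by rewrite lee_fin invr_ge0 !mulr_ge0// ?exprn_ge0 ?(ltW (r_gt0 n))// ltW.
  have Nn : (EN n * (c n)%:E)%E \is a fin_num by near: n.
  have EJ0 : (0 <= q%:E * EJ n)%E by rewrite -EqJ; apply: integral_ge0 => w _; rewrite lee_fin.
  have EN0 : (0 <= EN n)%E by apply: integral_ge0 => w _; rewrite lee_fin.
  have Eb0 : (0 <= Eb n)%E by apply: integral_ge0 => w _; rewrite lee_fin.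
  rewrite EbE muleA leeBlDr//; apply/andP; split.
    by rewrite -ge0_muleDl//; exact: lee_wpmul2r.
  by rewrite -ge0_muleDl//; exact: lee_wpmul2r.
- rewrite -[X in _ --> X]sube0; apply: cvgeB => //.
  by rewrite fin_num_adde_defl.
- rewrite -[X in _ --> X]adde0; apply: cvgeD => //.
  by rewrite fin_num_adde_defl.
Unshelve. all: by end_near.
Qed.

End Sandwich.
End Limit.

(** * Invariance and locality of the shapes *)

Section SpreadShapes.
Context {R : realType} {d m : nat}.
Implicit Types (x : 'rV[R]_d) (z : 'M[R]_(m, d)).
Variable (q : R).
Hypothesis q_gt0 : 0 < q.

Let q0 : q != 0. Proof. by rewrite gt_eqF. Qed.

Let row_eq x z a b :
  row a (spread q (x, z)) = row b (spread q (x, z)) <-> row a (with0 z) = row b (with0 z).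
Proof.
by rewrite !row_spread; split => [/addIr/(scalerI q0)//|->].
Qed.

Let dist_eq x z a b : (enorm (row a (spread q (x, z)) - row b (spread q (x, z))) <= q) =
  (enorm (row a (with0 z) - row b (with0 z)) <= 1).
Proof.
rewrite !row_spread opprD addrACA subrr addr0 -scalerBr enormZ gtr0_norm//.
by rewrite -[X in _ <= X]mulr1 ler_pM2l.
Qed.

Let common_eq x z (J : {set 'I_m.+1}) :
  (exists c, forall a, a \in J -> eball (row a (spread q (x, z))) (q / 2) c) <->
  (exists c, forall a, a \in J -> eball (row a (with0 z)) (1 / 2) c).
Proof.
split=> -[c cJ].
  exists (q^-1 *: (c - x)) => a /cJ; rewrite /eball /= row_spread.
  have -> : q^-1 *: (c - x) - row a (with0 z) = q^-1 *: (c - (q *: row a (with0 z) + x)).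
    by rewrite opprD addrCA [RHS]scalerDr scalerN scalerA mulVf// scale1r [RHS]addrC.
  by move=> H; rewrite enormZ gtr0_norm ?invr_gt0// ler_pdivrMl// mulrA mulr1.
exists (q *: c + x) => a /cJ; rewrite /eball /= row_spread.
rewrite opprD addrACA subrr addr0 -scalerBr enormZ gtr0_norm// => H.
by rewrite ler_pM2l// -div1r.
Qed.

(** The map [c |-> q c + x] sends the common points of balls of radius 1/2 around the
    points of [with0 z] to those of balls of radius [q / 2] around its image. *)
Lemma complex_iso_spread (V : finType) (L : {set {set V}}) x z : #|V| = m.+1 ->
  complex_iso (cech (points (spread q (x, z))) q) L <->
  complex_iso (cech (points (with0 z)) 1) L.
Proof.
move=> cV; split; apply: complex_iso_transfer => // [a b|J].
- exact: iff_sym (row_eq _ _ _ _).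
- exact: iff_sym (common_eq _ _ _).
Qed.

Lemma graph_iso_spread (V : finType) (e : rel V) x z : #|V| = m.+1 ->
  graph_iso (@geometric_graph R d (points (spread q (x, z))) q) e <->
  graph_iso (@geometric_graph R d (points (with0 z)) 1) e.
Proof.
move=> cV; split; apply: graph_iso_transfer => // a b.
exact: iff_sym (row_eq _ _ _ _).
Qed.

End SpreadShapes.

Section ShapesAreLocal.
Context {R : realType} {d : nat}.

Lemma tuple_ball_dist m (z : 'M[R]_(m, d)) :
  (forall a, enorm (row a (with0 z) - row ord0 (with0 z)) <= m.+1%:R) -> tuple_ball z.
Proof. by move=> H; apply: near_tuples_ball => a; rewrite mulr1. Qed.

(** In a hollow simplex with at least three vertices all pairs are edges. *)
Lemma hollow_shape_near k (z : 'M[R]_(k.+1, d)) : (0 < k)%N ->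
  complex_iso (cech (points (with0 z)) 1) (hollow_simplex k.+2) -> tuple_ball z.
Proof.
move=> k0 [h h_bij hE]; apply: tuple_ball_dist => a.
apply: (@le_trans _ _ 1); last by rewrite ler1n.
have : adjacent (cech (points (with0 z)) 1) (point (with0 z) a) (point (with0 z) ord0).
  rewrite /adjacent -hE finset.in_set card_imset; last exact: bij_inj.
  by rewrite cards2; case: (_ == _).
by rewrite adjacent_cech.
Qed.

(** The cross-polytope graph has diameter 2. *)
Lemma cross_shape_near k (z : 'M[R]_(k.*2.+1, d)) : (0 < k)%N ->
  graph_iso (@geometric_graph R d (points (with0 z)) 1) (@cross_polytope_graph k) -> tuple_ball z.
Proof.
move=> k0 [h [g hK gK] hE]; apply: tuple_ball_dist => a.
have adj u v : (h u).2 != (h v).2 -> enorm (val u - val v) <= 1.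
  by move=> uv; have := hE u v; rewrite /cross_polytope_graph uv => /esym/andP[].
set u := point (with0 z) a; set v := point (with0 z) ord0.
have [/eqP uv|uv] := boolP ((h u).2 == (h v).2); last first.
  by apply: le_trans (adj _ _ uv) _; rewrite ler1n.
have [w wu] : exists w : 'I_k.+1, w != (h u).2.
  case: (eqVneq (h u).2 ord0) => [->|u0]; last by exists ord0; rewrite eq_sym.
  by exists ord_max; rewrite -val_eqE /= -lt0n.
have hg : (h (g (true, w))).2 = w by rewrite gK.
have uw : (h u).2 != (h (g (true, w))).2 by rewrite hg eq_sym.
have wv : (h (g (true, w))).2 != (h v).2 by rewrite hg -uv.
apply: le_trans (enorm_dist _ (val (g (true, w))) _) _.
by apply: le_trans (lerD (adj _ _ uw) (adj _ _ wv)) _; rewrite -[1 + 1]/(2%:R) ler_nat.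
Qed.

End ShapesAreLocal.

(** * The limits *)

Lemma lebesgue_mx0 (R : realType) d : @lebesgue_mx R 0 d setT = 1%E.
Proof.
have -> : setT = [set y : 'M[R]_(0, d) | forall i k, (fun _ _ => setT) i k (y i k)].
  by apply/seteqP; split.
by rewrite (@lebesgue_mx_box R 0 d (fun _ _ => setT))// big_ord0.
Qed.

Theorem theorem4p1 (R : realType) (d : nat) (d_gt0 : (0 < d)%N)
    (disp : measure_display) (Omega : measurableType disp)
    (P : probability Omega R)
    (Phi : {RV P >-> configuration R d})
    (Phi_lf : forall w, locally_finite (Phi w))
    (Phi_stationary : stationary P Phi)
    (rho : forall j : nat, 'M[R]_(j, d) -> R)
    (rho_intensity : forall j, (0 < j)%N -> joint_intensity P Phi (rho j))
    (rho_translation : forall j, (0 < j)%N -> translation_invariant (rho j))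
    (rho_unit : forall x : 'rV[R]_d, rho 1%N x = 1)
    (rho_continuous : forall j, (0 < j)%N ->
       {ae @lebesgue_mx R j d, forall y, {for y, continuous (rho j)}})
    (f : nat -> R -> R) (g : forall j : nat, 'M[R]_(j, d) -> R)
    (fg_scaling : forall m,
       scaling_functions (rho m.+1) (f m.+1) (g m.+1))
    (g_continuous : forall m,
       {ae @lebesgue_mx R m d, forall y, tuple_ball y ->
         {for y, continuous (fun z : 'M[R]_(m, d) => g m.+1 (with0 z))}})
    (f_bigO : forall j, (0 < j)%N -> f j.+1 =O_ (0^'+) f j)
    (r : nat -> R) (r_gt0 : forall n, 0 < r n) (r_to0 : r @ \oo --> 0)
    (mu0_cech_gt0 : forall k, (0 < k < d)%N ->
       (0 < mu0_cech (g k.+2) (hollow_simplex k.+2))%E)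
    (mu0_gt0 : forall k, (0 < k)%N ->
       (0 < mu0 (g k.*2.+2) (@cross_polytope_graph k))%E) :
  let Phi_n n w := fset_set (Phi w `&` window n) in
  [/\ forall k, (0 < k < d)%N ->
        ('E_P[fun w => (betti (cech (Phi_n n w) (r n)) k)%:R] *
           ((n%:R * r n ^+ (d * k.+1) * f k.+2 (r n))^-1)%:E)%E
          @[n --> \oo] --> mu0_cech (g k.+2) (hollow_simplex k.+2),
      forall k, (0 < k)%N ->
        ('E_P[fun w => (betti (rips (Phi_n n w) (r n)) k)%:R] *
           ((n%:R * r n ^+ (d * k.*2.+1) * f k.*2.+2 (r n))^-1)%:E)%E
          @[n --> \oo] --> mu0 (g k.*2.+2) (@cross_polytope_graph k),
      ('E_P[fun w => (betti (cech (Phi_n n w) (r n)) 0)%:R] *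
         (n%:R^-1)%:E)%E @[n --> \oo] --> 1%E &
      ('E_P[fun w => (betti (rips (Phi_n n w) (r n)) 0)%:R] *
         (n%:R^-1)%:E)%E @[n --> \oo] --> 1%E].
Proof.
move=> Phi_n.
have limit m (Q : set 'M[R]_(m.+1, d)) Qn := @sandwich_limit R d disp Omega d_gt0 P Phi Phi_lf
  r r_gt0 r_to0 m (rho m.+1) (f m.+1) (g m.+1) (rho m.+2) (f m.+2) (g m.+2)
  (rho_intensity m.+1 isT) (rho_intensity m.+2 isT) (rho_translation m.+1 isT)
  (rho_translation m.+2 isT) (fg_scaling m) (fg_scaling m.+1) (f_bigO m.+1 isT) Q Qn.
have rho1 : rho 1%N 0 = 1 by exact: rho_unit.
have [f1 g1] := scaling_nonvanishing (fg_scaling 0%N) (eq_ind_r (fun t => 0 < t) ltr01 rho1).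
(* In degree 0 the shape is a single point and the normalization [f 1] is 1, the
   intensity being 1. *)
have components (K : forall F : {fset 'rV[R]_d}, R -> {set {set F}}) :
    (forall F q, 0 < q ->
      `|(betti (K F q) 0)%:R - (1`!%:R)^-1 * (tuple_count F (@setT 'M[R]_(1, d)))%:R|
        <= (tuple_count F (near_tuples R d 1 q))%:R :> R) ->
    ('E_P[fun w => (betti (K (Phi_n n w) (r n)) 0)%:R] * (n%:R^-1)%:E)%E @[n --> \oo] --> 1%E.
  move=> Kcount.
  have := @limit 0%N setT (fun=> setT) measurableT (fun=> measurableT)
    (fun _ _ _ => iff_refl _) (fun z _ => (fun i : 'I_0 => match i with Ordinal _ lt => False_ind _ (notF lt) end))
    (fun n w => betti (K (Phi_n n w) (r n)) 0%N) (fun n w => Kcount _ _ (r_gt0 n)).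
  have -> : (\int[@lebesgue_mx R 0 d]_z (\1_(@setT 'M[R]_(1, d)) (with0 z) * g 1%N (with0 z))%:E = 1)%E.
    rewrite (eq_integral (cst 1%E)) => [|z _]; last first.
      by rewrite indicE in_setT mul1r g1 ?rho1// => -[].
    by rewrite integral_cst// mul1e; exact: lebesgue_mx0.
  rewrite mule1 (_ : (1`!)%:R^-1 = 1 :> R); last by rewrite invr1.
  have -> // : (fun n => 'E_P[fun w => (betti (K (Phi_n n w) (r n)) 0)%:R] *
      ((n%:R * r n ^+ (d * 0) * f 1%N (r n))^-1)%:E)%E =
     (fun n => 'E_P[fun w => (betti (K (Phi_n n w) (r n)) 0)%:R] * (n%:R^-1)%:E)%E.
  by apply/funext => n; rewrite muln0 expr0 mulr1 f1 ?mulr1// ltW.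
split.
- move=> k /andP[k0 kd].
  pose Q q := [set y : 'M[R]_(k.+2, d) | complex_iso (cech (points y) q) (hollow_simplex k.+2)].
  have cI : #|'I_k.+2| = k.+2 by rewrite card_ord.
  apply: (limit k.+1 (Q 1) (fun n => Q (r n))).
  + exact: measurable_complex_iso.
  + by move=> n; exact: measurable_complex_iso.
  + by move=> n x z; exact: complex_iso_spread.
  + by move=> z; exact: hollow_shape_near.
  + by move=> n w; exact: cech_betti_count.
- move=> k k0.
  pose Q q := [set y : 'M[R]_(k.*2.+2, d) |
    graph_iso (@geometric_graph R d (points y) q) (@cross_polytope_graph k)].
  have cI : #|{: bool * 'I_k.+1}| = k.*2.+2 by rewrite card_prod card_bool card_ord mul2n doubleS.
  apply: (limit k.*2.+1 (Q 1) (fun n => Q (r n))).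
  + exact: measurable_graph_iso.
  + by move=> n; exact: measurable_graph_iso.
  + by move=> n x z; exact: graph_iso_spread.
  + by move=> z; exact: cross_shape_near.
  + by move=> n w; exact: rips_betti_count.
- by apply: (components (@cech R d)) => F q q_gt0; exact: cech_components_count.
- by apply: (components (@rips R d)) => F q q_gt0; exact: rips_components_count.
Qed.
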